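(* Let $\alpha,\beta,\theta\in\mathbb{C}$ satisfy $0\le\operatorname{Re}\theta<1$, $-1<\operatorname{Re}\alpha<1$, $\alpha\neq0$ and $\operatorname{Re}\beta>-1$. Let the index set $P$, the operator $D$, the bilinear form $\{\cdot,\cdot\}$, the functions $\Phi_p$ and the space $\mathcal{E}$ be as defined in the context. Then: (a) $\Phi_p\in\mathcal{E}$ for $p\in P$. (b) For $f,g\in\mathcal{E}$, $\{Df,g\}=\{f,Dg\}$.
   Context: $F[a,b;c;x]={}_2F_1(a,b;c;x)$ is the Gauss hypergeometric function. Index set: $P$ is the set of $p\in\mathbb{C}$ such that $p-\theta\in\mathbb{Z}$, $\operatorname{Re}(2p+\alpha+\beta+1)>0$ and $1+p+\alpha\neq0$. Bilinear form (on functions on the half-line $x>0$): $$\{f,g\}=\int_0^1 f(x)g(x)(1-x)^\alpha x^\beta\,dx+\frac{\sin((\alpha+\theta)\pi)}{\sin(\theta\pi)}\int_1^\infty f(x)g(x)(x-1)^\alpha x^\beta\,dx .$$ Differential operator: $$D=x(1-x)\frac{d^2}{dx^2}+\bigl(\beta+1-(\alpha+\beta+2)x\bigr)\frac{d}{dx}.$$ Functions $\Phi_p$, $p\in P$, on $[0,\infty)$: $$\Phi_p(x)=\frac{\Gamma(2p+\alpha+\beta+2)}{\Gamma(\beta+1)}\,F\left[-p,\;p+\alpha+\beta+1;\;\beta+1;\;x\right]\qquad (0\le x<1),$$ $$\Phi_p(x)=\frac{\Gamma(1+p+\alpha)}{\Gamma(-p)}\,F\left[p+\alpha+1,\;p+\alpha+\beta+1;\;2p+\alpha+\beta+2;\;\tfrac1x\right]x^{-\alpha-\beta-p-1}\qquad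 (x>1).$$ Space $\mathcal{E}$: the space of functions $f$ on $[0,\infty)$ that are smooth outside the singular points $x=0$, $x=1$, $x=\infty$ and satisfy: (i) at $0$: $f$ is smooth at $0$; (ii) at $1$: there are functions $u,v$ smooth at $1$ such that, near $x=1$, $$f(x)=u(x)+v(x)(1-x)^{-\alpha}\ \ (x<1),\qquad f(x)=\frac{\sin(\theta\pi)}{\sin((\alpha+\theta)\pi)}\,u(x)+v(x)(x-1)^{-\alpha}\ \ (x>1);$$ (iii) at $\infty$: there is a function $w$, smooth at $0$, such that $f(x)=w(1/x)\,x^{-\alpha-\beta-r-1}$ for large $x$, where $r$ is the minimal possible value of $p$ (the element of $P$ for which the integer $p-\theta$ is smallest).
   Formalization: Since the space E divides by sin((α+θ)π) and the form {·,·} divides by sin(θπ), it is assumed that sin((α+θ)π)≠0 (α+θ not an integer) throughout, and that sin(θπ)≠0 (θ≠0) in part (b); otherwise these objects are undefined. *)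

(* Defs.v *)
(* Stdlib reals with Coquelicot. *)
From Stdlib Require Export Reals Factorial.
From Coquelicot Require Export Coquelicot.
Open Scope R_scope.

Definition CDerive (f : R -> C) (x : R) : C :=
  (Derive (fun t => Re (f t)) x, Derive (fun t => Im (f t)) x).

Definition Csmooth (f : R -> C) (x : R) : Prop :=
  forall n : nat,
    ex_derive_n (fun t => Re (f t)) n x /\ ex_derive_n (fun t => Im (f t)) n x.

Definition Csmooth_near (f : R -> C) (a : R) : Prop := locally a (Csmooth f).

(* Improper Riemann integrals; the filters [Fa], [Fb] are the ends of the
   interval of integration. *)
Definition ex_CRInt_gen (f : R -> C) (Fa Fb : (R -> Prop) -> Prop) : Prop :=
  ex_RInt_gen (fun t => Re (f t)) Fa Fb /\ ex_RInt_gen (fun t => Im (f t)) Fa Fb.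

Definition CRInt_gen (f : R -> C) (Fa Fb : (R -> Prop) -> Prop) : C :=
  (RInt_gen (fun t => Re (f t)) Fa Fb, RInt_gen (fun t => Im (f t)) Fa Fb).

Definition Cexp (z : C) : C :=
  (exp (Re z) * cos (Im z), exp (Re z) * sin (Im z)).

Definition Csin (z : C) : C :=
  ((Cexp (Ci * z) - Cexp (- (Ci * z))) / (2 * Ci))%C.

(* x^s for a complex exponent; only meaningful for a base x > 0. *)
Definition Rcpow (x : R) (s : C) : C := Cexp (s * ln x)%C.

(* (a)_n = a (a+1) ... (a+n-1) *)
Fixpoint poch (a : C) (n : nat) : C :=
  match n with
  | O => RtoC 1
  | S m => (poch a m * (a + INR m))%C
  end.

(* Euler's limit n! n^z / (z (z+1) ... (z+n)), which exists for every z that is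
   not a pole.  At a pole z = 0, -1, -2, ... the terms are eventually [/ 0 = 0],
   so that [CGamma z = 0] and [/ CGamma z = 0]: a quotient by [CGamma] at a pole
   has the conventional value of the entire function 1/Gamma. *)
Definition Gamma_seq (z : C) (n : nat) : C :=
  (INR (fact n) * Rcpow (INR n) z / poch z (S n))%C.

Definition CGamma (z : C) : C :=
  (real (Lim_seq (fun n => Re (Gamma_seq z n))),
   real (Lim_seq (fun n => Im (Gamma_seq z n)))).

(* Gauss series F[a,b;c;x], for real |x| < 1 and c not in {0, -1, -2, ...}. *)
Definition hyp_coef (a b c : C) (n : nat) : C :=
  (poch a n * poch b n / (poch c n * INR (fact n)))%C.

Definition hyp2F1 (a b c : C) (x : R) : C :=
  (PSeries (fun n => Re (hyp_coef a b c n)) x,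
   PSeries (fun n => Im (hyp_coef a b c n)) x).

Definition index_set (alpha beta theta p : C) : Prop :=
  (exists m : Z, (p - theta)%C = RtoC (IZR m)) /\
  0 < Re (2 * p + alpha + beta + 1)%C /\
  (1 + p + alpha)%C <> RtoC 0.

Definition min_index (alpha beta theta r : C) : Prop :=
  index_set alpha beta theta r /\
  forall p : C, index_set alpha beta theta p ->
  forall m k : Z, (p - theta)%C = RtoC (IZR m) -> (r - theta)%C = RtoC (IZR k) ->
  (k <= m)%Z.

Definition hyp_op (alpha beta : C) (f : R -> C) (x : R) : C :=
  (x * (1 - x) * CDerive (CDerive f) x
   + (beta + 1 - (alpha + beta + 2) * x) * CDerive f x)%C.

Definition form_integrand_lt1 (alpha beta : C) (f g : R -> C) (x : R) : C :=
  (f x * g x * Rcpow (1 - x) alpha * Rcpow x beta)%C.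

Definition form_integrand_gt1 (alpha beta : C) (f g : R -> C) (x : R) : C :=
  (f x * g x * Rcpow (x - 1) alpha * Rcpow x beta)%C.

(* The two integrals defining [form] converge. *)
Definition ex_form (alpha beta : C) (f g : R -> C) : Prop :=
  ex_CRInt_gen (form_integrand_lt1 alpha beta f g) (at_right 0) (at_left 1) /\
  ex_CRInt_gen (form_integrand_gt1 alpha beta f g)
    (at_right 1) (Rbar_locally p_infty).

(* Meaningful only when [Csin (theta * PI) <> 0]. *)
Definition form (alpha beta theta : C) (f g : R -> C) : C :=
  (CRInt_gen (form_integrand_lt1 alpha beta f g) (at_right 0%R) (at_left 1%R)
   + Csin ((alpha + theta) * PI) / Csin (theta * PI)
     * CRInt_gen (form_integrand_gt1 alpha beta f g)
         (at_right 1%R) (Rbar_locally p_infty))%C.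

(* The value at x = 1 is immaterial: neither [form] nor [space_E] looks at it. *)
Definition Phi (alpha beta p : C) (x : R) : C :=
  if Rlt_dec x 1 then
    (CGamma (2 * p + alpha + beta + 2) / CGamma (beta + 1)
     * hyp2F1 (- p) (p + alpha + beta + 1) (beta + 1) x)%C
  else
    (CGamma (1 + p + alpha) / CGamma (- p)
     * hyp2F1 (p + alpha + 1) (p + alpha + beta + 1)
         (2 * p + alpha + beta + 2) (/ x)
     * Rcpow x (- alpha - beta - p - 1))%C.

(* A function on [0, oo) is represented by any [f : R -> C] extending it; only
   the values on [0, 1) and (1, oo) matter.  Smoothness at the end point 0 is
   the existence of a smooth extension to a neighbourhood of 0.
   Meaningful only when [Csin ((alpha + theta) * PI) <> 0]. *)
Definition space_E (alpha beta theta : C) (f : R -> C) : Prop :=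
  (forall x : R, 0 < x -> x <> 1 -> Csmooth f x) /\
  (exists g : R -> C, Csmooth_near g 0 /\
     locally 0 (fun x => 0 <= x -> f x = g x)) /\
  (exists u v : R -> C, Csmooth_near u 1 /\ Csmooth_near v 1 /\
     locally 1 (fun x =>
       (x < 1 -> f x = (u x + v x * Rcpow (1 - x) (- alpha))%C) /\
       (1 < x -> f x = (Csin (theta * PI) / Csin ((alpha + theta) * PI) * u x
                        + v x * Rcpow (x - 1) (- alpha))%C))) /\
  (exists (r : C) (w : R -> C), min_index alpha beta theta r /\
     Csmooth_near w 0 /\
     Rbar_locally p_infty (fun x =>
       f x = (w (/ x)%R * Rcpow x (- alpha - beta - r - 1))%C)).

(* Main.v *)
From Stdlib Require Import Lra Lia Classical ZArith Wf_nat.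
Require Import Defs.

(* (a) Write [F(z)] for [F[a,b;a+b+s;1-z]].  The Wronskian of two solutions of the
   hypergeometric equation is a known multiple of a constant, so on [0 < z < 1]
   [F(z) = A F[a,b;1-s;z] + B z^s F[a+s,b+s;1+s;z]].  The operator [s - z d/dz] kills
   [z^s] to leading order and maps [F[a,b;c]] to a multiple of [F[a,b;c+1]] by a
   contiguous relation; iterating gives [A] as a limit of ratios of Pochhammer
   symbols, i.e. Gauss's quotient of Gamma values, and Euler's transformation
   exchanges [A] and [B].  With [s = -alpha] this is applied
   in [z = 1 - x] to the left branch of [Phi] and in [z = 1 - 1/x] to the right one;
   Pfaff's transformation identifies the two local bases at [x = 1].  The coefficients
   match by the reflection formula for Gamma, which is Gauss's theorem for
   [F[a,-a;1/2;sin^2 t] = cos(2at)] at [t = pi/2].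

   (b) On each of the intervals (0,1) and (1,oo) the difference of the two integrands
   is the derivative of [x^(beta+1) |1-x|^(alpha+1) (f'g - fg')], up to a sign.  This
   vanishes at 0 and at infinity, and its one-sided limits at 1 differ by the factor
   [sin(theta pi) / sin((alpha+theta) pi)], which the weight of the second integral
   compensates. *)

(** * Limits of complex-valued functions *)

(** The series F[a,b;c;x] is available only for |x| < 1 and no analytic continuation is used:
    identities between solutions come from the differential equation on real intervals, through
    Wronskians and limits at an end point. For Re s <= 0 the term z^s need not vanish at z = 0, so A
    cannot be read off as a value of F there. Raising s by 1 removes this obstruction, and raising
    it n times brings the coefficient within O(1/n) of 1, because only the leading term of the
    series survives as the lower parameter grows. The strip -1 < Re alpha < 1 serves twice: Gauss's
    evaluation applies to both s = -alpha and -s = alpha, and the powers |1-x|^alpha and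
    |1-x|^(-alpha) are both integrable at 1. Connection coefficients are written with reciprocals of
    Gamma values, which vanish at the poles, so degenerate parameters need no separate treatment.
    Pfaff's transformation is needed only for z near 0, since only the germ at x = 1 enters the
    condition there. Convergence of all integrals is part of the claim; it is obtained by comparing
    antiderivatives with powers of a local parameter at each end. *)

Definition Clim {T : Type} (F : (T -> Prop) -> Prop) (f : T -> C) (l : C) : Prop :=
  filterlim (fun t => Re (f t)) F (locally (Re l)) /\
  filterlim (fun t => Im (f t)) F (locally (Im l)).

Lemma C_ext (z w : C) : Re z = Re w -> Im z = Im w -> z = w.
Proof. destruct z, w; simpl; intros; subst; reflexivity. Qed.

Lemma Cmod_le_Re_Im (z : C) : Cmod z <= Rabs (Re z) + Rabs (Im z).
Proof.
  destruct z as [x y]; unfold Cmod; simpl.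
  apply Rsqr_incr_0_var.
  - rewrite Rsqr_sqrt by nra. unfold Rsqr.
    pose proof (Rabs_pos x); pose proof (Rabs_pos y).
    assert (Rabs x * Rabs x = x * x) by (rewrite <- Rabs_mult; apply Rabs_pos_eq; nra).
    assert (Rabs y * Rabs y = y * y) by (rewrite <- Rabs_mult; apply Rabs_pos_eq; nra).
    nra.
  - pose proof (Rabs_pos x); pose proof (Rabs_pos y); lra.
Qed.

Lemma im_le_Cmod (z : C) : Rabs (Im z) <= Cmod z.
Proof. eapply Rle_trans; [apply Rmax_r | apply Rmax_Cmod]. Qed.

Lemma Csqr_norm_neq_0 (z : C) : z <> RtoC 0 -> fst z ^ 2 + snd z ^ 2 <> 0.
Proof.
  intros H E. apply Cmod_gt_0 in H. unfold Cmod in H. rewrite E, sqrt_0 in H. lra.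
Qed.

Section Limits.
Context {T : Type} {F : (T -> Prop) -> Prop} {FF : Filter F}.

Lemma Clim_const (c : C) : Clim F (fun _ => c) c.
Proof. split; apply filterlim_const. Qed.

Lemma Clim_ext_loc (f g : T -> C) (l : C) :
  F (fun t => f t = g t) -> Clim F f l -> Clim F g l.
Proof.
  intros H [H1 H2]; split; [eapply filterlim_ext_loc; [|apply H1] | eapply filterlim_ext_loc; [|apply H2]];
    (eapply filter_imp; [|apply H]); intros t Ht; simpl; rewrite Ht; reflexivity.
Qed.

Lemma filterlim_Rmult (f g : T -> R) (a b : R) :
  filterlim f F (locally a) -> filterlim g F (locally b) ->
  filterlim (fun t => f t * g t) F (locally (a * b)).
Proof. intros Hf Hg; exact (filterlim_comp_2 _ _ _ Hf Hg (filterlim_mult a b)). Qed.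

Lemma filterlim_Rplus (f g : T -> R) (a b : R) :
  filterlim f F (locally a) -> filterlim g F (locally b) ->
  filterlim (fun t => f t + g t) F (locally (a + b)).
Proof. intros Hf Hg; exact (filterlim_comp_2 _ _ _ Hf Hg (filterlim_plus a b)). Qed.

Lemma filterlim_Ropp (f : T -> R) (a : R) :
  filterlim f F (locally a) -> filterlim (fun t => - f t) F (locally (- a)).
Proof. intros Hf; eapply filterlim_comp; [apply Hf | apply (filterlim_opp a)]. Qed.

Lemma Clim_plus (f g : T -> C) (a b : C) :
  Clim F f a -> Clim F g b -> Clim F (fun t => f t + g t)%C (a + b)%C.
Proof.
  intros [Hf1 Hf2] [Hg1 Hg2]; split; simpl.
  - apply filterlim_Rplus; assumption.
  - apply filterlim_Rplus; assumption.
Qed.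

Lemma Clim_opp (f : T -> C) (a : C) : Clim F f a -> Clim F (fun t => - f t)%C (- a)%C.
Proof.
  intros [H1 H2]; split; simpl.
  - eapply filterlim_comp; [apply H1 | apply (filterlim_opp (Re a))].
  - eapply filterlim_comp; [apply H2 | apply (filterlim_opp (Im a))].
Qed.

Lemma Clim_minus (f g : T -> C) (a b : C) :
  Clim F f a -> Clim F g b -> Clim F (fun t => f t - g t)%C (a - b)%C.
Proof. intros Hf Hg; apply (Clim_plus _ _ _ _ Hf (Clim_opp _ _ Hg)). Qed.

Lemma Clim_mult (f g : T -> C) (a b : C) :
  Clim F f a -> Clim F g b -> Clim F (fun t => f t * g t)%C (a * b)%C.
Proof.
  intros [Hf1 Hf2] [Hg1 Hg2]; split; simpl.
  - apply filterlim_Rplus; [|apply filterlim_Ropp]; apply filterlim_Rmult; assumption.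
  - apply filterlim_Rplus; apply filterlim_Rmult; assumption.
Qed.

Lemma Clim_inv (f : T -> C) (a : C) :
  Clim F f a -> a <> RtoC 0 -> Clim F (fun t => / f t)%C (/ a)%C.
Proof.
  intros [H1 H2] Ha.
  assert (Hn : fst a ^ 2 + snd a ^ 2 <> 0).
  { apply Csqr_norm_neq_0, Ha. }
  assert (HI : filterlim (fun t => / (fst (f t) ^ 2 + snd (f t) ^ 2)) F
     (locally (/ (fst a ^ 2 + snd a ^ 2)))).
  { eapply filterlim_comp; [|apply (filterlim_Rbar_inv (fst a ^ 2 + snd a ^ 2))].
    - simpl. apply filterlim_Rplus; repeat apply filterlim_Rmult; try assumption; apply filterlim_const.
    - congruence. }
  split; simpl; unfold Rdiv; apply filterlim_Rmult; try assumption.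
  apply filterlim_Ropp; assumption.
Qed.

Lemma filterlim_zero_le (f g : T -> R) :
  F (fun t => Rabs (f t) <= g t) -> filterlim g F (locally 0) -> filterlim f F (locally 0).
Proof.
  intros H Hg. apply filterlim_locally; intros eps.
  pose proof (proj1 (filterlim_locally _ _) Hg eps) as H2.
  eapply filter_imp; [|apply (filter_and _ _ H H2)].
  intros t [A B]. change (Rabs (f t - 0) < eps). change (Rabs (g t - 0) < eps) in B.
  rewrite Rminus_0_r in *. pose proof (Rle_abs (g t)). lra.
Qed.

Lemma Clim_0_le (f : T -> C) (g : T -> R) :
  F (fun t => Cmod (f t) <= g t) -> filterlim g F (locally 0) -> Clim F f (RtoC 0).
Proof.
  intros H Hg; split; simpl; eapply filterlim_zero_le; try apply Hg;
    (eapply filter_imp; [|apply H]); intros t Ht; simpl in *.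
  - eapply Rle_trans; [apply (re_le_Cmod (f t))| assumption].
  - eapply Rle_trans; [apply (im_le_Cmod (f t))| assumption].
Qed.

Lemma Clim_Cmod_le (f : T -> C) (l : C) :
  Clim F f l -> exists M : R, F (fun t => Cmod (f t) <= M).
Proof.
  intros [H1 H2]. exists (Rabs (Re l) + 1 + (Rabs (Im l) + 1)).
  pose proof (proj1 (filterlim_locally _ _) H1 (mkposreal 1 Rlt_0_1)) as A.
  pose proof (proj1 (filterlim_locally _ _) H2 (mkposreal 1 Rlt_0_1)) as B.
  eapply filter_imp; [|apply (filter_and _ _ A B)].
  intros t [C D]. change (Rabs (Re (f t) - Re l) < 1) in C. change (Rabs (Im (f t) - Im l) < 1) in D.
  eapply Rle_trans; [apply Cmod_le_Re_Im|].
  pose proof (Rabs_triang_inv (Re (f t)) (Re l)); pose proof (Rabs_triang_inv (Im (f t)) (Im l)); lra.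
Qed.

Lemma Clim_Cmod_sub (f : T -> C) (l : C) :
  Clim F f l -> forall eps : posreal, F (fun t => Cmod (f t - l) < eps).
Proof.
  intros [H1 H2] eps.
  pose proof (proj1 (filterlim_locally _ _) H1 (pos_div_2 eps)) as A.
  pose proof (proj1 (filterlim_locally _ _) H2 (pos_div_2 eps)) as B.
  eapply filter_imp; [|apply (filter_and _ _ A B)].
  intros t [C D]. change (Rabs (Re (f t) - Re l) < eps / 2) in C. change (Rabs (Im (f t) - Im l) < eps / 2) in D.
  eapply Rle_lt_trans; [apply Cmod_le_Re_Im|].
  change (Rabs (Re (f t) - Re l) + Rabs (Im (f t) - Im l) < eps). lra.
Qed.

Lemma Clim_neq_0 (f : T -> C) (l : C) :
  Clim F f l -> l <> RtoC 0 -> F (fun t => f t <> RtoC 0).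
Proof.
  intros H Hl. assert (Hp := proj1 (Cmod_gt_0 _) Hl).
  eapply filter_imp; [|apply (Clim_Cmod_sub _ _ H (mkposreal _ Hp))].
  simpl; intros t Ht E. rewrite E in Ht.
  replace (0 - l)%C with (- l)%C in Ht by ring. rewrite Cmod_opp in Ht. lra.
Qed.

End Limits.

Lemma Clim_filter_le {T : Type} (F G : (T -> Prop) -> Prop) (f : T -> C) (l : C) :
  filter_le G F -> Clim F f l -> Clim G f l.
Proof. intros H [A B]; split; eapply filterlim_filter_le_1; eauto. Qed.

Lemma Clim_unique {T : Type} (F : (T -> Prop) -> Prop) {FF : ProperFilter F}
    (f : T -> C) (a b : C) : Clim F f a -> Clim F f b -> a = b.
Proof.
  intros [A B] [A' B']. apply C_ext.
  - exact (filterlim_locally_unique _ _ _ A A').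
  - exact (filterlim_locally_unique _ _ _ B B').
Qed.

Lemma Clim_comp {T U : Type} (F : (T -> Prop) -> Prop) (G : (U -> Prop) -> Prop)
    (g : T -> U) (f : U -> C) (l : C) :
  filterlim g F G -> Clim G f l -> Clim F (fun t => f (g t)) l.
Proof.
  intros H [A B]; split.
  - exact (filterlim_comp _ _ _ g (fun u => Re (f u)) _ _ _ H A).
  - exact (filterlim_comp _ _ _ g (fun u => Im (f u)) _ _ _ H B).
Qed.

(** * Derivatives of complex-valued functions *)

Definition is_Cderive (f : R -> C) (x : R) (l : C) : Prop :=
  is_derive (fun t => Re (f t)) x (Re l) /\ is_derive (fun t => Im (f t)) x (Im l).

Lemma is_Cderive_eq (f : R -> C) (x : R) (l m : C) :
  is_Cderive f x l -> l = m -> is_Cderive f x m.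
Proof. intros H <-; exact H. Qed.

Lemma is_derive_eq (f : R -> R) (x l m : R) : is_derive f x l -> l = m -> is_derive f x m.
Proof. intros H <-; exact H. Qed.

Lemma is_Cderive_unique (f : R -> C) (x : R) (l : C) : is_Cderive f x l -> CDerive f x = l.
Proof. intros [A B]; apply C_ext; apply is_derive_unique; assumption. Qed.

Lemma is_Cderive_ext_loc (f g : R -> C) (x : R) (l : C) :
  locally x (fun t => f t = g t) -> is_Cderive f x l -> is_Cderive g x l.
Proof.
  intros H [A B]; split; (eapply is_derive_ext_loc; [|eassumption]);
    (eapply filter_imp; [|apply H]); intros t Ht; simpl; rewrite Ht; reflexivity.
Qed.

Lemma is_Cderive_Clim (f : R -> C) (x : R) (l : C) : is_Cderive f x l -> Clim (locally x) f (f x).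
Proof.
  intros [A B]; split.
  - apply (ex_derive_continuous (fun t => Re (f t))); eexists; apply A.
  - apply (ex_derive_continuous (fun t => Im (f t))); eexists; apply B.
Qed.

Lemma is_Cderive_const (c : C) (x : R) : is_Cderive (fun _ => c) x (RtoC 0).
Proof. split; apply (is_derive_const (V := R_NormedModule)). Qed.

Lemma is_Cderive_RtoC (f : R -> R) (x l : R) :
  is_derive f x l -> is_Cderive (fun t => RtoC (f t)) x (RtoC l).
Proof.
  intros H; split; [exact H|].
  exact (is_derive_const (V := R_NormedModule) 0 x).
Qed.

Lemma is_Cderive_id (x : R) : is_Cderive RtoC x (RtoC 1).
Proof. apply (is_Cderive_RtoC (fun t => t)), (is_derive_id (K := R_AbsRing)). Qed.

Lemma is_Cderive_plus (f g : R -> C) (x : R) (a b : C) :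
  is_Cderive f x a -> is_Cderive g x b -> is_Cderive (fun t => f t + g t)%C x (a + b)%C.
Proof.
  intros [A B] [A' B']; split.
  - apply (is_derive_plus (V := R_NormedModule) _ _ _ _ _ A A').
  - apply (is_derive_plus (V := R_NormedModule) _ _ _ _ _ B B').
Qed.

Lemma is_Cderive_opp (f : R -> C) (x : R) (a : C) :
  is_Cderive f x a -> is_Cderive (fun t => - f t)%C x (- a)%C.
Proof.
  intros [A B]; split.
  - apply (is_derive_opp (V := R_NormedModule) _ _ _ A).
  - apply (is_derive_opp (V := R_NormedModule) _ _ _ B).
Qed.

Lemma is_Cderive_minus (f g : R -> C) (x : R) (a b : C) :
  is_Cderive f x a -> is_Cderive g x b -> is_Cderive (fun t => f t - g t)%C x (a - b)%C.
Proof. intros Hf Hg; apply (is_Cderive_plus _ _ _ _ _ Hf (is_Cderive_opp _ _ _ Hg)). Qed.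

Lemma is_derive_Rmult (f g : R -> R) (x a b : R) :
  is_derive f x a -> is_derive g x b -> is_derive (fun t => f t * g t) x (a * g x + f x * b).
Proof. intros A B; apply (is_derive_mult _ _ _ _ _ A B), Rmult_comm. Qed.

Lemma is_Cderive_mult (f g : R -> C) (x : R) (a b : C) :
  is_Cderive f x a -> is_Cderive g x b ->
  is_Cderive (fun t => f t * g t)%C x (a * g x + f x * b)%C.
Proof.
  intros [A B] [A' B']; split.
  - eapply is_derive_eq.
    + apply (is_derive_minus (V := R_NormedModule) _ _ _ _ _
        (is_derive_Rmult _ _ _ _ _ A A') (is_derive_Rmult _ _ _ _ _ B B')).
    + unfold minus, plus, opp, Re, Im; simpl; ring.
  - eapply is_derive_eq.
    + apply (is_derive_plus (V := R_NormedModule) _ _ _ _ _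
        (is_derive_Rmult _ _ _ _ _ A B') (is_derive_Rmult _ _ _ _ _ B A')).
    + unfold plus, Re, Im; simpl; ring.
Qed.

Lemma is_Cderive_scal (c : C) (f : R -> C) (x : R) (a : C) :
  is_Cderive f x a -> is_Cderive (fun t => c * f t)%C x (c * a)%C.
Proof.
  intros H; eapply is_Cderive_eq; [apply (is_Cderive_mult _ _ _ _ _ (is_Cderive_const c x) H)|].
  cbv beta; ring.
Qed.

Lemma is_Cderive_comp (f : R -> C) (g : R -> R) (x : R) (a : C) (b : R) :
  is_Cderive f (g x) a -> is_derive g x b -> is_Cderive (fun t => f (g t)) x (b * a)%C.
Proof.
  intros [A B] H; split.
  - eapply is_derive_eq; [apply (is_derive_comp (fun t => Re (f t)) g _ _ _ A H)|].
    unfold scal, mult, Re, Im; simpl; unfold mult; simpl; ring.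
  - eapply is_derive_eq; [apply (is_derive_comp (fun t => Im (f t)) g _ _ _ B H)|].
    unfold scal, mult, Re, Im; simpl; unfold mult; simpl; ring.
Qed.

Lemma is_Cderive_inv (f : R -> C) (x : R) (a : C) :
  is_Cderive f x a -> f x <> RtoC 0 ->
  is_Cderive (fun t => / f t)%C x (- a * (/ f x * / f x))%C.
Proof.
  intros [A B] H.
  set (n := fun t => fst (f t) ^ 2 + snd (f t) ^ 2).
  assert (Hn : n x <> 0).
  { apply Csqr_norm_neq_0, H. }
  assert (Dn : is_derive n x (2 * Re a * Re (f x) + 2 * Im a * Im (f x))).
  { unfold n. eapply is_derive_eq.
    - apply (is_derive_plus (V := R_NormedModule)).
      + apply is_derive_pow, A.
      + apply is_derive_pow, B.
    - unfold plus, Re, Im; simpl; ring. }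
  pose proof (is_derive_inv n x _ Dn Hn) as Di.
  split; simpl.
  - eapply is_derive_eq; [apply (is_derive_Rmult _ _ _ _ _ A Di)|].
    unfold n, Re, Im in *; simpl in *; field; nra.
  - eapply is_derive_eq.
    + apply (is_derive_Rmult (fun t => - Im (f t)) _ _ _ _
        (is_derive_opp (V := R_NormedModule) _ _ _ B) Di).
    + unfold opp, n, Re, Im in *; simpl in *; field; nra.
Qed.

(** Intervals of every kind, bounded or not, so that mean value arguments apply alike to (0,1), to
    (1,oo) and to one-sided neighbourhoods. *)
Definition convex (D : R -> Prop) : Prop := forall x y z, D x -> D y -> x <= z <= y -> D z.

Lemma is_Cderive_0_const (f : R -> C) (D : R -> Prop) :
  convex D ->
  (forall x, D x -> is_Cderive f x (RtoC 0)) ->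
  forall x y, D x -> D y -> f x = f y.
Proof.
  intros HD H.
  assert (W : forall x y, D x -> D y -> x < y -> f x = f y).
  { intros x y Hx Hy Hxy. apply C_ext.
    - apply (eq_is_derive (fun t => Re (f t)) x y); [|assumption].
      intros t Ht; apply (proj1 (H t (HD _ _ _ Hx Hy Ht))).
    - apply (eq_is_derive (fun t => Im (f t)) x y); [|assumption].
      intros t Ht; apply (proj2 (H t (HD _ _ _ Hx Hy Ht))). }
  intros x y Hx Hy. destruct (Rtotal_order x y) as [L|[->|L]]; auto. symmetry; auto.
Qed.

(** * Complex exponentials and powers *)

Lemma Cexp_plus (z w : C) : Cexp (z + w)%C = (Cexp z * Cexp w)%C.
Proof.
  apply C_ext; unfold Cexp; simpl; rewrite exp_plus, ?cos_plus, ?sin_plus; unfold Re, Im; ring.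
Qed.

Lemma Cexp_0 : Cexp (RtoC 0) = RtoC 1.
Proof. apply C_ext; unfold Cexp; simpl; rewrite exp_0, ?cos_0, ?sin_0; ring. Qed.

Lemma Cmod_Cexp (z : C) : Cmod (Cexp z) = exp (Re z).
Proof.
  unfold Cmod, Cexp; simpl fst; simpl snd.
  replace ((exp (Re z) * cos (Im z)) ^ 2 + (exp (Re z) * sin (Im z)) ^ 2)
    with (exp (Re z) * exp (Re z) * (Rsqr (sin (Im z)) + Rsqr (cos (Im z)))) by (unfold Rsqr; ring).
  rewrite sin2_cos2, Rmult_1_r. apply sqrt_square, Rlt_le, exp_pos.
Qed.

Lemma Cexp_neq_0 (z : C) : Cexp z <> RtoC 0.
Proof. apply Cmod_gt_0. rewrite Cmod_Cexp. apply exp_pos. Qed.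

Lemma is_Cderive_Cexp (f : R -> C) (x : R) (a : C) :
  is_Cderive f x a -> is_Cderive (fun t => Cexp (f t)) x (a * Cexp (f x))%C.
Proof.
  intros [A B].
  assert (E : is_derive (fun t => exp (Re (f t))) x (Re a * exp (Re (f x)))).
  { apply (is_derive_comp exp (fun t => Re (f t))); [apply is_derive_exp | exact A]. }
  assert (S : is_derive (fun t => sin (Im (f t))) x (Im a * cos (Im (f x)))).
  { apply (is_derive_comp sin (fun t => Im (f t))); [apply is_derive_sin | exact B]. }
  assert (K : is_derive (fun t => cos (Im (f t))) x (Im a * - sin (Im (f x)))).
  { apply (is_derive_comp cos (fun t => Im (f t))); [apply is_derive_cos | exact B]. }
  split.
  - eapply is_derive_eq; [apply (is_derive_Rmult _ _ _ _ _ E K)|].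
    unfold Re, Im; simpl; unfold Re, Im; ring.
  - eapply is_derive_eq; [apply (is_derive_Rmult _ _ _ _ _ E S)|].
    unfold Re, Im; simpl; unfold Re, Im; ring.
Qed.

Lemma Rcpow_plus (x : R) (s t : C) : Rcpow x (s + t)%C = (Rcpow x s * Rcpow x t)%C.
Proof. unfold Rcpow. rewrite <- Cexp_plus. f_equal; ring. Qed.

Lemma Rcpow_0 (x : R) : Rcpow x (RtoC 0) = RtoC 1.
Proof. unfold Rcpow. rewrite <- Cexp_0. f_equal; ring. Qed.

Lemma Rcpow_neq_0 (x : R) (s : C) : Rcpow x s <> RtoC 0.
Proof. apply Cexp_neq_0. Qed.

Lemma Rcpow_opp (x : R) (s : C) : Rcpow x (- s)%C = (/ Rcpow x s)%C.
Proof.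
  pose proof (Rcpow_neq_0 x s).
  assert (E : (Rcpow x s * Rcpow x (- s) = RtoC 1)%C).
  { rewrite <- Rcpow_plus, <- (Rcpow_0 x). f_equal; ring. }
  rewrite <- (Cmult_1_l (/ Rcpow x s)), <- E. field; assumption.
Qed.

Lemma Rcpow_opp_l (x : R) (s : C) : (Rcpow x (- s) * Rcpow x s = RtoC 1)%C.
Proof. rewrite Rcpow_opp; field; apply Rcpow_neq_0. Qed.

Lemma Rcpow_1 (x : R) : 0 < x -> Rcpow x (RtoC 1) = RtoC x.
Proof.
  intros Hx. unfold Rcpow. rewrite Cmult_1_l.
  apply C_ext; unfold Cexp; simpl; rewrite exp_ln, ?cos_0, ?sin_0 by assumption; ring.
Qed.

Lemma Rcpow_mult (x y : R) (s : C) : 0 < x -> 0 < y -> Rcpow (x * y) s = (Rcpow x s * Rcpow y s)%C.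
Proof.
  intros; unfold Rcpow. rewrite ln_mult by assumption. rewrite <- Cexp_plus, RtoC_plus. f_equal; ring.
Qed.

Lemma Rcpow_inv (x : R) (s : C) : 0 < x -> Rcpow (/ x) s = Rcpow x (- s)%C.
Proof. intros; unfold Rcpow. rewrite ln_Rinv by assumption. rewrite RtoC_opp; f_equal; ring. Qed.

Lemma Rcpow_1_l (s : C) : Rcpow 1 s = RtoC 1.
Proof. unfold Rcpow. rewrite ln_1, Cmult_0_r. apply Cexp_0. Qed.

Lemma Cmod_Rcpow (x : R) (s : C) : Cmod (Rcpow x s) = Rpower x (Re s).
Proof. unfold Rcpow, Rpower. rewrite Cmod_Cexp, re_scal_r. reflexivity. Qed.

Lemma is_Cderive_Rcpow (s : C) (x : R) :
  0 < x -> is_Cderive (fun t => Rcpow t s) x (s * Rcpow x (s - 1))%C.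
Proof.
  intros Hx. eapply is_Cderive_eq.
  - apply is_Cderive_Cexp, is_Cderive_scal, is_Cderive_RtoC, is_derive_ln, Hx.
  - replace (s - 1)%C with (s + - RtoC 1)%C by ring.
    rewrite Rcpow_plus, Rcpow_opp, Rcpow_1, RtoC_inv by lra. unfold Rcpow. ring.
Qed.

Lemma is_Cderive_Rcpow_comp (s : C) (g : R -> R) (x b : R) :
  0 < g x -> is_derive g x b ->
  is_Cderive (fun t => Rcpow (g t) s) x (b * s * Rcpow (g x) (s - 1))%C.
Proof.
  intros Hx Hg. eapply is_Cderive_eq.
  - apply (is_Cderive_comp (fun t => Rcpow t s) g x _ _ (is_Cderive_Rcpow s _ Hx) Hg).
  - ring.
Qed.

Lemma Rcpow_minus_1 (x : R) (s : C) : 0 < x -> Rcpow x (s - 1)%C = (Rcpow x s / x)%C.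
Proof.
  intros Hx. replace (s - 1)%C with (s + - RtoC 1)%C by ring.
  rewrite Rcpow_plus, Rcpow_opp, Rcpow_1 by assumption. reflexivity.
Qed.

Lemma filterlim_Rpower_0 (k : R) : 0 < k ->
  filterlim (fun x => Rpower x k) (at_right 0) (locally 0).
Proof.
  intros Hk. unfold Rpower.
  eapply filterlim_comp with (G := Rbar_locally m_infty).
  - eapply filterlim_comp; [apply is_lim_ln_0|].
    pose proof (filterlim_Rbar_mult_l k m_infty) as H.
    replace (Rbar_mult k m_infty) with m_infty in H; [exact H|].
    simpl. destruct (Rle_dec 0 k) as [r|]; [|lra].
    destruct (Rle_lt_or_eq_dec 0 k r); [reflexivity|lra].
  - apply (is_lim_exp_m).
Qed.

Lemma Clim_Rcpow_0 (s : C) : 0 < Re s -> Clim (at_right 0) (fun x => Rcpow x s) (RtoC 0).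
Proof.
  intros Hs. apply (Clim_0_le _ (fun x => Rpower x (Re s))).
  - exists (mkposreal 1 Rlt_0_1). intros y _ _. rewrite Cmod_Rcpow; lra.
  - apply filterlim_Rpower_0, Hs.
Qed.

(** * Smoothness *)

(** The derivative is supplied on a neighbourhood at each stage. Sums, products, inverses and
    compositions then follow by induction on [k], without formulas for higher derivatives. *)
Fixpoint Cdiffn (k : nat) (f : R -> C) (x : R) : Prop :=
  match k with
  | O => True
  | S k => exists f' : R -> C, locally x (fun y => is_Cderive f y (f' y)) /\ Cdiffn k f' x
  end.

Lemma Cdiffn_ext_loc (k : nat) (f g : R -> C) (x : R) :
  locally x (fun t => f t = g t) -> Cdiffn k f x -> Cdiffn k g x.
Proof.
  destruct k as [|k]; [easy|]. intros H [f' [D D']]; exists f'; split; [|assumption].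
  eapply filter_imp; [|apply (filter_and _ _ (locally_locally _ _ H) D)].
  intros y [A B]; eapply is_Cderive_ext_loc; eauto.
Qed.

Lemma Cdiffn_S (k : nat) (f : R -> C) (x : R) : Cdiffn (S k) f x -> Cdiffn k f x.
Proof.
  revert f; induction k as [|k IH]; [easy|].
  intros f [f' [D D']]; exists f'; split; [assumption | apply IH, D'].
Qed.

Lemma Cdiffn_const (c : C) (k : nat) (x : R) : Cdiffn k (fun _ => c) x.
Proof.
  revert c; induction k as [|k IH]; [easy|]; intros c.
  exists (fun _ => RtoC 0); split; [|apply IH].
  apply filter_forall; intros y; apply is_Cderive_const.
Qed.

Lemma Cdiffn_RtoC (k : nat) (x : R) : Cdiffn k RtoC x.
Proof.
  destruct k as [|k]; [easy|]. exists (fun _ => RtoC 1); split; [|apply Cdiffn_const].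
  apply filter_forall; intros y; apply is_Cderive_id.
Qed.

Lemma Cdiffn_plus (k : nat) (f g : R -> C) (x : R) :
  Cdiffn k f x -> Cdiffn k g x -> Cdiffn k (fun t => f t + g t)%C x.
Proof.
  revert f g; induction k as [|k IH]; [easy|].
  intros f g [f' [Df Df']] [g' [Dg Dg']]. exists (fun t => f' t + g' t)%C; split; [|auto].
  eapply filter_imp; [|apply (filter_and _ _ Df Dg)]. intros y [A B]; apply is_Cderive_plus; assumption.
Qed.

Lemma Cdiffn_mult (k : nat) (f g : R -> C) (x : R) :
  Cdiffn k f x -> Cdiffn k g x -> Cdiffn k (fun t => f t * g t)%C x.
Proof.
  revert f g; induction k as [|k IH]; [easy|].
  intros f g Hf Hg. pose proof (Cdiffn_S _ _ _ Hf); pose proof (Cdiffn_S _ _ _ Hg).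
  destruct Hf as [f' [Df Df']]; destruct Hg as [g' [Dg Dg']].
  exists (fun t => f' t * g t + f t * g' t)%C; split; [|apply Cdiffn_plus; auto].
  eapply filter_imp; [|apply (filter_and _ _ Df Dg)]. intros y [A B]; apply is_Cderive_mult; assumption.
Qed.

Lemma Cdiffn_inv (k : nat) (f : R -> C) (x : R) :
  Cdiffn k f x -> f x <> RtoC 0 -> Cdiffn k (fun t => / f t)%C x.
Proof.
  revert f; induction k as [|k IH]; [easy|].
  intros f Hf Hx. pose proof (Cdiffn_S _ _ _ Hf) as Hk. destruct Hf as [f' [D D']].
  exists (fun t => - 1 * f' t * (/ f t * / f t))%C; split.
  - pose proof (is_Cderive_Clim _ _ _ (locally_singleton _ _ D)) as L.
    eapply filter_imp; [|apply (filter_and _ _ D (Clim_neq_0 _ _ L Hx))].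
    intros y [A B]. eapply is_Cderive_eq; [apply is_Cderive_inv; eassumption | ring].
  - repeat apply Cdiffn_mult; auto; apply Cdiffn_const.
Qed.

Lemma locally_comp_is_derive (P : R -> Prop) (g : R -> R) (x l : R) :
  is_derive g x l -> locally (g x) P -> locally x (fun t => P (g t)).
Proof.
  intros D H. apply (ex_derive_continuous g x); [eexists; exact D | exact H].
Qed.

Lemma Cdiffn_comp (k : nat) (f : R -> C) (g : R -> R) (x : R) :
  Cdiffn k f (g x) -> Cdiffn k (fun t => RtoC (g t)) x -> Cdiffn k (fun t => f (g t)) x.
Proof.
  revert f; induction k as [|k IH]; [easy|].
  intros f [f' [Df Df']] Hg. pose proof (Cdiffn_S _ _ _ Hg) as Hk.
  destruct Hg as [g' [Dg Dg']].
  (* The derivative supplied by [Cdiffn] is complex-valued; as the derivative of a real function it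
     has zero imaginary part. *)
  assert (Rg : locally x (fun y => is_derive g y (Re (g' y)) /\ g' y = RtoC (Re (g' y)))).
  { eapply filter_imp; [|apply Dg]. intros y [A B]; split; [exact A|].
    apply C_ext; [reflexivity|].
    change (Im (g' y) = 0). rewrite <- (is_derive_unique _ _ _ B). exact (Derive_const 0 y). }
  exists (fun t => g' t * f' (g t))%C; split.
  - pose proof (locally_comp_is_derive _ _ _ _ (proj1 (locally_singleton _ _ Rg)) Df) as L.
    eapply filter_imp; [|apply (filter_and _ _ L Rg)]. intros y [A [B E]].
    rewrite E. apply is_Cderive_comp; assumption.
  - apply Cdiffn_mult; auto.
Qed.

Lemma locally_lt (a x : R) : x < a -> locally x (fun t => t < a).
Proof. intros H. apply (open_lt a x H). Qed.

Lemma locally_gt (a x : R) : a < x -> locally x (fun t => a < t).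
Proof. intros H. apply (open_gt a x H). Qed.

Lemma Cdiffn_Rcpow (k : nat) (s : C) (x : R) : 0 < x -> Cdiffn k (fun t => Rcpow t s) x.
Proof.
  intros Hx; revert s; induction k as [|k IH]; [easy|]; intros s.
  exists (fun t => s * Rcpow t (s - 1))%C; split.
  - eapply filter_imp; [|apply (locally_gt 0 x Hx)]. intros y Hy; apply is_Cderive_Rcpow, Hy.
  - apply Cdiffn_mult; [apply Cdiffn_const | apply IH].
Qed.

Lemma Cdiffn_ex_derive_n (n : nat) (f : R -> C) (x : R) :
  Cdiffn n f x ->
  ex_derive_n (fun t => Re (f t)) n x /\ ex_derive_n (fun t => Im (f t)) n x.
Proof.
  (* [Derive_n] adds the last derivative on the outside, while [Cdiffn] strips the first one from
     the inside; [W] passes from one to the other. *)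
  assert (W : forall (h h' : R -> R) m y, locally y (fun t => is_derive h t (h' t)) ->
     ex_derive_n h' (S m) y -> ex_derive_n h (S (S m)) y).
  { intros h h' m y L E. simpl.
    apply (ex_derive_ext (Derive_n (Derive h) m)).
    - intros t. rewrite (Derive_n_comp h m 1). replace (m + 1)%nat with (S m) by lia. reflexivity.
    - apply (ex_derive_n_ext_loc h' (Derive h) (S m) y); [|exact E].
      eapply filter_imp; [|apply L]. intros t Ht. symmetry. apply is_derive_unique, Ht. }
  revert f; induction n as [|[|n] IH]; intros f H; [easy| |].
  - destruct H as [f' [D _]]. apply locally_singleton in D. destruct D as [A B].
    split; eexists; eassumption.
  - destruct H as [f' [D D']]. destruct (IH _ D') as [A B].
    split.
    + apply (W _ (fun t => Re (f' t))); [|exact A].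
      eapply filter_imp; [|apply D]. intros t [? ?]; assumption.
    + apply (W _ (fun t => Im (f' t))); [|exact B].
      eapply filter_imp; [|apply D]. intros t [? ?]; assumption.
Qed.

Definition smooth_at (f : R -> C) (x : R) : Prop := forall k, Cdiffn k f x.

Lemma smooth_at_Csmooth (f : R -> C) (x : R) : smooth_at f x -> Csmooth f x.
Proof. intros H n; apply Cdiffn_ex_derive_n, H. Qed.

(** * Power series with complex coefficients *)

(** [hyp2F1 a b c] is convertible to [CPSeries (hyp_coef a b c)]. *)
Definition CPSeries (h : nat -> C) (x : R) : C :=
  (PSeries (fun n => Re (h n)) x, PSeries (fun n => Im (h n)) x).

(** At least 1, not equal to 1: terminating series have infinite radius. *)
Definition unit_radius (h : nat -> C) : Prop :=
  Rbar_le 1 (CV_radius (fun n => Re (h n))) /\ Rbar_le 1 (CV_radius (fun n => Im (h n))).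

(** The radius is the least upper bound of the [r] at which the terms stay bounded; a radius
    [rho < 1] is refuted by the point midway between [Rmax rho 0] and 1. *)
Lemma Rbar_le_1_CV_radius (a : nat -> R) :
  (forall r, 0 < r < 1 -> exists M, forall n, Rabs (a n) * r ^ n <= M) ->
  Rbar_le 1 (CV_radius a).
Proof.
  intros H. pose proof (CV_radius_bounded a) as [UB _].
  apply Rbar_not_lt_le; intros L.
  destruct (CV_radius a) as [rho| |]; simpl in L; try easy.
  - set (r := (Rmax rho 0 + 1) / 2).
    assert (0 <= Rmax rho 0 < 1) by (split; [apply Rmax_r | apply Rmax_lub_lt; lra]).
    assert (Hr : 0 < r < 1) by (unfold r; lra).
    destruct (H r Hr) as [M HM].
    assert (E : Rbar_le r rho).
    { apply UB. exists M. intros n. rewrite Rabs_mult, (Rabs_pos_eq (r ^ n)); [apply HM|].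
      apply pow_le; lra. }
    simpl in E. pose proof (Rmax_l rho 0). unfold r in E; lra.
  - destruct (H (/ 2)) as [M HM]; [lra|].
    assert (E : Rbar_le (/ 2) m_infty).
    { apply UB. exists M. intros n. rewrite Rabs_mult, (Rabs_pos_eq ((/ 2) ^ n)); [apply HM|].
      apply pow_le; lra. }
    exact E.
Qed.

Lemma unit_radius_bound (h : nat -> C) :
  (forall r, 0 < r < 1 -> exists M, forall n, Cmod (h n) * r ^ n <= M) -> unit_radius h.
Proof.
  intros H; split; apply Rbar_le_1_CV_radius; intros r Hr; destruct (H r Hr) as [M HM];
    exists M; intros n; (eapply Rle_trans; [|apply (HM n)]);
    (apply Rmult_le_compat_r; [apply pow_le; lra|]); [apply re_le_Cmod | apply im_le_Cmod].
Qed.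

Lemma Rbar_le_1_PS_plus (a b : nat -> R) :
  Rbar_le 1 (CV_radius a) -> Rbar_le 1 (CV_radius b) -> Rbar_le 1 (CV_radius (PS_plus a b)).
Proof.
  intros Ha Hb. eapply Rbar_le_trans; [|apply CV_radius_plus].
  apply Rbar_min_case; assumption.
Qed.

Lemma Rbar_le_1_PS_scal (c : R) (a : nat -> R) :
  Rbar_le 1 (CV_radius a) -> Rbar_le 1 (CV_radius (PS_scal c a)).
Proof.
  intros Ha. destruct (Req_dec c 0) as [->|Hc].
  - apply Rbar_le_1_CV_radius. intros r Hr. exists 0. intros n. unfold PS_scal, scal; simpl.
    unfold mult; simpl. rewrite Rmult_0_l, Rabs_R0. lra.
  - rewrite CV_radius_scal by assumption. exact Ha.
Qed.

Lemma unit_radius_plus (h g : nat -> C) :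
  unit_radius h -> unit_radius g -> unit_radius (fun n => h n + g n)%C.
Proof.
  intros [A B] [A' B']; split.
  - exact (Rbar_le_1_PS_plus _ _ A A').
  - exact (Rbar_le_1_PS_plus _ _ B B').
Qed.

Lemma PS_scal_Re (c : C) (h : nat -> C) (n : nat) :
  PS_plus (PS_scal (Re c) (fun n => Re (h n))) (PS_scal (- Im c) (fun n => Im (h n))) n = Re (c * h n).
Proof. unfold PS_plus, PS_scal, plus, scal; simpl. unfold mult, Re, Im; simpl. ring. Qed.

Lemma PS_scal_Im (c : C) (h : nat -> C) (n : nat) :
  PS_plus (PS_scal (Re c) (fun n => Im (h n))) (PS_scal (Im c) (fun n => Re (h n))) n = Im (c * h n).
Proof. unfold PS_plus, PS_scal, plus, scal; simpl. unfold mult, Re, Im; simpl. ring. Qed.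

Lemma unit_radius_scal (c : C) (h : nat -> C) :
  unit_radius h -> unit_radius (fun n => c * h n)%C.
Proof.
  intros [A B]; split.
  - rewrite <- (CV_radius_ext _ _ (PS_scal_Re c h)).
    apply Rbar_le_1_PS_plus; apply Rbar_le_1_PS_scal; assumption.
  - rewrite <- (CV_radius_ext _ _ (PS_scal_Im c h)).
    apply Rbar_le_1_PS_plus; apply Rbar_le_1_PS_scal; assumption.
Qed.

Definition Cshift (h : nat -> C) (n : nat) : C :=
  match n with O => RtoC 0 | S m => h m end.

Definition Cderiv_coef (h : nat -> C) (n : nat) : C := (INR (S n) * h (S n))%C.

Lemma unit_radius_shift (h : nat -> C) : unit_radius h -> unit_radius (Cshift h).
Proof.
  intros [A B]; split.
  - rewrite <- (CV_radius_ext (PS_incr_1 (fun n => Re (h n)))); [|intros [|n]; reflexivity].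
    rewrite CV_radius_incr_1; exact A.
  - rewrite <- (CV_radius_ext (PS_incr_1 (fun n => Im (h n)))); [|intros [|n]; reflexivity].
    rewrite CV_radius_incr_1; exact B.
Qed.

Lemma PS_derive_Re (h : nat -> C) (n : nat) :
  PS_derive (fun n => Re (h n)) n = Re (Cderiv_coef h n).
Proof. unfold PS_derive, Cderiv_coef. rewrite re_scal_l. reflexivity. Qed.

Lemma PS_derive_Im (h : nat -> C) (n : nat) :
  PS_derive (fun n => Im (h n)) n = Im (Cderiv_coef h n).
Proof. unfold PS_derive, Cderiv_coef. rewrite im_scal_l. reflexivity. Qed.

Lemma unit_radius_deriv (h : nat -> C) : unit_radius h -> unit_radius (Cderiv_coef h).
Proof.
  intros [A B]; split.
  - rewrite <- (CV_radius_ext _ _ (PS_derive_Re h)), CV_radius_derive; exact A.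
  - rewrite <- (CV_radius_ext _ _ (PS_derive_Im h)), CV_radius_derive; exact B.
Qed.

Lemma unit_radius_lt (a : nat -> R) (x : R) :
  Rbar_le 1 (CV_radius a) -> Rabs x < 1 -> Rbar_lt (Rabs x) (CV_radius a).
Proof. intros H Hx. eapply Rbar_lt_le_trans; [|exact H]. exact Hx. Qed.

Lemma CPSeries_ext (h g : nat -> C) (x : R) : (forall n, h n = g n) -> CPSeries h x = CPSeries g x.
Proof.
  intros E; apply C_ext; simpl; apply PSeries_ext; intros n; rewrite E; reflexivity.
Qed.

Lemma CPSeries_plus (h g : nat -> C) (x : R) :
  unit_radius h -> unit_radius g -> Rabs x < 1 ->
  CPSeries (fun n => h n + g n)%C x = (CPSeries h x + CPSeries g x)%C.
Proof.
  intros [A B] [A' B'] Hx; apply C_ext; simpl.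
  - apply (PSeries_plus (fun n => Re (h n)) (fun n => Re (g n))); apply CV_radius_inside, unit_radius_lt; assumption.
  - apply (PSeries_plus (fun n => Im (h n)) (fun n => Im (g n))); apply CV_radius_inside, unit_radius_lt; assumption.
Qed.

Lemma CPSeries_scal (c : C) (h : nat -> C) (x : R) :
  unit_radius h -> Rabs x < 1 -> CPSeries (fun n => c * h n)%C x = (c * CPSeries h x)%C.
Proof.
  intros [A B] Hx; unfold CPSeries.
  rewrite <- (PSeries_ext _ _ x (PS_scal_Re c h)), <- (PSeries_ext _ _ x (PS_scal_Im c h)).
  rewrite !PSeries_plus, !PSeries_scal
    by (apply CV_radius_inside, unit_radius_lt; [apply Rbar_le_1_PS_scal|]; assumption).
  apply C_ext; simpl; unfold Re, Im; ring.
Qed.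

Lemma CPSeries_shift (h : nat -> C) (x : R) : CPSeries (Cshift h) x = (x * CPSeries h x)%C.
Proof.
  apply C_ext; rewrite ?re_scal_l, ?im_scal_l; simpl.
  - rewrite <- PSeries_incr_1. apply PSeries_ext. intros [|n]; reflexivity.
  - rewrite <- PSeries_incr_1. apply PSeries_ext. intros [|n]; reflexivity.
Qed.

Lemma CPSeries_zero (x : R) : CPSeries (fun _ => RtoC 0) x = RtoC 0.
Proof. apply C_ext; simpl; apply PSeries_const_0. Qed.

Lemma CPSeries_at_0 (h : nat -> C) : CPSeries h 0 = h O.
Proof. apply C_ext; simpl; apply PSeries_0. Qed.

Lemma is_Cderive_CPSeries (h : nat -> C) (x : R) :
  unit_radius h -> Rabs x < 1 -> is_Cderive (CPSeries h) x (CPSeries (Cderiv_coef h) x).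
Proof.
  intros [A B] Hx; split.
  - change (is_derive (PSeries (fun n => Re (h n))) x (PSeries (fun n => Re (Cderiv_coef h n)) x)).
    rewrite <- (PSeries_ext _ _ x (PS_derive_Re h)). apply is_derive_PSeries, unit_radius_lt; assumption.
  - change (is_derive (PSeries (fun n => Im (h n))) x (PSeries (fun n => Im (Cderiv_coef h n)) x)).
    rewrite <- (PSeries_ext _ _ x (PS_derive_Im h)). apply is_derive_PSeries, unit_radius_lt; assumption.
Qed.

Lemma locally_Rabs_lt_1 (x : R) : Rabs x < 1 -> locally x (fun t => Rabs t < 1).
Proof.
  intros H. apply Rabs_def2 in H. eapply filter_imp;
    [|apply (filter_and _ _ (locally_lt 1 x (proj1 H)) (locally_gt (-1) x (proj2 H)))].
  intros t [? ?]; apply Rabs_def1; lra.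
Qed.

Lemma Cdiffn_CPSeries (k : nat) (h : nat -> C) (x : R) :
  unit_radius h -> Rabs x < 1 -> Cdiffn k (CPSeries h) x.
Proof.
  intros Hh Hx; revert h Hh; induction k as [|k IH]; [easy|]; intros h Hh.
  exists (CPSeries (Cderiv_coef h)); split; [|apply IH, unit_radius_deriv, Hh].
  eapply filter_imp; [|apply (locally_Rabs_lt_1 x Hx)].
  intros y Hy; apply is_Cderive_CPSeries; assumption.
Qed.

(** The bound is uniform in [|x| < 1], so it survives the limit [x -> 1] although the series is
    never evaluated at 1. *)
Lemma CPSeries_sub_le (h : nat -> C) (M x : R) :
  unit_radius h -> Rabs x < 1 ->
  (forall N, sum_n (fun k => Cmod (h (S k))) N <= M) ->
  Cmod (CPSeries h x - h O) <= M.
Proof.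
  intros Hh Hx HM.
  set (Sm := fun N => (sum_n (fun k => Re (h k) * x ^ k) N, sum_n (fun k => Im (h k) * x ^ k) N) : C).
  assert (W : forall a, Rbar_le 1 (CV_radius a) ->
     filterlim (sum_n (fun k => a k * x ^ k)) eventually (locally (PSeries a x))).
  { intros a Ha. pose proof (PSeries_correct _ _ (CV_radius_inside _ _ (unit_radius_lt _ _ Ha Hx))) as P.
    apply is_pseries_R in P. exact P. }
  assert (L : Clim eventually Sm (CPSeries h x)).
  { destruct Hh; split; apply W; assumption. }
  assert (HS : forall N, Cmod (Sm (S N) - h O) <= sum_n (fun k => Cmod (h (S k))) N).
  { assert (St : forall N, Sm (S N) = (Sm N + h (S N) * (x ^ (S N))%R)%C).
    { intros N. unfold Sm. rewrite !sum_Sn.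
      apply C_ext; rewrite ?re_plus, ?im_plus, ?re_scal_r, ?im_scal_r; reflexivity. }
    assert (Sz : Sm O = h O).
    { unfold Sm. rewrite !sum_O. apply C_ext; simpl; apply Rmult_1_r. }
    assert (P : forall n, Cmod (h n * (x ^ n)%R)%C <= Cmod (h n)).
    { intros n. rewrite Cmod_mult, Cmod_R, <- RPow_abs.
      rewrite <- (Rmult_1_r (Cmod (h n))) at 2. apply Rmult_le_compat_l; [apply Cmod_ge_0|].
      rewrite <- (pow1 n). apply pow_incr. split; [apply Rabs_pos | lra]. }
    induction N as [|N IH].
    - rewrite St, Sz, sum_O. replace (h O + h 1%nat * (x ^ 1)%R - h O)%C with (h 1%nat * (x ^ 1)%R)%C by ring.
      apply P.
    - rewrite St, sum_Sn.
      replace (Sm (S N) + h (S (S N)) * (x ^ S (S N))%R - h O)%C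
       with ((Sm (S N) - h O) + h (S (S N)) * (x ^ S (S N))%R)%C by ring.
      eapply Rle_trans; [apply Cmod_triangle|]. apply Rplus_le_compat; [apply IH | apply P]. }
  apply Rnot_lt_le; intros Hlt.
  assert (He : 0 < Cmod (CPSeries h x - h O) - M) by lra.
  destruct (Clim_Cmod_sub _ _ L (mkposreal _ He)) as [N HN]. simpl in HN.
  specialize (HN (S N) (Nat.le_succ_diag_r N)).
  pose proof (HS N); pose proof (HM N).
  pose proof (Cmod_triangle (Sm (S N) - h O) (- (Sm (S N) - CPSeries h x))) as Tr.
  rewrite Cmod_opp in Tr.
  replace (Sm (S N) - h O + - (Sm (S N) - CPSeries h x))%C with (CPSeries h x - h O)%C in Tr by ring.
  lra.
Qed.

(** * The hypergeometric series and its differential equation *)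

Definition nonpole (c : C) : Prop := forall n : nat, (c + INR n)%C <> RtoC 0.

Lemma nonpole_Re_pos (c : C) : 0 < Re c -> nonpole c.
Proof.
  intros H n E. apply (f_equal Re) in E. rewrite re_plus, !re_RtoC in E.
  pose proof (pos_INR n). lra.
Qed.

Lemma RtoC_INR_S (n : nat) : RtoC (INR (S n)) = (INR n + 1)%C.
Proof. rewrite S_INR, RtoC_plus. reflexivity. Qed.

Lemma RtoC_neq_0 (x : R) : x <> 0 -> RtoC x <> RtoC 0.
Proof. intros H E; apply H, RtoC_inj, E. Qed.

Lemma INR_S_neq_0 (n : nat) : (INR n + 1)%C <> RtoC 0.
Proof. rewrite <- RtoC_INR_S. apply RtoC_neq_0, not_0_INR. discriminate. Qed.

Lemma poch_neq_0 (c : C) (n : nat) : nonpole c -> poch c n <> RtoC 0.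
Proof.
  intros H; induction n as [|n IH]; simpl.
  - apply RtoC_neq_0; lra.
  - apply Cmult_neq_0; auto.
Qed.

Lemma fact_C_neq_0 (n : nat) : RtoC (INR (fact n)) <> RtoC 0.
Proof. apply RtoC_neq_0, INR_fact_neq_0. Qed.

Lemma hyp_coef_O (a b c : C) : hyp_coef a b c 0 = RtoC 1.
Proof. unfold hyp_coef; simpl. field. Qed.

Lemma hyp_coef_S (a b c : C) (n : nat) : nonpole c ->
  hyp_coef a b c (S n)
  = (hyp_coef a b c n * ((a + INR n) * (b + INR n) / ((c + INR n) * (INR n + 1))))%C.
Proof.
  intros H. unfold hyp_coef. cbn [poch].
  rewrite fact_simpl, mult_INR, RtoC_mult, RtoC_INR_S.
  field. repeat split; auto using poch_neq_0, fact_C_neq_0, INR_S_neq_0.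
Qed.

Lemma hyp_coef_sym (a b c : C) (n : nat) : hyp_coef a b c n = hyp_coef b a c n.
Proof. unfold hyp_coef. f_equal. ring. Qed.

Lemma hyp2F1_sym (a b c : C) (x : R) : hyp2F1 a b c x = hyp2F1 b a c x.
Proof. apply CPSeries_ext, hyp_coef_sym. Qed.

Lemma Cmod_plus_INR_le (a : C) (n : nat) : Cmod (a + INR n) <= Cmod a + INR n.
Proof.
  eapply Rle_trans; [apply Cmod_triangle|].
  rewrite Cmod_R, Rabs_pos_eq by apply pos_INR. lra.
Qed.

Lemma Cmod_plus_INR_ge (a : C) (n : nat) : INR n - Cmod a <= Cmod (a + INR n).
Proof.
  pose proof (Cmod_triangle (a + INR n) (- a)) as H.
  replace (a + INR n + - a)%C with (RtoC (INR n)) in H by ring.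
  rewrite Cmod_R, Rabs_pos_eq, Cmod_opp in H by apply pos_INR. lra.
Qed.

Lemma Cmod_INR_S (n : nat) : Cmod (INR n + 1) = INR n + 1.
Proof.
  rewrite <- RtoC_plus, Cmod_R, Rabs_pos_eq; [reflexivity|]. pose proof (pos_INR n); lra.
Qed.

Lemma nat_above (x : R) : exists N : nat, x <= INR N.
Proof.
  destruct (INR_archimed 1 x Rlt_0_1) as [N HN]. exists N. lra.
Qed.

Lemma eventually_decreasing_bounded (u : nat -> R) (N : nat) :
  (forall n, (N <= n)%nat -> u (S n) <= u n) -> exists M, forall n, u n <= M.
Proof.
  revert u; induction N as [|N IH]; intros u H.
  - exists (u O). induction n as [|n IHn]; [lra|].
    pose proof (H n (Nat.le_0_l n)). lra.
  - destruct (IH (fun n => u (S n))) as [M HM]; [intros n Hn; apply H; lia|].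
    exists (Rmax M (u O)). intros [|n]; [apply Rmax_r|].
    eapply Rle_trans; [apply HM | apply Rmax_l].
Qed.

(** The ratio of consecutive terms [|h_n| r^n] tends to [r < 1], so these terms eventually decrease
    and are therefore bounded. *)
Lemma unit_radius_hyp_coef (a b c : C) : nonpole c -> unit_radius (hyp_coef a b c).
Proof.
  intros Hc. apply unit_radius_bound. intros r Hr.
  pose proof (Cmod_ge_0 a) as Pa; pose proof (Cmod_ge_0 b) as Pb; pose proof (Cmod_ge_0 c) as Pc.
  (* Chosen so that [n (1 - r) >= K] implies [r (|a| + n) (|b| + n) <= (n - |c|) (n + 1)]. *)
  set (K := Cmod a + Cmod b + 2 * Cmod c + Cmod a * Cmod b + 1).
  destruct (nat_above (K / (1 - r))) as [N HN].
  apply (eventually_decreasing_bounded _ N). intros n Hn.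
  rewrite hyp_coef_S by assumption. rewrite Cmod_mult, <- tech_pow_Rmult.
  rewrite Cmod_div by (apply Cmult_neq_0; [apply Hc | apply INR_S_neq_0]).
  rewrite !Cmod_mult.
  rewrite Cmod_INR_S.
  assert (HnK : K <= INR n * (1 - r)).
  { apply le_INR in Hn. apply Rmult_le_reg_r with (/ (1 - r)); [apply Rinv_0_lt_compat; lra|].
    rewrite Rmult_assoc, Rinv_r by lra. unfold Rdiv in HN. lra. }
  assert (PK : 0 <= Cmod a * Cmod b) by nra.
  assert (Hn1 : K <= INR n).
  { pose proof (pos_INR n). assert (0 <= INR n * r) by nra. nra. }
  pose proof (Cmod_plus_INR_le a n) as Ua. pose proof (Cmod_plus_INR_le b n) as Ub.
  pose proof (Cmod_plus_INR_ge c n) as Lc.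
  pose proof (Cmod_ge_0 (a + INR n)); pose proof (Cmod_ge_0 (b + INR n)).
  set (A := Cmod (a + INR n)) in *; set (B := Cmod (b + INR n)) in *; set (G := Cmod (c + INR n)) in *.
  assert (HG : 0 < INR n - Cmod c) by (unfold K in Hn1; nra).
  assert (HAB : A * B <= (Cmod a + INR n) * (Cmod b + INR n)) by (apply Rmult_le_compat; assumption).
  assert (Q : r * (A * B) <= G * (INR n + 1)).
  { apply Rle_trans with (r * ((Cmod a + INR n) * (Cmod b + INR n))); [apply Rmult_le_compat_l; lra|].
    apply Rle_trans with ((INR n - Cmod c) * (INR n + 1)); [|apply Rmult_le_compat_r; lra].
    assert (INR n * K <= INR n * (INR n * (1 - r))) by (apply Rmult_le_compat_l; lra).
    assert (r * (Cmod a * Cmod b) <= Cmod a * Cmod b) by nra.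
    assert (r * (INR n * (Cmod a + Cmod b)) <= INR n * (Cmod a + Cmod b)).
    { assert (0 <= INR n * (Cmod a + Cmod b)) by nra. nra. }
    assert (Cmod a * Cmod b <= INR n * (Cmod a * Cmod b)) by (unfold K in Hn1; nra).
    assert (Cmod c <= INR n * Cmod c) by (unfold K in Hn1; nra).
    unfold K in *. nra. }
  assert (Q2 : A * B / (G * (INR n + 1)) * r <= 1).
  { assert (0 < G * (INR n + 1)) by nra.
    apply Rmult_le_reg_r with (G * (INR n + 1)); [assumption|].
    replace (A * B / (G * (INR n + 1)) * r * (G * (INR n + 1))) with (r * (A * B)) by (field; nra).
    lra. }
  pose proof (Cmod_ge_0 (hyp_coef a b c n)); assert (0 <= r ^ n) by (apply pow_le; lra).
  replace (Cmod (hyp_coef a b c n) * (A * B / (G * (INR n + 1))) * (r * r ^ n))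
    with ((Cmod (hyp_coef a b c n) * r ^ n) * (A * B / (G * (INR n + 1)) * r)) by ring.
  rewrite <- (Rmult_1_r (Cmod (hyp_coef a b c n) * r ^ n)) at 2.
  apply Rmult_le_compat_l; [|assumption]. apply Rmult_le_pos; assumption.
Qed.

(** The hypergeometric equation at a single point, with the first derivative [f1] as data, because
    Wronskians are formed from [f] and [f1]. *)
Definition hyp_sol (a b c : C) (f f1 : R -> C) (x : R) : Prop :=
  is_Cderive f x (f1 x) /\
  exists l : C, is_Cderive f1 x l /\
  (x * (1 - x) * l + (c - (a + b + 1) * x) * f1 x - a * b * f x = 0)%C.

Definition dhyp2F1 (a b c : C) : R -> C := CPSeries (Cderiv_coef (hyp_coef a b c)).

Definition d2hyp2F1 (a b c : C) : R -> C :=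
  CPSeries (Cderiv_coef (Cderiv_coef (hyp_coef a b c))).

Lemma is_Cderive_hyp2F1 (a b c : C) (x : R) : nonpole c -> Rabs x < 1 ->
  is_Cderive (hyp2F1 a b c) x (dhyp2F1 a b c x).
Proof.
  intros Hc Hx. apply (is_Cderive_CPSeries _ _ (unit_radius_hyp_coef a b c Hc) Hx).
Qed.

Lemma is_Cderive_dhyp2F1 (a b c : C) (x : R) : nonpole c -> Rabs x < 1 ->
  is_Cderive (dhyp2F1 a b c) x (d2hyp2F1 a b c x).
Proof.
  intros Hc Hx. apply is_Cderive_CPSeries; [|exact Hx].
  apply unit_radius_deriv, unit_radius_hyp_coef, Hc.
Qed.

Lemma Cdiffn_hyp2F1 (k : nat) (a b c : C) (x : R) : nonpole c -> Rabs x < 1 ->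
  Cdiffn k (hyp2F1 a b c) x.
Proof.
  intros Hc Hx. apply (Cdiffn_CPSeries k _ x (unit_radius_hyp_coef a b c Hc) Hx).
Qed.

Lemma hyp2F1_0 (a b c : C) : hyp2F1 a b c 0 = RtoC 1.
Proof. exact (eq_trans (CPSeries_at_0 _) (hyp_coef_O a b c)). Qed.

Lemma hyp2F1_sol (a b c : C) (x : R) : nonpole c -> Rabs x < 1 ->
  hyp_sol a b c (hyp2F1 a b c) (dhyp2F1 a b c) x.
Proof.
  intros Hc Hx. split; [apply is_Cderive_hyp2F1; assumption|].
  exists (d2hyp2F1 a b c x). split; [apply is_Cderive_dhyp2F1; assumption|].
  change (hyp2F1 a b c x) with (CPSeries (hyp_coef a b c) x). unfold dhyp2F1, d2hyp2F1.
  pose proof (unit_radius_hyp_coef a b c Hc) as R0.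
  pose proof (unit_radius_deriv _ R0) as R1. pose proof (unit_radius_deriv _ R1) as R2.
  set (h := hyp_coef a b c) in *. set (h1 := Cderiv_coef h) in *. set (h2 := Cderiv_coef h1) in *.
  pose proof (unit_radius_shift _ R1) as S1. pose proof (unit_radius_shift _ R2) as S2.
  pose proof (unit_radius_shift _ S2) as SS2.
  (* The left side of the equation as one power series: multiplication by [x] is [Cshift], so its
     coefficients must vanish by the two-term recurrence. *)
  transitivity (CPSeries (fun n => Cshift h2 n + (-1 * Cshift (Cshift h2) n + (c * h1 n
    + (- (a + b + 1) * Cshift h1 n + - (a * b) * h n))))%C x).
  - rewrite !CPSeries_plus, !CPSeries_scal, !CPSeries_shift by auto 20 using unit_radius_plus, unit_radius_scal.
    ring.
  - rewrite <- (CPSeries_zero x). apply CPSeries_ext. intros n.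
    assert (E : forall m, (h1 m * (c + INR m) = h m * ((a + INR m) * (b + INR m)))%C).
    { intros m. unfold h1, Cderiv_coef, h. rewrite hyp_coef_S, RtoC_INR_S by assumption.
      field. split; [apply INR_S_neq_0 | apply Hc]. }
    specialize (E n).
    (* The indices 0 and 1 are separate because one or two applications of [Cshift] put zeros
       there. *)
    destruct n as [|[|n]]; unfold Cshift; unfold h2, Cderiv_coef in *; fold h1; rewrite ?RtoC_INR_S in *.
    + simpl INR in *.
      transitivity (h1 O * (c + 0) - h O * ((a + 0) * (b + 0)))%C; [ring | rewrite E; ring].
    + simpl INR in *.
      transitivity (h1 1%nat * (c + (0 + 1)) - h 1%nat * ((a + (0 + 1)) * (b + (0 + 1))))%C; [|rewrite E; ring].
      unfold h1 at 3. unfold Cderiv_coef. simpl INR. ring.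
    + transitivity (h1 (S (S n)) * (c + (INR n + 1 + 1)) - h (S (S n)) * ((a + (INR n + 1 + 1)) * (b + (INR n + 1 + 1))))%C;
        [|rewrite E; ring].
      unfold h1 at 2 4. unfold Cderiv_coef. rewrite !RtoC_INR_S. ring.
Qed.

Lemma poch_succ_l (c : C) (n : nat) : (c * poch (c + 1) n = poch c n * (c + INR n))%C.
Proof.
  induction n as [|n IH]; simpl poch.
  - simpl INR. ring.
  - rewrite Cmult_assoc, IH, RtoC_INR_S. ring.
Qed.

Lemma nonpole_succ (c : C) : nonpole c -> nonpole (c + 1)%C.
Proof.
  intros H n E. apply (H (S n)). rewrite RtoC_INR_S, <- E. ring.
Qed.

(** Compare coefficients: raising [c] by 1 multiplies the [n]-th one by [c / (c + n)]. *)
Lemma hyp2F1_contiguous (a b c : C) (x : R) : nonpole c -> Rabs x < 1 ->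
  ((c - a - b) * hyp2F1 a b c x + (1 - x) * dhyp2F1 a b c x
   = (c - a) * (c - b) / c * hyp2F1 a b (c + 1) x)%C.
Proof.
  intros Hc Hx.
  assert (Hc0 : c <> RtoC 0) by (intros E; apply (Hc O); rewrite E; simpl; ring).
  change (hyp2F1 a b c x) with (CPSeries (hyp_coef a b c) x).
  change (hyp2F1 a b (c + 1) x) with (CPSeries (hyp_coef a b (c + 1)) x). unfold dhyp2F1.
  pose proof (unit_radius_hyp_coef a b c Hc) as R0.
  pose proof (unit_radius_hyp_coef a b _ (nonpole_succ c Hc)) as R0'.
  pose proof (unit_radius_deriv _ R0) as R1. pose proof (unit_radius_shift _ R1) as S1.
  rewrite <- (CPSeries_scal ((c - a) * (c - b) / c)%C) by assumption.
  transitivity (CPSeries (fun n => (c - a - b) * hyp_coef a b c n + (Cderiv_coef (hyp_coef a b c) n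
     + -1 * Cshift (Cderiv_coef (hyp_coef a b c)) n))%C x).
  - rewrite !CPSeries_plus, !CPSeries_scal, !CPSeries_shift by auto 20 using unit_radius_plus, unit_radius_scal.
    ring.
  - apply CPSeries_ext. intros n.
    assert (E : (hyp_coef a b (c + 1) n = hyp_coef a b c n * c / (c + INR n))%C).
    { unfold hyp_coef. pose proof (poch_succ_l c n) as P.
      replace (poch (c + 1) n) with (poch c n * (c + INR n) / c)%C by (rewrite <- P; field; assumption).
      field. repeat split; auto using poch_neq_0, fact_C_neq_0. }
    rewrite E. unfold Cderiv_coef at 1. rewrite hyp_coef_S, RtoC_INR_S by assumption.
    assert (E2 : Cshift (Cderiv_coef (hyp_coef a b c)) n = (INR n * hyp_coef a b c n)%C).
    { destruct n; simpl Cshift; [simpl; ring | reflexivity]. }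
    rewrite E2. field. repeat split; auto using INR_S_neq_0.
Qed.

(** The first two derivatives of a multiplier times a composite. Euler's and Pfaff's
    transformations, the splitting off of a power and the substitution [sin^2 t] are all
    instances. *)
Lemma is_Cderive_twist (m m1 f f1 : R -> C) (g g1 : R -> R) (x g2 : R) (m2 f2 : C) :
  is_Cderive m x (m1 x) -> is_Cderive m1 x m2 ->
  is_derive g x (g1 x) -> is_derive g1 x g2 ->
  is_Cderive f (g x) (f1 (g x)) -> is_Cderive f1 (g x) f2 ->
  is_Cderive (fun t => m t * f (g t))%C x (m1 x * f (g x) + m x * (g1 x * f1 (g x)))%C /\
  is_Cderive (fun t => m1 t * f (g t) + m t * (g1 t * f1 (g t)))%C x
    (m2 * f (g x) + 2 * m1 x * g1 x * f1 (g x)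
     + m x * (g2 * f1 (g x) + g1 x * g1 x * f2))%C.
Proof.
  intros Hm Hm1 Hg Hg1 Hf Hf1.
  pose proof (is_Cderive_comp _ _ _ _ _ Hf Hg) as F0.
  pose proof (is_Cderive_comp _ _ _ _ _ Hf1 Hg) as F1.
  split.
  - apply (is_Cderive_mult _ _ _ _ _ Hm F0).
  - eapply is_Cderive_eq.
    + exact (is_Cderive_plus _ _ _ _ _ (is_Cderive_mult _ _ _ _ _ Hm1 F0)
        (is_Cderive_mult _ _ _ _ _ Hm (is_Cderive_mult _ _ _ _ _ (is_Cderive_RtoC _ _ _ Hg1) F1))).
    + cbv beta. ring.
Qed.

Lemma is_derive_1_minus (x : R) : is_derive (fun t => 1 - t) x (-1).
Proof. auto_derive; [trivial | ring]. Qed.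

Lemma hyp_sol_reflect (a b c : C) (f f1 : R -> C) (x : R) :
  hyp_sol a b c f f1 (1 - x) ->
  hyp_sol a b (a + b - c + 1) (fun t => f (1 - t)) (fun t => - f1 (1 - t)%R)%C x.
Proof.
  intros (D & l & D1 & E). split; [|exists l; split].
  - eapply is_Cderive_eq; [apply (is_Cderive_comp _ _ _ _ _ D (is_derive_1_minus x)) | ring].
  - eapply is_Cderive_eq;
      [apply is_Cderive_opp, (is_Cderive_comp _ _ _ _ _ D1 (is_derive_1_minus x)) | ring].
  - rewrite RtoC_minus in E. rewrite <- E. ring.
Qed.

Lemma is_Cderive_Rcpow_minus (s : C) (x : R) : x < 1 ->
  is_Cderive (fun t => Rcpow (1 - t) s) x (- s * Rcpow (1 - x) (s - 1))%C.
Proof.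
  intros Hx. eapply is_Cderive_eq.
  - apply (is_Cderive_Rcpow_comp s (fun t => 1 - t) x (-1)); [lra | apply is_derive_1_minus].
  - ring.
Qed.

Lemma RtoC_1_minus_neq_0 (x : R) : x < 1 -> (1 - x)%C <> RtoC 0.
Proof. intros H. rewrite <- RtoC_minus. apply RtoC_neq_0; lra. Qed.

Lemma is_derive_Rid (x : R) : is_derive (fun t : R => t) x 1.
Proof. apply (is_derive_id (K := R_AbsRing)). Qed.

Lemma hyp_sol_euler (a b c : C) (f f1 : R -> C) (x : R) : x < 1 ->
  hyp_sol (c - a) (c - b) c f f1 x ->
  hyp_sol a b c (fun t => Rcpow (1 - t) (c - a - b) * f t)%C
    (fun t => - (c - a - b) * Rcpow (1 - t) (c - a - b - 1) * f t
       + Rcpow (1 - t) (c - a - b) * (1 * f1 t))%C x.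
Proof.
  intros Hx (D & l & D1 & E). set (s := (c - a - b)%C).
  destruct (is_Cderive_twist (fun t => Rcpow (1 - t) s) (fun t => - s * Rcpow (1 - t) (s - 1))%C
    f f1 (fun t => t) (fun _ => 1) x 0 (- s * (- (s - 1) * Rcpow (1 - x) (s - 1 - 1)))%C l)
    as [G G1]; try assumption.
  - apply is_Cderive_Rcpow_minus, Hx.
  - apply is_Cderive_scal, is_Cderive_Rcpow_minus, Hx.
  - apply is_derive_Rid.
  - exact (is_derive_const (V := R_NormedModule) 1 x).
  - split; [exact G|]. eexists; split; [exact G1|].
    pose proof (RtoC_1_minus_neq_0 x Hx) as Nx. cbv beta.
    rewrite !Rcpow_minus_1, RtoC_minus by lra.
    (* The equation to be proved is the multiplier times the equation satisfied by [f]. *)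
    transitivity (Rcpow (1 - x) s * (x * (1 - x) * l + (c - (c - a + (c - b) + 1) * x) * f1 x
      - (c - a) * (c - b) * f x))%C; [|rewrite E; ring].
    unfold s. field. assumption.
Qed.

(** This produces the Frobenius solution with exponent [s] at 0 for lower parameter [1 - s]. *)
Lemma hyp_sol_pow (a b s : C) (f f1 : R -> C) (x : R) : 0 < x ->
  hyp_sol (a + s) (b + s) (1 + s) f f1 x ->
  hyp_sol a b (1 - s) (fun t => Rcpow t s * f t)%C
    (fun t => s * Rcpow t (s - 1) * f t + Rcpow t s * (1 * f1 t))%C x.
Proof.
  intros Hx (D & l & D1 & E).
  destruct (is_Cderive_twist (fun t => Rcpow t s) (fun t => s * Rcpow t (s - 1))%C
    f f1 (fun t => t) (fun _ => 1) x 0 (s * ((s - 1) * Rcpow x (s - 1 - 1)))%C l)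
    as [G G1]; try assumption.
  - apply is_Cderive_Rcpow, Hx.
  - apply is_Cderive_scal, is_Cderive_Rcpow, Hx.
  - apply is_derive_Rid.
  - exact (is_derive_const (V := R_NormedModule) 1 x).
  - split; [exact G|]. eexists; split; [exact G1|].
    assert (Nx : RtoC x <> RtoC 0) by (apply RtoC_neq_0; lra). cbv beta.
    rewrite !Rcpow_minus_1 by lra.
    transitivity (Rcpow x s * (x * (1 - x) * l + (1 + s - (a + s + (b + s) + 1) * x) * f1 x
      - (a + s) * (b + s) * f x))%C; [|rewrite E; ring].
    field. assumption.
Qed.

Lemma hyp_sol_pfaff (a b c : C) (f f1 : R -> C) (x : R) : x < 1 ->
  hyp_sol a b c f f1 (- x / (1 - x)) ->
  hyp_sol (c - a) b c (fun t => Rcpow (1 - t) (- b) * f (- t / (1 - t))%R)%C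
    (fun t => - - b * Rcpow (1 - t) (- b - 1) * f (- t / (1 - t))%R
       + Rcpow (1 - t) (- b) * (RtoC (- / (1 - t) ^ 2) * f1 (- t / (1 - t))%R))%C x.
Proof.
  intros Hx (D & l & D1 & E).
  destruct (is_Cderive_twist (fun t => Rcpow (1 - t) (- b)) (fun t => - - b * Rcpow (1 - t) (- b - 1))%C
    f f1 (fun t => - t / (1 - t)) (fun t => - / (1 - t) ^ 2) x (- (2) / (1 - x) ^ 3)
    (- - b * (- (- b - 1) * Rcpow (1 - x) (- b - 1 - 1)))%C l)
    as [G G1]; try assumption.
  - apply is_Cderive_Rcpow_minus, Hx.
  - apply is_Cderive_scal, is_Cderive_Rcpow_minus, Hx.
  - auto_derive; [lra | field; lra].
  - auto_derive; [nra | field; lra].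
  - split; [exact G|]. eexists; split; [exact G1|].
    assert (Nx : RtoC (1 - x) <> RtoC 0) by (apply RtoC_neq_0; lra). cbv beta.
    rewrite !Rcpow_minus_1 by lra.
    set (X := - x / (1 - x)) in *.
    assert (EX : RtoC X = (- x / (1 - x)%R)%C).
    { unfold X. rewrite RtoC_div, RtoC_opp by lra. reflexivity. }
    assert (E1 : RtoC (- / (1 - x) ^ 2) = (- / ((1 - x)%R * (1 - x)%R))%C).
    { rewrite RtoC_opp, RtoC_inv, RtoC_pow by (apply pow_nonzero; lra). field. assumption. }
    assert (E2 : RtoC (- (2) / (1 - x) ^ 3) = (- 2 / ((1 - x)%R * (1 - x)%R * (1 - x)%R))%C).
    { rewrite RtoC_div, RtoC_pow, RtoC_opp by (apply pow_nonzero; lra). field. assumption. }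
    rewrite E1, E2.
    (* Again a multiple of the equation of [f], now at [X]; note that [1 - X = 1 / (1 - x)]. *)
    transitivity (- Rcpow (1 - x) (- b) / (1 - x)%R * (X * (1 - X) * l + (c - (a + b + 1) * X) * f1 X
      - a * b * f X))%C; [|rewrite E; ring].
    rewrite EX. replace (RtoC (1 - x)) with (1 - x)%C in * by (symmetry; apply RtoC_minus).
    field. assumption.
Qed.

(** * The connection formula between 0 and 1 *)

(** Abel's identity: the logarithmic derivative of [x^c (1-x)^(a+b-c+1)] is
    [(c - (a+b+1) x) / (x (1-x))]. The derivative of the product is a multiple of [f] times the
    equation of [g] minus [g] times the equation of [f]. *)
Lemma hyp_wronskian_const (a b c : C) (f f1 g g1 : R -> C) (D : R -> Prop) :
  convex D ->
  (forall x, D x -> 0 < x < 1 /\ hyp_sol a b c f f1 x /\ hyp_sol a b c g g1 x) ->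
  forall x y, D x -> D y ->
  (Rcpow x c * Rcpow (1 - x) (a + b - c + 1) * (f x * g1 x - f1 x * g x)
   = Rcpow y c * Rcpow (1 - y) (a + b - c + 1) * (f y * g1 y - f1 y * g y))%C.
Proof.
  intros HD H.
  apply (is_Cderive_0_const (fun x => Rcpow x c * Rcpow (1 - x) (a + b - c + 1)
    * (f x * g1 x - f1 x * g x))%C D HD).
  intros x Hx. destruct (H x Hx) as (Hx1 & (Df & l & Df1 & Ef) & (Dg & m & Dg1 & Eg)).
  eapply is_Cderive_eq.
  - apply is_Cderive_mult; [apply is_Cderive_mult|].
    + apply is_Cderive_Rcpow; lra.
    + apply is_Cderive_Rcpow_minus; lra.
    + apply is_Cderive_minus; apply is_Cderive_mult; eassumption.
  - assert (N0 : RtoC x <> RtoC 0) by (apply RtoC_neq_0; lra).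
    pose proof (RtoC_1_minus_neq_0 x (proj2 Hx1)) as N1.
    rewrite !Rcpow_minus_1, RtoC_minus by lra.
    transitivity (Rcpow x c * Rcpow (1 - x) (a + b - c + 1) / (x * (1 - x))
      * (f x * (x * (1 - x) * m + (c - (a + b + 1) * x) * g1 x - a * b * g x)
         - g x * (x * (1 - x) * l + (c - (a + b + 1) * x) * f1 x - a * b * f x)))%C;
      [field; auto | rewrite Ef, Eg; field; auto].
Qed.

(** For such [s] the exponents 0 and [s] give independent power series solutions, and [1 + s] and
    [1 - s] are admissible lower parameters. The property is stable under integer shifts of [s],
    which the iteration below requires. *)
Definition nonint (s : C) : Prop := forall n : Z, s <> RtoC (IZR n).

Lemma nonint_opp (s : C) : nonint s -> nonint (- s)%C.
Proof.
  intros H n E. apply (H (- n)%Z). rewrite opp_IZR, RtoC_opp, <- E. ring.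
Qed.

Lemma nonint_plus_INR (s : C) (n : nat) : nonint s -> nonint (s + INR n)%C.
Proof.
  intros H m E. apply (H (m - Z.of_nat n)%Z).
  rewrite minus_IZR, <- INR_IZR_INZ, RtoC_minus, <- E. ring.
Qed.

Lemma nonint_nonpole (s : C) : nonint s -> nonpole s.
Proof.
  intros H n E. apply (H (- Z.of_nat n)%Z).
  rewrite opp_IZR, <- INR_IZR_INZ, RtoC_opp.
  transitivity (s + INR n - INR n)%C; [ring | rewrite E; ring].
Qed.

Lemma nonint_nonpole_1_plus (s : C) : nonint s -> nonpole (1 + s)%C.
Proof.
  intros H. apply nonint_nonpole. pose proof (nonint_plus_INR s 1 H) as K.
  replace (1 + s)%C with (s + INR 1)%C by (simpl; ring). exact K.
Qed.

Lemma nonint_nonpole_1_minus (s : C) : nonint s -> nonpole (1 - s)%C.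
Proof. intros H. exact (nonint_nonpole_1_plus _ (nonint_opp _ H)). Qed.

(* [A] and [B] are the connection coefficients of [F[a,b;a+b+s;1-z]] in the
   basis of solutions with exponents [0] and [s] at [z = 0]. *)
Definition connection (a b s A B : C) : Prop := forall z : R, 0 < z < 1 ->
  hyp2F1 a b (a + b + s) (1 - z)
  = (A * hyp2F1 a b (1 - s) z + B * (Rcpow z s * hyp2F1 (a + s) (b + s) (1 + s) z))%C.

Lemma Rabs_lt_1_of_01 (z : R) : 0 < z < 1 -> Rabs z < 1.
Proof. intros H; apply Rabs_def1; lra. Qed.

Lemma hyp_sol_at_1 (a b s : C) (z : R) : nonpole (a + b + s) -> 0 < z < 1 ->
  hyp_sol a b (1 - s) (fun t => hyp2F1 a b (a + b + s) (1 - t))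
    (fun t => - dhyp2F1 a b (a + b + s) (1 - t)%R)%C z.
Proof.
  intros Hc Hz. replace (1 - s)%C with (a + b - (a + b + s) + 1)%C by ring.
  apply hyp_sol_reflect, hyp2F1_sol; [assumption | apply Rabs_lt_1_of_01; lra].
Qed.

Lemma at_right_01 (P : R -> Prop) : (forall z, 0 < z < 1 -> P z) -> at_right 0 P.
Proof.
  intros H. exists (mkposreal 1 Rlt_0_1). intros y By Hy. apply H. split; [exact Hy|].
  apply Rabs_def2 in By. unfold minus, plus, opp in By; simpl in By. lra.
Qed.

Lemma filter_le_at_right (a : R) : filter_le (at_right a) (locally a).
Proof. intros P HP. unfold at_right, within. eapply filter_imp; [|exact HP]. auto. Qed.

Lemma Clim_at_right (f : R -> C) (x : R) (l : C) :
  is_Cderive f x l -> Clim (at_right x) f (f x).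
Proof.
  intros H. apply (Clim_filter_le _ _ _ _ (filter_le_at_right x)), (is_Cderive_Clim _ _ _ H).
Qed.

Lemma Clim_hyp2F1_0 (a b c : C) : nonpole c -> Clim (at_right 0) (hyp2F1 a b c) (RtoC 1).
Proof.
  intros H. rewrite <- (hyp2F1_0 a b c). eapply Clim_at_right, is_Cderive_hyp2F1; [exact H|].
  rewrite Rabs_R0; lra.
Qed.

Lemma Clim_dhyp2F1_0 (a b c : C) : nonpole c -> Clim (at_right 0) (dhyp2F1 a b c) (dhyp2F1 a b c 0).
Proof.
  intros H. eapply Clim_at_right, is_Cderive_dhyp2F1; [exact H|].
  rewrite Rabs_R0; lra.
Qed.

Lemma Clim_id_0 : Clim (at_right 0) RtoC (RtoC 0).
Proof. exact (Clim_at_right RtoC 0 _ (is_Cderive_id 0)). Qed.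

Lemma Clim_eq {T : Type} (F : (T -> Prop) -> Prop) (f : T -> C) (l m : C) :
  Clim F f l -> l = m -> Clim F f m.
Proof. intros H <-; exact H. Qed.

Lemma Clim_Rcpow_1_minus (s : C) : Clim (at_right 0) (fun t => Rcpow (1 - t) s) (RtoC 1).
Proof.
  eapply Clim_eq; [eapply Clim_at_right; apply is_Cderive_Rcpow_minus; lra|].
  cbv beta. rewrite Rminus_0_r. apply Rcpow_1_l.
Qed.

Lemma Rcpow_minus_r (x : R) (s t : C) : Rcpow x (s - t)%C = (Rcpow x s / Rcpow x t)%C.
Proof. unfold Cminus. rewrite Rcpow_plus, Rcpow_opp. reflexivity. Qed.

Definition pow_sol (a b s : C) (t : R) : C := (Rcpow t s * hyp2F1 (a + s) (b + s) (1 + s) t)%C.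

(** Written in the shape delivered by [hyp_sol_pow], including the factor 1. *)
Definition dpow_sol (a b s : C) (t : R) : C :=
  (s * Rcpow t (s - 1) * hyp2F1 (a + s) (b + s) (1 + s) t
   + Rcpow t s * (1 * dhyp2F1 (a + s) (b + s) (1 + s) t))%C.

Lemma pow_sol_sol (a b s : C) (z : R) : nonint s -> 0 < z < 1 ->
  hyp_sol a b (1 - s) (pow_sol a b s) (dpow_sol a b s) z.
Proof.
  intros Hs Hz. apply hyp_sol_pow; [lra|].
  apply hyp2F1_sol; [apply nonint_nonpole_1_plus, Hs | apply Rabs_lt_1_of_01, Hz].
Qed.

Lemma reg_sol_sol (a b s : C) (z : R) : nonint s -> 0 < z < 1 ->
  hyp_sol a b (1 - s) (hyp2F1 a b (1 - s)) (dhyp2F1 a b (1 - s)) z.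
Proof.
  intros Hs Hz. apply hyp2F1_sol; [apply nonint_nonpole_1_minus, Hs | apply Rabs_lt_1_of_01, Hz].
Qed.

Lemma convex_interval (a b : R) : convex (fun x => a < x < b).
Proof. intros x y z; lra. Qed.

(** The constant is read off at [z -> 0], where the Wronskian behaves like [s z^(s-1)]. As [s] is
    not 0, the two solutions form a basis. *)
Lemma wronskian_reg_pow (a b s : C) (z : R) : nonint s -> 0 < z < 1 ->
  (Rcpow z (1 - s) * Rcpow (1 - z) (a + b - (1 - s) + 1)
   * (hyp2F1 a b (1 - s) z * dpow_sol a b s z - dhyp2F1 a b (1 - s) z * pow_sol a b s z) = s)%C.
Proof.
  intros Hs Hz.
  set (K := fun z : R => (Rcpow z (1 - s) * Rcpow (1 - z) (a + b - (1 - s) + 1)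
   * (hyp2F1 a b (1 - s) z * dpow_sol a b s z - dhyp2F1 a b (1 - s) z * pow_sol a b s z))%C).
  change (K z = s).
  apply (Clim_unique (at_right 0) K).
  - apply (Clim_ext_loc (fun _ => K z)); [|apply Clim_const].
    apply at_right_01. intros y Hy.
    apply (hyp_wronskian_const a b (1 - s) _ _ _ _ (fun x => 0 < x < 1) (convex_interval 0 1)); try assumption.
    intros x Hx. split; [exact Hx|]. split; [apply reg_sol_sol | apply pow_sol_sol]; assumption.
  - pose proof (nonint_nonpole_1_minus s Hs) as N1. pose proof (nonint_nonpole_1_plus s Hs) as N2.
    (* The powers [z^s] and [z^(-s)] cancel, so no condition on the sign of [Re s] enters. *)
    apply (Clim_ext_loc (fun z => Rcpow (1 - z) (a + b - (1 - s) + 1)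
      * (s * (hyp2F1 a b (1 - s) z * hyp2F1 (a + s) (b + s) (1 + s) z)
        + z * (hyp2F1 a b (1 - s) z * dhyp2F1 (a + s) (b + s) (1 + s) z
               - dhyp2F1 a b (1 - s) z * hyp2F1 (a + s) (b + s) (1 + s) z)))%C).
    + apply at_right_01. intros y Hy. unfold K, pow_sol, dpow_sol.
      rewrite Rcpow_minus_1, Rcpow_minus_r, Rcpow_1 by lra.
      field. split; [apply RtoC_neq_0; lra | apply Rcpow_neq_0].
    + eapply Clim_eq.
      * apply Clim_mult; [apply Clim_Rcpow_1_minus|].
        apply Clim_plus; apply Clim_mult; [apply Clim_const | | apply Clim_id_0 |].
        -- apply Clim_mult; apply Clim_hyp2F1_0; assumption.
        -- apply Clim_minus; apply Clim_mult;
             [apply Clim_hyp2F1_0 | apply Clim_dhyp2F1_0 | apply Clim_dhyp2F1_0 | apply Clim_hyp2F1_0]; assumption.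
      * ring.
Qed.

(** Cramer's rule: the coefficients are quotients of Wronskians, whose numerators are constant by
    Abel's identity and whose denominator is [s]. The constants are evaluated at the base point
    1/2. *)
Lemma connection_exists (a b s : C) : nonpole (a + b + s) -> nonint s ->
  exists A B : C, connection a b s A B.
Proof.
  intros Hc Hs.
  set (f := fun t => hyp2F1 a b (a + b + s) (1 - t)).
  set (f1 := fun t => (- dhyp2F1 a b (a + b + s) (1 - t)%R)%C).
  set (M := fun z => (Rcpow z (1 - s) * Rcpow (1 - z) (a + b - (1 - s) + 1))%C).
  assert (H2 : 0 < / 2 < 1) by lra. set (h := / 2) in H2.
  pose proof (Hs 0%Z) as S0.
  set (k1 := (M h * (f h * dpow_sol a b s h - f1 h * pow_sol a b s h))%C).
  set (k2 := (M h * (hyp2F1 a b (1 - s) h * f1 h - dhyp2F1 a b (1 - s) h * f h))%C).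
  exists (k1 / s)%C, (k2 / s)%C. intros z Hz.
  assert (E1 : (M z * (f z * dpow_sol a b s z - f1 z * pow_sol a b s z))%C = k1).
  { apply (hyp_wronskian_const a b (1 - s) _ _ _ _ (fun x => 0 < x < 1) (convex_interval 0 1)); try assumption.
    intros x Hx. split; [exact Hx|]. split; [apply hyp_sol_at_1 | apply pow_sol_sol]; assumption. }
  assert (E2 : (M z * (hyp2F1 a b (1 - s) z * f1 z - dhyp2F1 a b (1 - s) z * f z))%C = k2).
  { apply (hyp_wronskian_const a b (1 - s) _ _ _ _ (fun x => 0 < x < 1) (convex_interval 0 1)); try assumption.
    intros x Hx. split; [exact Hx|]. split; [apply reg_sol_sol | apply hyp_sol_at_1]; assumption. }
  pose proof (wronskian_reg_pow a b s z Hs Hz) as E0. fold (M z) in E0.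
  change (hyp2F1 a b (a + b + s) (1 - z)) with (f z). fold (pow_sol a b s z).
  transitivity (f z * s / s)%C; [field; assumption|].
  rewrite <- E0 at 1. rewrite <- E1, <- E2. field. assumption.
Qed.

Lemma locally_01 (z : R) : 0 < z < 1 -> locally z (fun t => 0 < t < 1).
Proof.
  intros H. apply filter_and; [apply locally_gt | apply locally_lt]; lra.
Qed.

Lemma connection_deriv (a b s A B : C) (z : R) :
  nonpole (a + b + s) -> nonint s -> connection a b s A B -> 0 < z < 1 ->
  (- dhyp2F1 a b (a + b + s) (1 - z)%R = A * dhyp2F1 a b (1 - s) z + B * dpow_sol a b s z)%C.
Proof.
  intros Hc Hs H Hz.
  destruct (hyp_sol_at_1 a b s z Hc Hz) as [D _].
  destruct (reg_sol_sol a b s z Hs Hz) as [D1 _].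
  destruct (pow_sol_sol a b s z Hs Hz) as [D2 _].
  rewrite <- (is_Cderive_unique _ _ _ D). apply is_Cderive_unique.
  eapply is_Cderive_ext_loc;
    [|apply (is_Cderive_plus _ _ _ _ _ (is_Cderive_scal A _ _ _ D1) (is_Cderive_scal B _ _ _ D2))].
  eapply filter_imp; [|apply (locally_01 z Hz)]. intros t Ht. symmetry. apply H, Ht.
Qed.

(** With [Re s > 0] the term in [z^s] disappears, and [A] is the limit of F at argument 1. *)
Lemma connection_lim (a b s A B : C) :
  nonint s -> 0 < Re s -> connection a b s A B ->
  Clim (at_right 0) (fun z => hyp2F1 a b (a + b + s) (1 - z)) A.
Proof.
  intros Hs Rs H.
  eapply Clim_ext_loc; [apply at_right_01; intros z Hz; symmetry; apply H, Hz|].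
  eapply Clim_eq.
  - apply Clim_plus; apply Clim_mult; try apply Clim_const.
    + apply Clim_hyp2F1_0, nonint_nonpole_1_minus, Hs.
    + apply Clim_mult; [apply Clim_Rcpow_0, Rs | apply Clim_hyp2F1_0, nonint_nonpole_1_plus, Hs].
  - ring.
Qed.

(* [s f - z f'] annihilates [z^s] to leading order, so it isolates [A] even
   where [z^s] does not tend to 0. *)
Lemma connection_lim_contiguous (a b s A B : C) :
  nonpole (a + b + s) -> nonint s -> -1 < Re s -> connection a b s A B ->
  Clim (at_right 0)
    (fun z => (a + s) * (b + s) / (a + b + s) * hyp2F1 a b (a + b + s + 1) (1 - z)%R)%C (s * A)%C.
Proof.
  intros Hc Hs Rs H.
  apply (Clim_ext_loc (fun z => A * (s * hyp2F1 a b (1 - s) z - z * dhyp2F1 a b (1 - s) z)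
     - B * (Rcpow z (s + 1) * dhyp2F1 (a + s) (b + s) (1 + s) z))%C).
  - apply at_right_01. intros z Hz.
    (* With [c = a + b + s] the contiguous relation at argument [1 - z] has left side [s F + z F'],
       which is [s f - z f'] for [f(z) = F(1 - z)]. *)
    pose proof (hyp2F1_contiguous a b (a + b + s) (1 - z) Hc) as E.
    replace (a + b + s - a - b)%C with s in E by ring.
    replace (a + b + s - a)%C with (b + s)%C in E by ring.
    replace (a + b + s - b)%C with (a + s)%C in E by ring.
    rewrite (Cmult_comm (a + s) (b + s)), <- E by (apply Rabs_lt_1_of_01; lra).
    rewrite (H z Hz).
    replace (dhyp2F1 a b (a + b + s) (1 - z)) with (- (A * dhyp2F1 a b (1 - s) z + B * dpow_sol a b s z))%C
      by (rewrite <- (connection_deriv a b s A B z Hc Hs H Hz); ring).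
    unfold dpow_sol. rewrite Rcpow_plus, Rcpow_minus_1, Rcpow_1, RtoC_minus by lra.
    field. apply RtoC_neq_0; lra.
  - eapply Clim_eq.
    + apply Clim_minus; apply Clim_mult; try apply Clim_const.
      * apply Clim_minus; apply Clim_mult; [apply Clim_const | | apply Clim_id_0 |].
        -- apply Clim_hyp2F1_0, nonint_nonpole_1_minus, Hs.
        -- apply Clim_dhyp2F1_0, nonint_nonpole_1_minus, Hs.
      * apply Clim_mult; [apply Clim_Rcpow_0|].
        -- rewrite re_plus, re_RtoC; lra.
        -- apply Clim_dhyp2F1_0, nonint_nonpole_1_plus, Hs.
    + ring.
Qed.

(** The limit isolating [s A] is a multiple of F with lower parameter raised by 1. Since
    [Re (s + 1) > 0], that function tends to its own first coefficient [A']. *)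
Lemma connection_step (a b s A B A' B' : C) :
  nonpole (a + b + s) -> nonint s -> -1 < Re s ->
  connection a b s A B -> connection a b (s + 1) A' B' ->
  (A * ((a + b + s) * s) = (a + s) * (b + s) * A')%C.
Proof.
  intros Hc Hs Rs H H'.
  assert (Hs1 : nonint (s + 1)%C).
  { replace (s + 1)%C with (s + INR 1)%C by (simpl; ring). apply nonint_plus_INR, Hs. }
  assert (Rs1 : 0 < Re (s + 1)) by (rewrite re_plus, re_RtoC; lra).
  pose proof (connection_lim_contiguous a b s A B Hc Hs Rs H) as L.
  pose proof (connection_lim a b (s + 1) A' B' Hs1 Rs1 H') as L'.
  replace (a + b + (s + 1))%C with (a + b + s + 1)%C in L' by ring.
  pose proof (Clim_mult _ _ _ _ (Clim_const ((a + s) * (b + s) / (a + b + s))%C) L') as L2.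
  pose proof (Clim_unique _ _ _ _ L L2) as E.
  assert (Hc0 : (a + b + s)%C <> RtoC 0).
  { intros E0. apply (Hc O). rewrite E0. simpl; ring. }
  replace (A * ((a + b + s) * s))%C with (s * A * (a + b + s))%C by ring.
  rewrite E. field. assumption.
Qed.

(** * Gauss's theorem *)

(** A telescoping argument in the manner of Raabe: [k t_k] drops at each step by at least
    [d / (2 (g + 1))] times [t_k], so the sum is controlled by [t_1 <= |a| |b| / g]. The resulting
    bound is of order [1 / Re c] as [Re c] grows. *)
Lemma hyp_coef_sum_le (a b c : C) (N : nat) :
  let g := Re c in let d := g - Cmod a - Cmod b in
  0 < g -> 0 < d -> 2 * (Cmod a * Cmod b) <= d ->
  sum_n (fun k => Cmod (hyp_coef a b c (S k))) N <= 2 * (Cmod a * Cmod b) * (g + 1) / (g * d).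
Proof.
  intros g d Hg Hd Hab.
  pose proof (Cmod_ge_0 a) as Pa; pose proof (Cmod_ge_0 b) as Pb.
  pose proof (nonpole_Re_pos c Hg) as Hc.
  set (t := fun k => Cmod (hyp_coef a b c k)).
  assert (St : forall k, t (S k) * ((g + INR k) * (INR k + 1)) <= t k * ((Cmod a + INR k) * (Cmod b + INR k))).
  { intros k. unfold t. rewrite hyp_coef_S by assumption.
    rewrite Cmod_mult, Cmod_div by (apply Cmult_neq_0; [apply Hc | apply INR_S_neq_0]).
    rewrite !Cmod_mult.
    rewrite Cmod_INR_S. pose proof (pos_INR k) as Pk.
    assert (G : g + INR k <= Cmod (c + INR k)).
    { pose proof (re_le_Cmod (c + INR k)) as Q. rewrite re_plus, re_RtoC in Q.
      pose proof (Rle_abs (Re c + INR k)). unfold g. lra. }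
    pose proof (Cmod_ge_0 (hyp_coef a b c k)).
    rewrite Rmult_assoc. apply Rmult_le_compat_l; [assumption|].
    pose proof (Cmod_plus_INR_le a k) as Ua. pose proof (Cmod_plus_INR_le b k) as Ub.
    pose proof (Cmod_ge_0 (a + INR k)); pose proof (Cmod_ge_0 (b + INR k)).
    assert (P : 0 <= Cmod (a + INR k) * Cmod (b + INR k)) by (apply Rmult_le_pos; assumption).
    apply Rle_trans with (Cmod (a + INR k) * Cmod (b + INR k)).
    - set (X := Cmod (a + INR k) * Cmod (b + INR k)) in *. set (Y := Cmod (c + INR k)) in *.
      replace (X / (Y * (INR k + 1)) * ((g + INR k) * (INR k + 1))) with (X * ((g + INR k) / Y))
        by (field; split; lra).
      rewrite <- (Rmult_1_r X) at 2. apply Rmult_le_compat_l; [assumption|].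
      apply Rmult_le_reg_r with Y; [lra|]. unfold Rdiv. rewrite Rmult_assoc, Rinv_l by lra. lra.
    - apply Rmult_le_compat; assumption. }
  assert (I : forall n, d / (2 * (g + 1)) * sum_n (fun k => t (S k)) n + INR (S (S n)) * t (S (S n))
     <= Cmod a * Cmod b / g).
  { assert (T1 : t 1%nat <= Cmod a * Cmod b / g).
    { pose proof (St O) as Q. unfold t at 2 in Q. rewrite hyp_coef_O, Cmod_1 in Q. simpl INR in Q.
      apply Rmult_le_reg_r with g; [assumption|]. unfold Rdiv. rewrite Rmult_assoc, Rinv_l; lra. }
    assert (Q : forall n, INR (S (S n)) * t (S (S n)) + d / (2 * (g + 1)) * t (S n) <= INR (S n) * t (S n)).
    { intros n. pose proof (St (S n)) as Q. rewrite (S_INR (S n)).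
      set (k := INR (S n)) in *. assert (Hk : 1 <= k).
      { unfold k. rewrite S_INR. pose proof (pos_INR n); lra. }
      pose proof (Cmod_ge_0 (hyp_coef a b c (S n)) : 0 <= t (S n)) as P1.
      pose proof (Cmod_ge_0 (hyp_coef a b c (S (S n))) : 0 <= t (S (S n))) as P2.
      (* From [g + k <= k (g + 1)], valid because [k >= 1]; hence the factor [g + 1] in the final
         bound. *)
      assert (Kd : d / (2 * (g + 1)) * (g + k) <= k * d / 2).
      { apply Rmult_le_reg_r with (2 * (g + 1)); [lra|].
        replace (d / (2 * (g + 1)) * (g + k) * (2 * (g + 1))) with (d * (g + k)) by (field; lra).
        replace (k * d / 2 * (2 * (g + 1))) with (d * (k * (g + 1))) by field.
        apply Rmult_le_compat_l; [lra|]. nra. }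
      apply Rmult_le_reg_r with (g + k); [lra|].
      replace ((( k + 1) * t (S (S n)) + d / (2 * (g + 1)) * t (S n)) * (g + k))
        with (t (S (S n)) * ((g + k) * (k + 1)) + (d / (2 * (g + 1)) * (g + k)) * t (S n)) by ring.
      apply Rle_trans with (t (S n) * ((Cmod a + k) * (Cmod b + k)) + (k * d / 2) * t (S n)).
      - apply Rplus_le_compat; [exact Q | apply Rmult_le_compat_r; assumption].
      - replace (k * t (S n) * (g + k)) with (t (S n) * (k * (g + k))) by ring.
        rewrite (Rmult_comm (k * d / 2)), <- Rmult_plus_distr_l. apply Rmult_le_compat_l; [assumption|].
        assert (Cmod a * Cmod b <= k * d / 2) by nra.
        replace (k * (g + k)) with (k * k + k * (Cmod a + Cmod b) + k * d) by (unfold d; ring). nra. }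
    induction n as [|n IH].
    - rewrite sum_O. pose proof (Q O) as Q0. simpl INR in *. lra.
    - rewrite sum_Sn. pose proof (Q (S n)) as Q0.
      change (AbelianMonoid.plus _ _ (sum_n (fun k => t (S k)) n) (t (S (S n))))
        with (sum_n (fun k => t (S k)) n + t (S (S n))).
      rewrite Rmult_plus_distr_l. lra. }
  specialize (I N).
  assert (0 <= INR (S (S N)) * t (S (S N))).
  { apply Rmult_le_pos; [apply pos_INR | apply Cmod_ge_0]. }
  change (sum_n (fun k => t (S k)) N <= 2 * (Cmod a * Cmod b) * (g + 1) / (g * d)).
  set (Sg := sum_n (fun k => t (S k)) N) in *.
  assert (P : 0 < d / (2 * (g + 1))) by (apply Rdiv_lt_0_compat; lra).
  apply Rmult_le_reg_l with (d / (2 * (g + 1))); [assumption|].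
  replace (d / (2 * (g + 1)) * (2 * (Cmod a * Cmod b) * (g + 1) / (g * d))) with (Cmod a * Cmod b / g) by (field; repeat split; lra).
  lra.
Qed.

Lemma nonpole_plus_INR (c : C) (n : nat) : nonpole c -> nonpole (c + INR n)%C.
Proof.
  intros H m E. apply (H (n + m)%nat). rewrite plus_INR, RtoC_plus, <- E. ring.
Qed.

Lemma filterlim_inv_INR (K : R) : filterlim (fun n : nat => K / INR n) eventually (locally 0).
Proof.
  replace 0 with (K * 0) by ring.
  apply filterlim_Rmult; [apply filterlim_const|].
  refine (is_lim_seq_inv INR p_infty is_lim_seq_INR _); discriminate.
Qed.

(** For [s + n] with large [n], [A] is the limit of F at 1, and all terms of the series beyond the
    leading 1 sum to [O(1/n)] uniformly in the argument. *)
Lemma connection_gauss_bound (a b s : C) : exists K : R, exists N : nat, forall n A B,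
  (N <= n)%nat -> nonint s -> connection a b (s + INR n) A B -> Cmod (A - 1) <= K / INR n.
Proof.
  pose proof (Cmod_ge_0 a) as Pa; pose proof (Cmod_ge_0 b) as Pb.
  set (P := Cmod a * Cmod b). assert (HP : 0 <= P) by (apply Rmult_le_pos; assumption).
  (* From this index on, [Re c >= n/2], and [Re c - |a| - |b|] is at least both [n/4] and [2 P].
     With [g + 1 <= 2 g] these estimates give the constant [16 P]. *)
  destruct (nat_above (2 * (1 + Rabs (Re s) + Rabs (Re (a + b + s)) + Cmod a + Cmod b + 2 * P))) as [N HN].
  exists (16 * P), N. intros n A B Hn Hs H.
  apply le_INR in Hn.
  pose proof (Rabs_def2 (Re s) (Rabs (Re s) + 1) ltac:(lra)) as [_ Rs].
  pose proof (Rabs_def2 (Re (a + b + s)) (Rabs (Re (a + b + s)) + 1) ltac:(lra)) as [_ Rc].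
  pose proof (Rabs_pos (Re s)); pose proof (Rabs_pos (Re (a + b + s))).
  pose proof (connection_lim a b (s + INR n) A B (nonint_plus_INR s n Hs)
    ltac:(rewrite re_plus, re_RtoC; lra) H) as L.
  set (c := (a + b + (s + INR n))%C) in *.
  assert (Eg : Re c = Re (a + b + s) + INR n).
  { unfold c. rewrite !re_plus, re_RtoC. ring. }
  set (g := Re c) in *.
  assert (Hg : INR n / 2 <= g) by lra.
  assert (Hd : INR n / 4 <= g - Cmod a - Cmod b) by lra.
  assert (Hgn : 1 <= INR n) by lra.
  assert (Bd : forall z, 0 < z < 1 -> Cmod (hyp2F1 a b c (1 - z) - 1) <= 2 * P * (g + 1) / (g * (g - Cmod a - Cmod b))).
  { intros z Hz. rewrite <- (hyp_coef_O a b c). apply CPSeries_sub_le.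
    - apply unit_radius_hyp_coef, nonpole_Re_pos. fold g. lra.
    - apply Rabs_lt_1_of_01; lra.
    - intros M. apply hyp_coef_sum_le; fold g; fold P; lra. }
  apply Rnot_lt_le; intros Hlt.
  assert (Q : 2 * P * (g + 1) / (g * (g - Cmod a - Cmod b)) <= 16 * P / INR n).
  { assert (0 < g * (g - Cmod a - Cmod b)) by (apply Rmult_lt_0_compat; lra).
    apply Rmult_le_reg_r with (g * (g - Cmod a - Cmod b)); [assumption|].
    replace (2 * P * (g + 1) / (g * (g - Cmod a - Cmod b)) * (g * (g - Cmod a - Cmod b)))
      with (P * (2 * (g + 1))) by (field; lra).
    replace (16 * P / INR n * (g * (g - Cmod a - Cmod b)))
      with (P * (g * (16 * (g - Cmod a - Cmod b) / INR n))) by (field; lra).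
    apply Rmult_le_compat_l; [assumption|].
    assert (4 <= 16 * (g - Cmod a - Cmod b) / INR n).
    { apply Rmult_le_reg_r with (INR n); [lra|]. unfold Rdiv. rewrite Rmult_assoc, Rinv_l; lra. }
    assert (g * 4 <= g * (16 * (g - Cmod a - Cmod b) / INR n)) by (apply Rmult_le_compat_l; lra).
    lra. }
  assert (He : 0 < Cmod (A - 1) - 16 * P / INR n) by lra.
  pose proof (Clim_Cmod_sub _ _ L (mkposreal _ He)) as E.
  pose proof (filter_and _ _ E (at_right_01 _ Bd)) as E2.
  destruct (filter_ex _ E2) as [z [E3 E4]]. simpl in E3.
  pose proof (Cmod_triangle (hyp2F1 a b c (1 - z) - 1) (- (hyp2F1 a b c (1 - z) - A))) as T.
  rewrite Cmod_opp in T.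
  replace (hyp2F1 a b c (1 - z) - 1 + - (hyp2F1 a b c (1 - z) - A))%C with (A - 1)%C in T by ring.
  lra.
Qed.

(** Cross-multiplied, so that the induction only multiplies the invariant by one more instance of
    [connection_step]. *)
Lemma connection_iterate (a b s A B : C) (n : nat) :
  nonpole (a + b + s) -> nonint s -> -1 < Re s -> connection a b s A B ->
  exists A' B' : C, connection a b (s + INR n) A' B' /\
  (A * (poch (a + b + s) n * poch s n) = poch (a + s) n * poch (b + s) n * A')%C.
Proof.
  intros Hc Hs Rs H. induction n as [|n (A' & B' & H' & E)].
  - exists A, B. split; [|simpl; ring].
    simpl INR. replace (s + 0)%C with s by ring. exact H.
  - assert (Hs' := nonint_plus_INR s n Hs).
    assert (Hc' : nonpole (a + b + (s + INR n))).
    { replace (a + b + (s + INR n))%C with (a + b + s + INR n)%C by ring.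
      apply nonpole_plus_INR, Hc. }
    destruct (connection_exists a b (s + INR (S n))) as (A2 & B2 & H2).
    + replace (a + b + (s + INR (S n)))%C with (a + b + s + INR (S n))%C by ring.
      apply nonpole_plus_INR, Hc.
    + apply nonint_plus_INR, Hs.
    + exists A2, B2. split; [exact H2|].
      replace (s + INR (S n))%C with (s + INR n + 1)%C in H2 by (rewrite RtoC_INR_S; ring).
      assert (Rs' : -1 < Re (s + INR n)).
      { rewrite re_plus, re_RtoC. pose proof (pos_INR n); lra. }
      pose proof (connection_step a b (s + INR n) A' B' A2 B2 Hc' Hs' Rs' H' H2) as E2.
      simpl poch.
      replace (A * (poch (a + b + s) n * (a + b + s + INR n) * (poch s n * (s + INR n))))%C
        with (A * (poch (a + b + s) n * poch s n) * ((a + b + (s + INR n)) * (s + INR n)))%C by ring.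
      rewrite E.
      replace (poch (a + s) n * poch (b + s) n * A' * ((a + b + (s + INR n)) * (s + INR n)))%C
        with (poch (a + s) n * poch (b + s) n * (A' * ((a + b + (s + INR n)) * (s + INR n))))%C by ring.
      rewrite E2. ring.
Qed.

Lemma connection_gauss_poch (a b s A B : C) :
  nonpole (a + b + s) -> nonint s -> -1 < Re s -> connection a b s A B ->
  Clim eventually
    (fun n => poch (a + s) n * poch (b + s) n / (poch (a + b + s) n * poch s n))%C A.
Proof.
  intros Hc Hs Rs H.
  destruct (connection_gauss_bound a b s) as (K & N & HK).
  set (r := fun n => (poch (a + s) n * poch (b + s) n / (poch (a + b + s) n * poch s n))%C).
  assert (W : forall n, (N <= n)%nat -> exists A', A = (r n * A')%C /\ Cmod (A' - 1) <= K / INR n).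
  { intros n Hn. destruct (connection_iterate a b s A B n Hc Hs Rs H) as (A' & B' & H' & E).
    exists A'. split; [|eapply HK; eassumption].
    pose proof (poch_neq_0 _ n Hc). pose proof (poch_neq_0 _ n (nonint_nonpole s Hs)).
    transitivity (A * (poch (a + b + s) n * poch s n) / (poch (a + b + s) n * poch s n))%C;
      [field; auto | rewrite E; unfold r; field; auto]. }
  (* [|r n| (1 - K/n) <= |A|], hence [r] is bounded and [A - r n = r n (A' - 1)] tends to 0. *)
  assert (B1 : eventually (fun n => K / INR n < / 2)).
  { pose proof (proj1 (filterlim_locally _ _) (filterlim_inv_INR K) (mkposreal (/ 2) ltac:(lra))) as E.
    eapply filter_imp; [|exact E]. intros n Hn. change (Rabs (K / INR n - 0) < / 2) in Hn.
    apply Rabs_def2 in Hn. lra. }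
  assert (Z : Clim eventually (fun n => r n - A)%C (RtoC 0)).
  { apply (Clim_0_le _ (fun n => 2 * Cmod A * K / INR n)); [|apply filterlim_inv_INR].
    assert (EN : eventually (fun n => (N <= n)%nat)) by (exists N; auto).
    eapply filter_imp; [|exact (filter_and _ _ EN B1)]. intros n [Hn Hb].
    destruct (W n Hn) as (A' & E & Bd).
    assert (R1 : Cmod (r n) <= 2 * Cmod A).
    { pose proof (Cmod_triangle (A') (1 - A')) as T.
      replace (A' + (1 - A'))%C with (RtoC 1) in T by ring. rewrite Cmod_1 in T.
      replace (1 - A')%C with (- (A' - 1))%C in T by ring. rewrite Cmod_opp in T.
      rewrite E, Cmod_mult. pose proof (Cmod_ge_0 (r n)). nra. }
    replace (r n - A)%C with (- (r n * (A' - 1)))%C by (rewrite E; ring).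
    rewrite Cmod_opp, Cmod_mult.
    replace (2 * Cmod A * K / INR n) with (2 * Cmod A * (K / INR n)) by (unfold Rdiv; ring).
    apply Rmult_le_compat; try apply Cmod_ge_0; assumption. }
  eapply Clim_ext_loc; [|eapply Clim_eq; [apply (Clim_plus _ _ _ _ Z (Clim_const A))|]].
  - apply filter_forall. intros n. cbv beta. ring.
  - ring.
Qed.

(** * The Gamma function *)

Lemma is_derive_0_linear_bound (f : R -> R) (l : R) :
  is_derive f 0 l -> f 0 = 0 -> exists K d : R, 0 < d /\ forall t, Rabs t < d -> Rabs (f t) <= K * Rabs t.
Proof.
  intros D F0. apply is_derive_Reals in D.
  destruct (D 1 Rlt_0_1) as [d Hd]. exists (Rabs l + 1), d. split; [apply cond_pos|].
  intros t Ht. destruct (Req_dec t 0) as [->|Nt].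
  - rewrite F0, Rabs_R0. lra.
  - specialize (Hd t Nt Ht). rewrite Rplus_0_l, F0, Rminus_0_r in Hd.
    assert (Q : Rabs (f t / t) <= Rabs l + 1).
    { pose proof (Rabs_triang_inv (f t / t) l). lra. }
    replace (f t) with (f t / t * t) by (field; assumption).
    rewrite Rabs_mult. apply Rmult_le_compat_r; [apply Rabs_pos | assumption].
Qed.

(** Mean value theorem, with the derivative at the intermediate point bounded linearly. *)
Lemma is_derive_quadratic_bound (F f : R -> R) (l : R) :
  locally 0 (fun t => is_derive F t (f t)) -> f 0 = 0 -> is_derive f 0 l ->
  exists K d : R, 0 < d /\ forall t, Rabs t < d -> Rabs (F t - F 0) <= K * (t * t).
Proof.
  intros [e He] F0 D. destruct (is_derive_0_linear_bound f l D F0) as (K & d & Hd & HK).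
  exists (Rmax K 0), (Rmin d e). split; [apply Rmin_glb_lt; [assumption | apply cond_pos]|].
  intros t Ht.
  assert (Hte : forall x, Rmin 0 t <= x <= Rmax 0 t -> Rabs x <= Rabs t).
  { intros x Hx. unfold Rmin, Rmax in Hx. unfold Rabs. destruct (Rle_dec 0 t), (Rcase_abs x), (Rcase_abs t); lra. }
  assert (De : forall x, Rmin 0 t <= x <= Rmax 0 t -> is_derive F x (f x)).
  { intros x Hx. apply He. change (Rabs (x - 0) < e). rewrite Rminus_0_r.
    pose proof (Hte x Hx). pose proof (Rmin_r d e). lra. }
  destruct (MVT_gen F 0 t f) as (x & Hx & E).
  - intros x Hx. apply De. lra.
  - intros x Hx. apply continuity_pt_filterlim, (ex_derive_continuous F). eexists; apply De, Hx.
  - rewrite E, Rminus_0_r, Rabs_mult.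
    pose proof (Hte x Hx) as Q. pose proof (Rmin_l d e).
    pose proof (HK x ltac:(lra)) as B. pose proof (Rmax_l K 0); pose proof (Rmax_r K 0).
    replace (t * t) with (Rabs t * Rabs t) by (rewrite <- Rabs_mult; apply Rabs_pos_eq; nra).
    rewrite <- Rmult_assoc. apply Rmult_le_compat_r; [apply Rabs_pos|].
    eapply Rle_trans; [exact B|]. pose proof (Rabs_pos x). nra.
Qed.

(** Used with [t = 1/n]: a smooth ratio function with zero derivative at 0 equals its value there up
    to [O(1/n^2)]. *)
Lemma Cdiffn_quadratic_bound (f : R -> C) :
  Cdiffn 2 f 0 -> is_Cderive f 0 (RtoC 0) ->
  exists K d : R, 0 < d /\ forall t, Rabs t < d -> Cmod (f t - f 0) <= K * (t * t).
Proof.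
  intros (f' & D & f'' & D' & _) D0.
  assert (E0 : f' 0 = RtoC 0).
  { rewrite <- (is_Cderive_unique _ _ _ D0). symmetry.
    apply is_Cderive_unique, (locally_singleton _ _ D). }
  apply locally_singleton in D'. destruct D' as [D1 D2].
  assert (W : forall p : C -> R, is_derive (fun t => p (f' t)) 0 (p (f'' 0)) -> p (RtoC 0) = 0 ->
    locally 0 (fun t => is_derive (fun t => p (f t)) t (p (f' t))) ->
    exists K d : R, 0 < d /\ forall t, Rabs t < d -> Rabs (p (f t) - p (f 0)) <= K * (t * t)).
  { intros p Dp Hp Lp. eapply (is_derive_quadratic_bound (fun t => p (f t)) (fun t => p (f' t))).
    - exact Lp.
    - cbv beta. rewrite E0. exact Hp.
    - exact Dp. }
  destruct (W Re D1 eq_refl) as (K1 & d1 & P1 & B1); [eapply filter_imp; [|exact D]; intros t [? ?]; assumption|].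
  destruct (W Im D2 eq_refl) as (K2 & d2 & P2 & B2); [eapply filter_imp; [|exact D]; intros t [? ?]; assumption|].
  exists (K1 + K2), (Rmin d1 d2). split; [apply Rmin_glb_lt; assumption|].
  intros t Ht. eapply Rle_trans; [apply Cmod_le_Re_Im|].
  pose proof (Rmin_l d1 d2); pose proof (Rmin_r d1 d2).
  specialize (B1 t ltac:(lra)). specialize (B2 t ltac:(lra)).
  change (Rabs (Re (f t) - Re (f 0)) + Rabs (Im (f t) - Im (f 0)) <= (K1 + K2) * (t * t)). lra.
Qed.

(** The relative increments have a telescoping majorant. By [1 + x <= exp x] the quantity
    [|u_n| exp (K / (n + 1))] is nonincreasing, so [u] is bounded; the absolute increments are then
    dominated by a telescoping sequence as well. *)
Lemma Cseq_converges_shifted (u : nat -> C) (K : R) : 0 <= K ->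
  (forall n, Cmod (u (S n) - u n) <= K * (/ (INR n + 1) - / (INR n + 2)) * Cmod (u n)) ->
  exists l : C, Clim eventually u l.
Proof.
  intros HK H.
  set (e := fun n => / (INR n + 1)).
  assert (He : forall n, / (INR n + 2) = e (S n)).
  { intros n. unfold e. rewrite S_INR. f_equal; ring. }
  assert (Pe : forall n, 0 <= e n <= 1).
  { intros n. pose proof (pos_INR n). unfold e. split.
    - apply Rlt_le, Rinv_0_lt_compat; lra.
    - rewrite <- Rinv_1. apply Rinv_le_contravar; lra. }
  assert (De : forall n, e (S n) <= e n).
  { intros n. unfold e. rewrite S_INR. pose proof (pos_INR n). apply Rinv_le_contravar; lra. }
  assert (M : forall n, Cmod (u n) * exp (K * e n) <= Cmod (u O) * exp (K * e O)).
  { induction n as [|n IH]; [lra|]. eapply Rle_trans; [|exact IH].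
    pose proof (H n) as Hn. rewrite He in Hn. fold (e n) in Hn.
    pose proof (Cmod_triangle (u n) (u (S n) - u n)) as T.
    replace (u n + (u (S n) - u n))%C with (u (S n)) in T by ring.
    replace (K * e n) with (K * (e n - e (S n)) + K * e (S n)) by ring.
    rewrite exp_plus, <- Rmult_assoc. apply Rmult_le_compat_r; [apply Rlt_le, exp_pos|].
    pose proof (exp_ineq1_le (K * (e n - e (S n)))) as X. pose proof (Cmod_ge_0 (u n)). nra. }
  set (M0 := Cmod (u O) * exp (K * e O)) in *.
  assert (Bu : forall n, Cmod (u n) <= M0).
  { intros n. eapply Rle_trans; [|apply M]. rewrite <- (Rmult_1_r (Cmod (u n))) at 1.
    apply Rmult_le_compat_l; [apply Cmod_ge_0|].
    rewrite <- exp_0. pose proof (Pe n). destruct (Req_dec (K * e n) 0) as [->|]; [lra|].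
    apply Rlt_le, exp_increasing. nra. }
  assert (S1 : forall n, Cmod (u (S n) - u n) <= K * M0 * (e n - e (S n))).
  { intros n. eapply Rle_trans; [apply H|]. rewrite He. fold (e n).
    pose proof (Bu n). pose proof (De n). pose proof (Cmod_ge_0 (u n)).
    replace (K * M0 * (e n - e (S n))) with (K * (e n - e (S n)) * M0) by ring.
    apply Rmult_le_compat_l; [|assumption]. apply Rmult_le_pos; lra. }
  assert (Le : is_lim_seq e 0).
  { apply (is_lim_seq_ext (fun n => / INR (S n))); [intros n; unfold e; rewrite S_INR; reflexivity|].
    apply (is_lim_seq_incr_1 (fun n => / INR n)).
    refine (is_lim_seq_inv INR p_infty is_lim_seq_INR _); discriminate. }
  assert (PM : 0 <= M0) by (eapply Rle_trans; [apply Cmod_ge_0 | apply (Bu O)]).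
  assert (W : forall v : nat -> R, (forall n, Rabs (v n) <= Cmod (u n)) ->
     (forall n, Rabs (v (S n) - v n) <= Cmod (u (S n) - u n)) -> exists l, is_lim_seq v (Finite l)).
  { intros v V1 V2.
    (* Adding [K M0 e_n], which tends to 0, makes each real component decreasing and bounded
       below. *)
    destruct (ex_finite_lim_seq_decr (fun n => v n + K * M0 * e n) (- M0)) as [l Hl].
    - intros n. pose proof (V2 n). pose proof (S1 n). pose proof (Rle_abs (v (S n) - v n)). lra.
    - intros n. pose proof (V1 n). pose proof (Bu n). pose proof (Rle_abs (- v n)). rewrite Rabs_Ropp in *.
      assert (0 <= K * M0 * e n) by (apply Rmult_le_pos; [apply Rmult_le_pos; assumption | apply Pe]). lra.
    - exists l. apply (is_lim_seq_ext (fun n => (v n + K * M0 * e n) - K * M0 * e n)); [intros n; ring|].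
      replace (Finite l) with (Finite (l - K * M0 * 0)) by (f_equal; ring).
      apply is_lim_seq_minus'; [exact Hl|]. apply (is_lim_seq_scal_l e (K * M0) 0 Le). }
  destruct (W (fun n => Re (u n))) as [l1 H1].
  - intros n. apply re_le_Cmod.
  - intros n. apply (re_le_Cmod (u (S n) - u n)).
  - destruct (W (fun n => Im (u n))) as [l2 H2].
    + intros n. apply im_le_Cmod.
    + intros n. apply (im_le_Cmod (u (S n) - u n)).
    + exists (l1, l2). split; [exact H1 | exact H2].
Qed.

(** The factor 2 comes from [1/x^2 <= 2 (1/x - 1/(x+1))] for [x >= 1], applied with [x = n + 1]
    after dropping the first [N + 1] terms. *)
Lemma Cseq_converges (u : nat -> C) (K : R) (N : nat) :
  (forall n, (N <= n)%nat -> Cmod (u (S n) - u n) <= K * (/ INR n * / INR n) * Cmod (u n)) ->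
  exists l : C, Clim eventually u l.
Proof.
  intros H. destruct (Cseq_converges_shifted (fun n => u (n + S N)%nat) (2 * Rmax K 0)) as [l Hl].
  - pose proof (Rmax_r K 0); lra.
  - intros n. specialize (H (n + S N)%nat ltac:(lia)).
    eapply Rle_trans; [exact H|]. apply Rmult_le_compat_r; [apply Cmod_ge_0|].
    pose proof (pos_INR n). pose proof (pos_INR N). rewrite plus_INR, S_INR.
    set (x := INR n + 1). assert (Hx : 1 <= x) by (unfold x; lra).
    apply Rle_trans with (Rmax K 0 * (/ x * / x)).
    + pose proof (Rmax_l K 0); pose proof (Rmax_r K 0).
      assert (0 < / (INR n + (INR N + 1))) by (apply Rinv_0_lt_compat; lra).
      assert (0 < / x) by (apply Rinv_0_lt_compat; lra).
      assert (/ (INR n + (INR N + 1)) <= / x) by (apply Rinv_le_contravar; unfold x; lra).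
      apply Rle_trans with (Rmax K 0 * (/ (INR n + (INR N + 1)) * / (INR n + (INR N + 1)))).
      * apply Rmult_le_compat_r; nra.
      * apply Rmult_le_compat_l; [assumption|]. apply Rmult_le_compat; lra.
    + rewrite (Rmult_comm 2), Rmult_assoc. apply Rmult_le_compat_l; [apply Rmax_r|].
      replace (INR n + 2) with (x + 1) by (unfold x; ring).
      replace (2 * (/ x - / (x + 1))) with (/ x * (2 * / (x + 1))) by (field; lra).
      apply Rmult_le_compat_l; [apply Rlt_le, Rinv_0_lt_compat; lra|].
      apply Rmult_le_reg_r with (x * (x + 1)); [nra|].
      replace (/ x * (x * (x + 1))) with (x + 1) by (field; lra).
      replace (2 * / (x + 1) * (x * (x + 1))) with (2 * x) by (field; lra). lra.
  - exists l. destruct Hl as [A B]. split.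
    + apply (is_lim_seq_incr_n (fun n => Re (u n)) (S N) (Re l)). exact A.
    + apply (is_lim_seq_incr_n (fun n => Im (u n)) (S N) (Im l)). exact B.
Qed.

(** The ratio of consecutive terms of Euler's limit as a smooth function of [t = 1/n]. *)
Definition Gamma_ratio (z : C) (t : R) : C := (Rcpow (1 + t) (z + 1) * / (1 + (z + 1) * t))%C.

Lemma Gamma_seq_S (z : C) (n : nat) : nonpole z -> (1 <= n)%nat ->
  Gamma_seq z (S n) = (Gamma_seq z n * Gamma_ratio z (/ INR n))%C.
Proof.
  intros Hz Hn. apply le_INR in Hn. simpl INR in Hn.
  unfold Gamma_seq, Gamma_ratio.
  change (poch z (S (S n))) with (poch z (S n) * (z + INR (S n)))%C.
  pose proof (poch_neq_0 z (S n) Hz). pose proof (Hz (S n)) as Hs.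
  rewrite fact_simpl, mult_INR, RtoC_mult.
  assert (N0 : RtoC (INR n) <> RtoC 0) by (apply RtoC_neq_0; lra).
  replace (1 + / INR n) with (INR (S n) * / INR n) by (rewrite S_INR; field; lra).
  assert (Pn : 0 < INR n) by lra. assert (PS : 0 < INR (S n)) by (rewrite S_INR; lra).
  rewrite Rcpow_mult, Rcpow_inv, Rcpow_opp, !Rcpow_plus, !Rcpow_1
    by (try apply Rinv_0_lt_compat; assumption).
  rewrite RtoC_inv by lra. rewrite RtoC_INR_S in *.
  assert (N1 : (z + INR n + 1)%C <> RtoC 0) by (intros E; apply Hs; rewrite <- E; ring).
  field. repeat split; auto using Rcpow_neq_0.
  intros E; apply N1. rewrite <- E. ring.
Qed.

Lemma Cdiffn_affine (k : nat) (c d : C) (x : R) : Cdiffn k (fun t => c + d * t)%C x.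
Proof.
  apply Cdiffn_plus; [apply Cdiffn_const|]. apply Cdiffn_mult; [apply Cdiffn_const | apply Cdiffn_RtoC].
Qed.

Lemma Gamma_ratio_0 (z : C) : Gamma_ratio z 0 = RtoC 1.
Proof. unfold Gamma_ratio. rewrite Rplus_0_r, Rcpow_1_l. field. Qed.

Lemma Gamma_ratio_den_neq_0 (z : C) : (1 + (z + 1) * 0%R)%C <> RtoC 0.
Proof. replace (1 + (z + 1) * 0%R)%C with (RtoC 1) by ring. apply RtoC_neq_0; lra. Qed.

Lemma Cdiffn_Gamma_ratio (k : nat) (z : C) : Cdiffn k (Gamma_ratio z) 0.
Proof.
  apply Cdiffn_mult.
  - apply (Cdiffn_comp k (fun t => Rcpow t (z + 1)) (fun t => 1 + t)).
    + apply Cdiffn_Rcpow; lra.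
    + apply (Cdiffn_ext_loc k (fun t => 1 + 1 * t)%C); [|apply Cdiffn_affine].
      apply filter_forall. intros t. rewrite RtoC_plus. ring.
  - apply Cdiffn_inv; [apply Cdiffn_affine | apply Gamma_ratio_den_neq_0].
Qed.

(** The linear terms [(z + 1) t] of numerator and denominator cancel; this is why Euler's limit
    converges. *)
Lemma is_Cderive_Gamma_ratio (z : C) : is_Cderive (Gamma_ratio z) 0 (RtoC 0).
Proof.
  eapply is_Cderive_eq.
  - apply is_Cderive_mult.
    + apply (is_Cderive_Rcpow_comp (z + 1) (fun t => 1 + t) 0 1); [lra|].
      auto_derive; [trivial | ring].
    + apply is_Cderive_inv; [|apply Gamma_ratio_den_neq_0].
      apply is_Cderive_plus; [apply is_Cderive_const|]. apply is_Cderive_scal, is_Cderive_id.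
  - cbv beta. rewrite Rplus_0_r, !Rcpow_1_l. field.
Qed.

Lemma Cseq_quadratic_converges (u : nat -> C) (phi : R -> C) :
  Cdiffn 2 phi 0 -> is_Cderive phi 0 (RtoC 0) -> phi 0 = RtoC 1 ->
  (forall n, (1 <= n)%nat -> u (S n) = (u n * phi (/ INR n)%R)%C) ->
  exists l : C, Clim eventually u l.
Proof.
  intros D D0 E0 H.
  destruct (Cdiffn_quadratic_bound phi D D0) as (K & d & Hd & B).
  destruct (nat_above (/ d + 1)) as [N HN].
  apply (Cseq_converges u K N). intros n Hn. apply le_INR in Hn.
  assert (Pd : 0 < / d) by (apply Rinv_0_lt_compat; assumption).
  assert (L : / INR n < d).
  { rewrite <- (Rinv_inv d). apply Rinv_lt_contravar; [apply Rmult_lt_0_compat|]; lra. }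
  assert (Pn : 0 < / INR n) by (apply Rinv_0_lt_compat; lra).
  rewrite H by (apply INR_le; simpl; lra).
  replace (u n * phi (/ INR n)%R - u n)%C with ((phi (/ INR n)%R - phi 0%R) * u n)%C by (rewrite E0; ring).
  rewrite Cmod_mult. apply Rmult_le_compat_r; [apply Cmod_ge_0|].
  apply B. rewrite Rabs_pos_eq; lra.
Qed.

Lemma CGamma_Clim (z l : C) : Clim eventually (Gamma_seq z) l -> CGamma z = l.
Proof.
  intros [A B]. unfold CGamma.
  rewrite (is_lim_seq_unique _ (Re l) A), (is_lim_seq_unique _ (Im l) B).
  symmetry; apply surjective_pairing.
Qed.

Lemma RtoC_1_neq_0 : RtoC 1 <> RtoC 0.
Proof. apply RtoC_neq_0; lra. Qed.

(** The convergence criterion also applies to the reciprocals. The product of the two limits is 1,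
    so neither is 0. *)
Lemma CGamma_correct (z : C) : nonpole z ->
  Clim eventually (Gamma_seq z) (CGamma z) /\ CGamma z <> RtoC 0.
Proof.
  intros Hz.
  destruct (Cseq_quadratic_converges (Gamma_seq z) (Gamma_ratio z)) as [l Hl];
    auto using Cdiffn_Gamma_ratio, is_Cderive_Gamma_ratio, Gamma_ratio_0, Gamma_seq_S.
  assert (N0 : Gamma_ratio z 0 <> RtoC 0) by (rewrite Gamma_ratio_0; apply RtoC_1_neq_0).
  destruct (Cseq_quadratic_converges (fun n => / Gamma_seq z n)%C (fun t => / Gamma_ratio z t)%C) as [m Hm].
  - apply Cdiffn_inv; [apply Cdiffn_Gamma_ratio | exact N0].
  - eapply is_Cderive_eq; [apply is_Cderive_inv; [apply is_Cderive_Gamma_ratio | exact N0]|].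
    ring.
  - rewrite Gamma_ratio_0. field.
  - intros n Hn. rewrite Gamma_seq_S by assumption.
    assert (G0 : forall k, Gamma_seq z k <> RtoC 0).
    { intros k. unfold Gamma_seq. apply Cmult_neq_0; [apply Cmult_neq_0|].
      - apply fact_C_neq_0.
      - apply Rcpow_neq_0.
      - intros E. apply (Cmult_neq_0 _ _ RtoC_1_neq_0 RtoC_1_neq_0).
        pose proof (poch_neq_0 z (S k) Hz).
        transitivity (poch z (S k) * / poch z (S k))%C; [field; assumption | rewrite E; ring]. }
    assert (R0 : Gamma_ratio z (/ INR n) <> RtoC 0).
    { intros E. apply (G0 (S n)). rewrite Gamma_seq_S, E by assumption. ring. }
    field. split; [exact R0 | apply G0].
  - rewrite (CGamma_Clim z l Hl). split; [exact Hl|]. intros El.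
    assert (E : RtoC 1 = (l * m)%C).
    { apply (Clim_unique eventually (fun n => Gamma_seq z n * / Gamma_seq z n)%C); [|apply Clim_mult; assumption].
      apply (Clim_ext_loc (fun _ => RtoC 1)); [|apply Clim_const].
      apply filter_forall. intros k. pose proof (poch_neq_0 z (S k) Hz).
      unfold Gamma_seq. field. auto using fact_C_neq_0, Rcpow_neq_0. }
    apply RtoC_1_neq_0. rewrite E, El. ring.
Qed.

Lemma Cinv_0 : (/ RtoC 0)%C = RtoC 0.
Proof. apply C_ext; simpl; unfold Rdiv; ring. Qed.

(** The terms of Euler's limit for 1/Gamma: the Pochhammer symbol stands in the numerator, so they
    are meaningful at the poles of Gamma. *)
Definition inv_Gamma_seq (z : C) (n : nat) : C := (poch z (S n) / (INR (fact n) * Rcpow (INR n) z))%C.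

(* Also at the poles, where both sides are 0. *)
Lemma inv_CGamma_Clim (z : C) : Clim eventually (inv_Gamma_seq z) (/ CGamma z)%C.
Proof.
  destruct (classic (nonpole z)) as [Hz|Hz].
  - destruct (CGamma_correct z Hz) as [L N].
    apply (Clim_ext_loc (fun n => / Gamma_seq z n)%C); [|apply Clim_inv; assumption].
    apply filter_forall. intros n. pose proof (poch_neq_0 z (S n) Hz).
    unfold inv_Gamma_seq, Gamma_seq. field. auto using fact_C_neq_0, Rcpow_neq_0.
  - apply not_all_ex_not in Hz. destruct Hz as [m Hm].
    apply NNPP in Hm.
    assert (P0 : forall n, (m <= n)%nat -> poch z (S n) = RtoC 0).
    { intros n Hn. induction Hn as [|n Hn IH].
      - simpl. rewrite Hm. ring.
      - change (poch z (S n) * (z + INR (S n)) = RtoC 0)%C. rewrite IH. ring. }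
    rewrite (CGamma_Clim z (RtoC 0)), Cinv_0.
    + apply (Clim_ext_loc (fun _ => RtoC 0)); [|apply Clim_const].
      eapply filter_imp; [|apply (ex_intro _ m (fun n Hn => Hn))]. intros n Hn.
      unfold inv_Gamma_seq, Cdiv. rewrite P0 by assumption. ring.
    + apply (Clim_ext_loc (fun _ => RtoC 0)); [|apply Clim_const].
      eapply filter_imp; [|apply (ex_intro _ m (fun n Hn => Hn))]. intros n Hn.
      unfold Gamma_seq, Cdiv. rewrite P0, Cinv_0 by assumption. ring.
Qed.

(** Because [c + d = e + f], the powers of [n] in Euler's limits cancel. Reciprocals of Gamma allow
    [c] and [d] to be poles. *)
Lemma poch_ratio_Gamma (c d e f r : C) :
  nonpole e -> nonpole f -> (c + d)%C = (e + f)%C ->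
  Clim eventually (fun n => poch c n * poch d n / (poch e n * poch f n))%C r ->
  (r * (/ CGamma e * / CGamma f) = / CGamma c * / CGamma d)%C.
Proof.
  intros He Hf E L.
  set (q := fun n => (poch c n * poch d n / (poch e n * poch f n))%C) in L.
  (* Euler's limit has [poch z (S n)] against [fact n], hence the shift by one. *)
  assert (LS : Clim eventually (fun n => q (S n)) r).
  { destruct L as [A B]; split.
    - apply (is_lim_seq_incr_1 (fun n => Re (q n)) (Re r)), A.
    - apply (is_lim_seq_incr_1 (fun n => Im (q n)) (Im r)), B. }
  apply (Clim_unique eventually (fun n => inv_Gamma_seq c n * inv_Gamma_seq d n)%C).
  - apply (Clim_ext_loc (fun n => q (S n) * (inv_Gamma_seq e n * inv_Gamma_seq f n))%C).
    + apply filter_forall. intros n. unfold q, inv_Gamma_seq.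
      pose proof (poch_neq_0 e (S n) He). pose proof (poch_neq_0 f (S n) Hf).
      assert (Er : (Rcpow (INR n) c * Rcpow (INR n) d = Rcpow (INR n) e * Rcpow (INR n) f)%C).
      { rewrite <- !Rcpow_plus, E. reflexivity. }
      transitivity (poch c (S n) * poch d (S n) / (INR (fact n) * INR (fact n) * (Rcpow (INR n) e * Rcpow (INR n) f)))%C;
        [|rewrite <- Er]; field; auto 10 using fact_C_neq_0, Rcpow_neq_0.
    + apply Clim_mult; [exact LS|]. apply Clim_mult; apply inv_CGamma_Clim.
  - apply Clim_mult; apply inv_CGamma_Clim.
Qed.

Lemma connection_Gamma (a b s A B : C) :
  nonpole (a + b + s) -> nonint s -> -1 < Re s -> connection a b s A B ->
  (A * (/ CGamma (a + b + s) * / CGamma s) = / CGamma (a + s) * / CGamma (b + s))%C.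
Proof.
  intros Hc Hs Rs H. apply poch_ratio_Gamma; [exact Hc | apply nonint_nonpole, Hs | ring |].
  apply (connection_gauss_poch a b s A B); assumption.
Qed.

(** * The reflection formula *)

Lemma is_Cderive_Cexp_lin (k : C) (t : R) :
  is_Cderive (fun t => Cexp (k * t)%C) t (k * Cexp (k * t))%C.
Proof.
  eapply is_Cderive_eq; [apply is_Cderive_Cexp, is_Cderive_scal, is_Cderive_id|]. cbv beta; ring.
Qed.

Lemma sin2_lt_1 (t : R) : 0 <= t < PI / 2 -> Rabs (sin t ^ 2) < 1.
Proof.
  intros Ht. pose proof (sin2_cos2 t) as E. unfold Rsqr in E.
  assert (0 < cos t) by (apply cos_gt_0; lra).
  apply Rabs_def1; nra.
Qed.

(** For parameters [a], [-a], [1/2] the substitution [x = sin^2 t] turns the hypergeometric equation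
    into [y'' = - 4 a^2 y], here with [y(0) = 1] and [y'(0) = 0]. *)
Lemma hyp2F1_sin2 (a : C) (t : R) : a <> RtoC 0 -> 0 <= t < PI / 2 ->
  hyp2F1 a (- a) (RtoC (/ 2)) (sin t ^ 2)
  = ((Cexp (Ci * (2 * a) * t) + Cexp (- (Ci * (2 * a)) * t)) / 2)%C.
Proof.
  intros Ha Ht. set (c := RtoC (/ 2)).
  assert (Hc : nonpole c) by (apply nonpole_Re_pos; simpl; lra).
  set (k := (Ci * (2 * a))%C).
  set (F := hyp2F1 a (- a) c). set (F1 := dhyp2F1 a (- a) c).
  (* The factors 0 and 1 are the multiplier's derivative and the multiplier, as [is_Cderive_twist]
     displays them. *)
  set (y1 := fun t => (RtoC 0 * F (sin t ^ 2)%R + RtoC 1 * (RtoC (2 * sin t * cos t) * F1 (sin t ^ 2)%R))%C).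
  set (y := fun t => (RtoC 1 * F (sin t ^ 2)%R)%C).
  assert (D : forall t, 0 <= t < PI / 2 ->
    is_Cderive y t (y1 t) /\ is_Cderive y1 t (k * k * y t)%C).
  { intros x Hx. destruct (hyp2F1_sol a (- a) c (sin x ^ 2) Hc (sin2_lt_1 x Hx)) as (D0 & l & D1 & E).
    destruct (is_Cderive_twist (fun _ => RtoC 1) (fun _ => RtoC 0) F F1 (fun t => sin t ^ 2)
      (fun t => 2 * sin t * cos t) x (2 * cos x ^ 2 - 2 * sin x ^ 2) (RtoC 0) l) as [G G1]; try assumption.
    - apply is_Cderive_const.
    - apply is_Cderive_const.
    - auto_derive; [trivial | ring].
    - auto_derive; [trivial | ring].
    - split; [exact G|]. eapply is_Cderive_eq; [exact G1|].
      assert (EX : cos x ^ 2 = 1 - sin x ^ 2).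
      { pose proof (sin2_cos2 x) as Q. unfold Rsqr in Q. lra. }
      assert (E1 : (RtoC (2 * sin x * cos x) * RtoC (2 * sin x * cos x))%C
         = (4 * RtoC (sin x ^ 2) * (1 - RtoC (sin x ^ 2)))%C).
      { rewrite <- RtoC_minus, <- EX, <- !RtoC_mult. f_equal. ring. }
      unfold y. fold F F1 in E. cbv beta.
      replace (Cmult (RtoC (2 * sin x * cos x)) (RtoC (2 * sin x * cos x)))
         with (4 * RtoC (sin x ^ 2) * (1 - RtoC (sin x ^ 2)))%C.
      rewrite EX.
      replace (RtoC (2 * (1 - sin x ^ 2) - 2 * sin x ^ 2)) with (4 * (c - (a + - a + 1) * RtoC (sin x ^ 2)))%C
        by (unfold c; replace (2 * (1 - sin x ^ 2) - 2 * sin x ^ 2) with (4 * (/ 2 - sin x ^ 2)) by field;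
            rewrite RtoC_mult, RtoC_minus; ring).
      assert (Ek : (k * k)%C = (- (4) * (a * a))%C).
      { unfold k. transitivity (Ci * Ci * (4 * (a * a)))%C; [ring|].
        replace (Ci * Ci)%C with (- RtoC 1)%C by (apply C_ext; simpl; ring). ring. }
      rewrite Ek. set (X := RtoC (sin x ^ 2)) in *.
      transitivity (4 * (X * (1 - X) * l + (c - (a + - a + 1) * X) * F1 (sin x ^ 2)%R
         - a * - a * F (sin x ^ 2)%R) + - (4) * (a * a) * F (sin x ^ 2)%R)%C; [ring | rewrite E; ring]. }
  (* First integrals: for [q = k] and [q = - k] the expression [(y' + q y) exp (- q t)] is constant,
     with value [q] at 0. Subtracting the two relations eliminates [y']. *)
  assert (W : forall q, (q * q = k * k)%C -> ((y1 t + q * y t) * Cexp (- q * t) = q)%C).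
  { intros q Hq.
    transitivity ((y1 0%R + q * y 0%R) * Cexp (- q * 0%R))%C.
    - apply (is_Cderive_0_const (fun t => (y1 t + q * y t) * Cexp (- q * t))%C (fun t => 0 <= t < PI / 2)).
      + intros x1 x2 x3; lra.
      + intros x Hx. destruct (D x Hx) as [D0 D1]. eapply is_Cderive_eq.
        * apply is_Cderive_mult; [apply is_Cderive_plus; [exact D1 | apply is_Cderive_scal, D0] | apply is_Cderive_Cexp_lin].
        * rewrite <- Hq. ring.
      + exact Ht.
      + pose proof PI_RGT_0. lra.
    - unfold y1, y. rewrite sin_0. replace (0 ^ 2) with 0 by ring.
      replace (- q * 0%R)%C with (RtoC 0) by ring. rewrite Cexp_0.
      unfold F. rewrite hyp2F1_0, Rmult_0_r, Rmult_0_l. ring. }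
  pose proof (W k eq_refl) as E1. pose proof (W (- k)%C ltac:(ring)) as E2.
  assert (Ek : k <> RtoC 0).
  { unfold k. apply Cmult_neq_0; [|apply Cmult_neq_0; [apply RtoC_neq_0; lra | exact Ha]].
    intros E. apply (f_equal Im) in E. simpl in E. lra. }
  assert (X1 : (Cexp (- k * t) * Cexp (k * t) = 1)%C).
  { rewrite <- Cexp_plus, <- Cexp_0. f_equal. ring. }
  replace (- - k * t)%C with (k * t)%C in E2 by ring.
  assert (P1 : (y1 t + k * y t = k * Cexp (k * t))%C).
  { rewrite <- E1 at 2. transitivity ((y1 t + k * y t) * (Cexp (- k * t) * Cexp (k * t)))%C; [rewrite X1; ring | ring]. }
  assert (P2 : (y1 t + - k * y t = - k * Cexp (- k * t))%C).
  { rewrite <- E2 at 2. transitivity ((y1 t + - k * y t) * (Cexp (- k * t) * Cexp (k * t)))%C; [rewrite X1; ring | ring]. }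
  transitivity (((y1 t + k * y t) - (y1 t + - k * y t)) / (2 * k))%C.
  - unfold y, F. field. exact Ek.
  - rewrite P1, P2. field. exact Ek.
Qed.

Lemma filterlim_cos2_at_left : filterlim (fun t => cos t ^ 2) (at_left (PI / 2)) (at_right 0).
Proof.
  intros P HP. unfold at_right, within in HP. unfold filtermap, at_left, within.
  assert (L : locally (PI / 2) (fun t => (0 < cos t ^ 2 -> P (cos t ^ 2)))).
  { assert (D : is_derive (fun t => cos t ^ 2) (PI / 2) (2 * cos (PI / 2) * - sin (PI / 2))).
    { auto_derive; [trivial | ring]. }
    apply (locally_comp_is_derive (fun u => 0 < u -> P u) (fun t => cos t ^ 2) (PI / 2) _ D).
    rewrite cos_PI2. replace (0 ^ 2) with 0 by ring. exact HP. }
  pose proof PI_RGT_0 as PP.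
  eapply filter_imp; [|exact (filter_and _ _ L (locally_gt 0 (PI / 2) ltac:(lra)))].
  intros t [H1 H2] H3. apply H1. assert (0 < cos t) by (apply cos_gt_0; lra). nra.
Qed.

Lemma nonint_half : nonint (RtoC (/ 2)).
Proof.
  intros n E. apply RtoC_inj in E.
  assert (E2 : IZR (2 * n) = IZR 1) by (rewrite mult_IZR; lra).
  apply eq_IZR in E2. lia.
Qed.

(** With [a = z - 1/2] the first connection coefficient of [a], [-a], [s = 1/2] is
    [cos (a PI) = sin (z PI)]. The constant [Gamma(1/2)^2] stays unevaluated, as it cancels when two
    instances are compared. *)
Lemma inv_CGamma_reflection (z : C) :
  (/ CGamma z * / CGamma (1 - z) = Csin (z * PI) * (/ CGamma (RtoC (/ 2)) * / CGamma (RtoC (/ 2))))%C.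
Proof.
  set (h := RtoC (/ 2)). set (a := (z - h)%C).
  assert (Eh : (h + h)%C = RtoC 1) by (unfold h; rewrite <- RtoC_plus; f_equal; field).
  assert (Esin : Csin (z * PI) = ((Cexp (Ci * (2 * a) * (PI / 2)%R) + Cexp (- (Ci * (2 * a)) * (PI / 2)%R)) / 2)%C).
  { assert (Ea : (2 * a)%C = (2 * z - 1)%C) by (unfold a; rewrite <- Eh; ring).
    assert (Ep : RtoC PI = (2 * (PI / 2)%R)%C) by (rewrite <- RtoC_mult; f_equal; field).
    replace (Ci * (2 * a) * (PI / 2)%R)%C with (Ci * (z * PI) + Ci * - (PI / 2)%R)%C by (rewrite Ea, Ep; ring).
    replace (- (Ci * (2 * a)) * (PI / 2)%R)%C with (- (Ci * (z * PI)) + Ci * (PI / 2)%R)%C by (rewrite Ea, Ep; ring).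
    rewrite !Cexp_plus.
    assert (E1 : Cexp (Ci * (PI / 2)%R) = Ci).
    { apply C_ext; unfold Cexp; simpl;
      replace (0 * (PI / 2) - 1 * 0) with 0 by ring; replace (0 * 0 + 1 * (PI / 2)) with (PI / 2) by ring;
      rewrite exp_0, ?cos_PI2, ?sin_PI2; ring. }
    assert (E2 : Cexp (Ci * - (PI / 2)%R) = (- Ci)%C).
    { rewrite <- RtoC_opp. apply C_ext; unfold Cexp; simpl;
      replace (0 * - (PI / 2) - 1 * 0) with 0 by ring; replace (0 * 0 + 1 * - (PI / 2)) with (- (PI / 2)) by ring;
      rewrite exp_0, ?cos_neg, ?sin_neg, ?cos_PI2, ?sin_PI2; ring. }
    rewrite E1, E2. unfold Csin.
    assert (N : Ci <> RtoC 0) by (intros E; apply (f_equal Im) in E; simpl in E; lra).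
    assert (C2 : (Ci * Ci)%C = (- RtoC 1)%C) by (apply C_ext; simpl; ring).
    set (e1 := Cexp (Ci * (z * PI))). set (e2 := Cexp (- (Ci * (z * PI)))).
    transitivity (- (Ci * Ci) * (e1 - e2) / (2 * Ci))%C.
    - rewrite C2. field. exact N.
    - field. exact N. }
  destruct (classic (a = RtoC 0)) as [Ea|Ea].
  - rewrite Esin, Ea.
    replace (Ci * (2 * 0) * (PI / 2)%R)%C with (RtoC 0) by ring.
    replace (- (Ci * (2 * 0)) * (PI / 2)%R)%C with (RtoC 0) by ring. rewrite Cexp_0.
    assert (Ez : z = h) by (transitivity (a + h)%C; [unfold a; ring | rewrite Ea; ring]).
    replace (1 - z)%C with h by (rewrite Ez, <- Eh; ring). rewrite Ez.
    replace ((1 + 1) / 2)%C with (RtoC 1) by field. ring.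
  - assert (Hs : nonint h) by apply nonint_half.
    assert (Hc : nonpole (a + - a + h)).
    { replace (a + - a + h)%C with h by ring. apply nonint_nonpole, Hs. }
    destruct (connection_exists a (- a) h Hc Hs) as (A & B & H).
    assert (EA : A = Csin (z * PI)).
    { assert (R1 : 0 < Re h) by (simpl; lra).
      apply (Clim_unique (at_left (PI / 2)) (fun t => hyp2F1 a (- a) h (1 - cos t ^ 2))).
      - pose proof (connection_lim a (- a) h A B Hs R1 H) as L.
        replace (a + - a + h)%C with h in L by ring.
        exact (Clim_comp _ _ _ _ _ filterlim_cos2_at_left L).
      - rewrite Esin.
        apply (Clim_ext_loc (fun t : R => (Cexp (Ci * (2 * a) * t) + Cexp (- (Ci * (2 * a)) * t)) / 2)%C).
        + unfold at_left, within. pose proof PI_RGT_0.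
          eapply filter_imp; [|exact (locally_gt 0 (PI / 2) ltac:(lra))].
          intros t H1 H2. rewrite <- (hyp2F1_sin2 a t Ea ltac:(lra)). f_equal.
          pose proof (sin2_cos2 t) as Q. unfold Rsqr in Q. lra.
        + apply (Clim_filter_le (locally (PI / 2))).
          * intros P HP. unfold at_left, within. eapply filter_imp; [|exact HP]. auto.
          * apply Clim_mult; [|apply Clim_const].
            apply Clim_plus; eapply (is_Cderive_Clim (fun t : R => Cexp (_ * t)%C)), is_Cderive_Cexp_lin. }
    pose proof (connection_Gamma a (- a) h A B Hc Hs ltac:(simpl; lra) H) as E.
    replace (a + - a + h)%C with h in E by ring.
    replace (a + h)%C with z in E by (unfold a; ring).
    replace (- a + h)%C with (1 - z)%C in E by (unfold a; rewrite <- Eh; ring).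
    rewrite <- E, EA. reflexivity.
Qed.

(** * Euler's and Pfaff's transformations *)

Lemma at_right_0_ex (P : R -> Prop) : at_right 0 P -> exists d, 0 < d /\ forall x, 0 < x < d -> P x.
Proof.
  intros [d Hd]. exists d. split; [apply cond_pos|]. intros x Hx. apply Hd; [|lra].
  change (Rabs (x - 0) < d). apply Rabs_def1; lra.
Qed.

(** With [Re c > 0] and bounded derivatives the factor [x^c] forces the constant of Abel's identity
    to be 0, so the Wronskian vanishes. The quotient of the solutions is then constant where [g] has
    no zero, hence the restriction to a smaller interval, and it tends to 1. *)
Lemma hyp_sol_unique_at_0 (a b c : C) (f f1 g g1 : R -> C) (d : R) (m n : C) :
  0 < Re c -> 0 < d <= 1 ->
  (forall x, 0 < x < d -> hyp_sol a b c f f1 x /\ hyp_sol a b c g g1 x) ->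
  Clim (at_right 0) f (RtoC 1) -> Clim (at_right 0) g (RtoC 1) ->
  Clim (at_right 0) f1 m -> Clim (at_right 0) g1 n ->
  exists e, 0 < e /\ forall x, 0 < x < e -> f x = g x.
Proof.
  intros Hc Hd H Lf Lg Lf1 Lg1.
  assert (W : forall x, 0 < x < d -> (f x * g1 x - f1 x * g x = 0)%C).
  { intros x Hx.
    set (K := fun x : R => (Rcpow x c * Rcpow (1 - x) (a + b - c + 1) * (f x * g1 x - f1 x * g x))%C).
    assert (K0 : K x = RtoC 0).
    { apply (Clim_unique (at_right 0) K).
      - apply (Clim_ext_loc (fun _ => K x)); [|apply Clim_const].
        assert (Pd : 0 < d) by lra. exists (mkposreal d Pd). intros y By Hy.
        change (Rabs (y - 0) < d) in By. apply Rabs_def2 in By.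
        apply (hyp_wronskian_const a b c _ _ _ _ (fun x => 0 < x < d)); try lra.
        + apply convex_interval.
        + intros z Hz. split; [lra | apply H, Hz].
      - eapply Clim_eq.
        + apply Clim_mult; [apply Clim_mult; [apply Clim_Rcpow_0, Hc | apply Clim_Rcpow_1_minus]|].
          apply Clim_minus; apply Clim_mult; eassumption.
        + ring. }
    unfold K in K0.
    pose proof (Rcpow_neq_0 x c). pose proof (Rcpow_neq_0 (1 - x) (a + b - c + 1)).
    transitivity (Rcpow x c * Rcpow (1 - x) (a + b - c + 1) * (f x * g1 x - f1 x * g x)
       / (Rcpow x c * Rcpow (1 - x) (a + b - c + 1)))%C; [field; auto|].
    rewrite K0. field; auto. }
  destruct (at_right_0_ex _ (Clim_neq_0 _ _ Lg RtoC_1_neq_0)) as (e & He & Ge).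
  set (r := Rmin e d). assert (Hr : 0 < r) by (apply Rmin_glb_lt; lra).
  pose proof (Rmin_l e d : r <= e). pose proof (Rmin_r e d : r <= d).
  exists r. split; [exact Hr|]. intros x Hx.
  (* The derivative of [q] is minus the Wronskian divided by [g^2]. *)
  set (q := fun x => (f x * / g x)%C).
  assert (Q : q x = RtoC 1).
  { apply (Clim_unique (at_right 0) q).
    - apply (Clim_ext_loc (fun _ => q x)); [|apply Clim_const].
      exists (mkposreal r Hr). intros y By Hy.
      change (Rabs (y - 0) < r) in By. apply Rabs_def2 in By.
      apply (is_Cderive_0_const q (fun x => 0 < x < r)); try lra.
      + apply convex_interval.
      + intros z Hz. destruct (H z ltac:(lra)) as [(Df & _) (Dg & _)].
        assert (Gz : g z <> RtoC 0) by (apply Ge; lra).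
        eapply is_Cderive_eq; [apply is_Cderive_mult; [exact Df | apply is_Cderive_inv; [exact Dg | exact Gz]]|].
        transitivity (- (f z * g1 z - f1 z * g z) / (g z * g z))%C; [field; exact Gz|].
        rewrite W by lra. field. exact Gz.
    - eapply Clim_eq; [apply Clim_mult; [exact Lf | apply Clim_inv; [exact Lg | apply RtoC_1_neq_0]]|].
      field. }
  transitivity (q x * g x)%C.
  - unfold q. field. apply Ge; lra.
  - rewrite Q. ring.
Qed.

(** Two regular solutions with value 1 at 0. A small interval suffices, as the identity only serves
    to compare two connection formulas at one point. *)
Lemma hyp2F1_euler_at_0 (a b s : C) : 0 < Re (a + b + s)%C ->
  exists e, 0 < e /\ forall x, 0 < x < e ->
  hyp2F1 a b (a + b + s) x = (Rcpow (1 - x) s * hyp2F1 (a + s) (b + s) (a + b + s) x)%C.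
Proof.
  intros Hc. pose proof (nonpole_Re_pos _ Hc) as Np. set (c := (a + b + s)%C) in *.
  assert (Es : (c - a - b)%C = s) by (unfold c; ring).
  assert (Ea : (c - a)%C = (b + s)%C) by (unfold c; ring).
  assert (Eb : (c - b)%C = (a + s)%C) by (unfold c; ring).
  destruct (hyp_sol_unique_at_0 a b c (hyp2F1 a b c) (dhyp2F1 a b c)
    (fun t => Rcpow (1 - t) (c - a - b) * hyp2F1 (c - a) (c - b) c t)%C
    (fun t => - (c - a - b) * Rcpow (1 - t) (c - a - b - 1) * hyp2F1 (c - a) (c - b) c t
       + Rcpow (1 - t) (c - a - b) * (1 * dhyp2F1 (c - a) (c - b) c t))%C
    1 (dhyp2F1 a b c 0) (- (c - a - b) * 1 * 1 + 1 * (1 * dhyp2F1 (c - a) (c - b) c 0))%C Hc)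
    as (e & He & E).
  - lra.
  - intros x Hx. split; [apply hyp2F1_sol; [exact Np | apply Rabs_lt_1_of_01, Hx]|].
    apply hyp_sol_euler; [lra|]. apply hyp2F1_sol; [exact Np | apply Rabs_lt_1_of_01, Hx].
  - apply Clim_hyp2F1_0, Np.
  - eapply Clim_eq; [apply Clim_mult; [apply Clim_Rcpow_1_minus | apply Clim_hyp2F1_0, Np] | ring].
  - apply Clim_dhyp2F1_0, Np.
  - apply Clim_plus; apply Clim_mult.
    + apply Clim_mult; [apply Clim_const | apply Clim_Rcpow_1_minus].
    + apply Clim_hyp2F1_0, Np.
    + apply Clim_Rcpow_1_minus.
    + apply Clim_mult; [apply Clim_const | apply Clim_dhyp2F1_0, Np].
  - exists e. split; [exact He|]. intros x Hx. rewrite E by exact Hx.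
    rewrite Es, Ea, Eb, (hyp2F1_sym (b + s)). reflexivity.
Qed.

Lemma filterlim_pfaff_arg : filterlim (fun x => - x / (1 - x)) (at_right 0) (locally 0).
Proof.
  intros P HP. unfold filtermap, at_right, within.
  assert (D : is_derive (fun x => - x / (1 - x)) 0 (-1)).
  { auto_derive; [lra | field]. }
  eapply filter_imp; [|apply (locally_comp_is_derive P (fun x => - x / (1 - x)) 0 _ D)].
  - intros x H _; exact H.
  - replace (- 0 / (1 - 0)) with 0 by field. exact HP.
Qed.

Lemma Clim_at_0_continuous (f : R -> C) (g : R -> R) (l : C) :
  filterlim g (at_right 0) (locally 0) -> is_Cderive f 0 l -> Clim (at_right 0) (fun x => f (g x)) (f 0).
Proof. intros Hg Hf. apply (Clim_comp _ _ g f _ Hg), (is_Cderive_Clim _ _ _ Hf). Qed.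

Lemma Rabs_pfaff_arg_lt_1 (x : R) : 0 < x < / 2 -> Rabs (- x / (1 - x)) < 1.
Proof.
  intros Hx. assert (E : x / (1 - x) < 1).
  { apply Rmult_lt_reg_r with (1 - x); [lra|]. unfold Rdiv. rewrite Rmult_assoc, Rinv_l; lra. }
  assert (0 < x / (1 - x)) by (apply Rdiv_lt_0_compat; lra).
  replace (- x / (1 - x)) with (- (x / (1 - x))) by (field; lra).
  apply Rabs_def1; lra.
Qed.

(** Again by uniqueness of the regular solution, on [x < 1/2] where the argument [- x / (1 - x)]
    stays in the unit disc. *)
Lemma hyp2F1_pfaff_at_0 (a b c : C) : 0 < Re c ->
  exists e, 0 < e /\ forall x, 0 < x < e ->
  hyp2F1 (c - a) b c x = (Rcpow (1 - x) (- b) * hyp2F1 a b c (- x / (1 - x)))%C.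
Proof.
  intros Hc. pose proof (nonpole_Re_pos _ Hc) as Np.
  assert (R0 : Rabs 0 < 1) by (rewrite Rabs_R0; lra).
  apply (hyp_sol_unique_at_0 (c - a) b c (hyp2F1 (c - a) b c) (dhyp2F1 (c - a) b c)
    (fun t => Rcpow (1 - t) (- b) * hyp2F1 a b c (- t / (1 - t))%R)%C
    (fun t => - - b * Rcpow (1 - t) (- b - 1) * hyp2F1 a b c (- t / (1 - t))%R
       + Rcpow (1 - t) (- b) * (RtoC (- / (1 - t) ^ 2) * dhyp2F1 a b c (- t / (1 - t))%R))%C
    (/ 2) (dhyp2F1 (c - a) b c 0)
    (- - b * 1 * hyp2F1 a b c 0%R + 1 * (RtoC (- / (1 - 0) ^ 2) * dhyp2F1 a b c 0%R))%C Hc).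
  - lra.
  - intros x Hx. split; [apply hyp2F1_sol; [exact Np | apply Rabs_lt_1_of_01; lra]|].
    apply hyp_sol_pfaff; [lra|]. apply hyp2F1_sol; [exact Np | apply Rabs_pfaff_arg_lt_1, Hx].
  - apply Clim_hyp2F1_0, Np.
  - eapply Clim_eq; [apply Clim_mult; [apply Clim_Rcpow_1_minus|]|].
    + apply (Clim_at_0_continuous _ _ _ filterlim_pfaff_arg (is_Cderive_hyp2F1 a b c 0 Np R0)).
    + rewrite hyp2F1_0. ring.
  - apply Clim_dhyp2F1_0, Np.
  - apply Clim_plus; apply Clim_mult.
    + apply Clim_mult; [apply Clim_const | apply Clim_Rcpow_1_minus].
    + apply (Clim_at_0_continuous _ _ _ filterlim_pfaff_arg (is_Cderive_hyp2F1 a b c 0 Np R0)).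
    + apply Clim_Rcpow_1_minus.
    + apply Clim_mult.
      * eapply (Clim_at_right (fun t => RtoC (- / (1 - t) ^ 2))). apply is_Cderive_RtoC.
        auto_derive; [lra | reflexivity].
      * apply (Clim_at_0_continuous _ _ _ filterlim_pfaff_arg (is_Cderive_dhyp2F1 a b c 0 Np R0)).
Qed.

(** Near [z = 1] Euler's transformation writes F as [z^s] times the function with parameters
    [a + s], [b + s], [- s]. Expanding the latter exchanges the two basis solutions, so [B] and [A']
    multiply the same one. *)
Lemma connection_euler (a b s A B A' B' : C) :
  0 < Re (a + b + s)%C -> nonint s ->
  connection a b s A B -> connection (a + s) (b + s) (- s) A' B' -> B = A'.
Proof.
  intros Hc Hs H H'. pose proof (nonpole_Re_pos _ Hc) as Np.
  destruct (hyp2F1_euler_at_0 a b s Hc) as (e & He & E).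
  set (r := Rmin e 1). assert (Hr : 0 < r) by (apply Rmin_glb_lt; lra).
  pose proof (Rmin_l e 1 : r <= e). pose proof (Rmin_r e 1 : r <= 1).
  assert (Z : forall z, 1 - r < z < 1 ->
    ((A - B') * hyp2F1 a b (1 - s) z + (B - A') * pow_sol a b s z = 0)%C).
  { intros z Hz. pose proof (E (1 - z) ltac:(lra)) as E1.
    rewrite (H z ltac:(lra)) in E1. replace (1 - (1 - z)) with z in E1 by ring.
    pose proof (H' z ltac:(lra)) as E2.
    replace (a + s + (b + s) + - s)%C with (a + b + s)%C in E2 by ring.
    replace (1 - - s)%C with (1 + s)%C in E2 by ring.
    replace (a + s + - s)%C with a in E2 by ring. replace (b + s + - s)%C with b in E2 by ring.
    replace (1 + - s)%C with (1 - s)%C in E2 by ring.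
    rewrite E2 in E1. unfold pow_sol.
    transitivity ((A * hyp2F1 a b (1 - s) z + B * (Rcpow z s * hyp2F1 (a + s) (b + s) (1 + s) z))
      - (B' * hyp2F1 a b (1 - s) z + A' * (Rcpow z s * hyp2F1 (a + s) (b + s) (1 + s) z)))%C; [ring|].
    rewrite E1. rewrite Rcpow_opp. field. apply Rcpow_neq_0. }
  set (z := 1 - r / 2). assert (Hz : 1 - r < z < 1) by (unfold z; lra).
  assert (Hz1 : 0 < z < 1) by lra.
  destruct (reg_sol_sol a b s z Hs Hz1) as [D1 _].
  destruct (pow_sol_sol a b s z Hs Hz1) as [D2 _].
  assert (Z1 : ((A - B') * dhyp2F1 a b (1 - s) z + (B - A') * dpow_sol a b s z = 0)%C).
  { pose proof (is_Cderive_plus _ _ _ _ _ (is_Cderive_scal (A - B')%C _ _ _ D1)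
      (is_Cderive_scal (B - A')%C _ _ _ D2)) as D.
    rewrite <- (is_Cderive_unique _ _ _ D). apply is_Cderive_unique.
    eapply is_Cderive_ext_loc; [|apply is_Cderive_const].
    pose proof (locally_gt (1 - r) z (proj1 Hz)) as L1. pose proof (locally_lt 1 z (proj2 Hz)) as L2.
    eapply filter_imp; [|exact (filter_and _ _ L1 L2)].
    intros t [? ?]. symmetry. apply Z. lra. }
  pose proof (wronskian_reg_pow a b s z Hs Hz1) as W.
  pose proof (Z z Hz) as Z0.
  set (M := (Rcpow z (1 - s) * Rcpow (1 - z) (a + b - (1 - s) + 1))%C) in W.
  pose proof (Hs 0%Z) as S0.
  (* The linear relation and its derivative at one point; their determinant is the nonvanishing
     Wronskian [s]. *)
  assert (P : ((B - A') * s = 0)%C).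
  { rewrite <- W.
    transitivity (M * (hyp2F1 a b (1 - s) z * ((A - B') * dhyp2F1 a b (1 - s) z + (B - A') * dpow_sol a b s z)
      - dhyp2F1 a b (1 - s) z * ((A - B') * hyp2F1 a b (1 - s) z + (B - A') * pow_sol a b s z)))%C; [ring|].
    rewrite Z0, Z1. ring. }
  transitivity (A' + (B - A') * s / s)%C; [field; exact S0 | rewrite P; field; exact S0].
Qed.

(** [B] is the first coefficient of the problem with [a + s], [b + s], [- s]; the Gamma evaluation
    needs real part above -1 for both [s] and [- s]. Only Gamma values at non-poles are divided
    out. *)
Theorem connection_formula (a b s : C) :
  0 < Re (a + b + s)%C -> nonint s -> -1 < Re s < 1 ->
  connection a b s
    (CGamma (a + b + s) * CGamma s * (/ CGamma (a + s) * / CGamma (b + s)))%C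
    (CGamma (a + b + s) * CGamma (- s) * (/ CGamma a * / CGamma b))%C.
Proof.
  intros Hc Hs Rs. pose proof (nonpole_Re_pos _ Hc) as Np.
  destruct (connection_exists a b s Np Hs) as (A & B & H).
  assert (Ec : (a + s + (b + s) + - s)%C = (a + b + s)%C) by ring.
  assert (Np' : nonpole (a + s + (b + s) + - s)%C) by (rewrite Ec; exact Np).
  destruct (connection_exists (a + s) (b + s) (- s) Np' (nonint_opp s Hs)) as (A' & B' & H').
  pose proof (connection_euler a b s A B A' B' Hc Hs H H') as EB.
  pose proof (connection_Gamma a b s A B Np Hs ltac:(lra) H) as G.
  pose proof (connection_Gamma (a + s) (b + s) (- s) A' B' Np' (nonint_opp s Hs) ltac:(simpl; unfold Re in *; lra) H') as G'.
  rewrite Ec in G'.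
  replace (a + s + - s)%C with a in G' by ring. replace (b + s + - s)%C with b in G' by ring.
  destruct (CGamma_correct _ Np) as [_ N1].
  destruct (CGamma_correct _ (nonint_nonpole s Hs)) as [_ N2].
  destruct (CGamma_correct _ (nonint_nonpole _ (nonint_opp s Hs))) as [_ N3].
  rewrite <- G, <- G'.
  replace (CGamma (a + b + s) * CGamma s * (A * (/ CGamma (a + b + s) * / CGamma s)))%C with A by (field; auto).
  replace (CGamma (a + b + s) * CGamma (- s) * (A' * (/ CGamma (a + b + s) * / CGamma (- s))))%C with A' by (field; auto).
  rewrite <- EB. exact H.
Qed.

(** * Membership of the functions [Phi] in the space [E] *)

Lemma Cexp_opp_int_PI (m : Z) : Cexp (- (Ci * (IZR m * PI)))%C = Cexp (Ci * (IZR m * PI))%C.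
Proof.
  assert (S0 : sin (IZR m * PI) = 0) by (apply sin_eq_0_1; exists m; reflexivity).
  replace (- (Ci * (IZR m * PI)))%C with ((0, - (IZR m * PI)) : C) by (apply C_ext; simpl; ring).
  replace (Ci * (IZR m * PI))%C with ((0, IZR m * PI) : C) by (apply C_ext; simpl; ring).
  unfold Cexp; simpl. rewrite cos_neg, sin_neg, S0. f_equal; ring.
Qed.

Lemma Csin_plus_int_PI (z : C) (m : Z) :
  Csin ((z + IZR m) * PI)%C = (Cexp (Ci * (IZR m * PI)) * Csin (z * PI))%C.
Proof.
  unfold Csin.
  replace (Ci * ((z + IZR m) * PI))%C with (Ci * (z * PI) + Ci * (IZR m * PI))%C by ring.
  replace (- (Ci * (z * PI) + Ci * (IZR m * PI)))%C with (- (Ci * (z * PI)) + - (Ci * (IZR m * PI)))%C by ring.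
  rewrite !Cexp_plus, Cexp_opp_int_PI. unfold Cdiv. ring.
Qed.

Lemma Csin_opp (z : C) : Csin (- z)%C = (- Csin z)%C.
Proof.
  unfold Csin. replace (- (Ci * - z))%C with (Ci * z)%C by ring.
  replace (Ci * - z)%C with (- (Ci * z))%C by ring. unfold Cdiv. ring.
Qed.

Lemma Csin_0 : Csin (RtoC 0) = RtoC 0.
Proof.
  unfold Csin. replace (- (Ci * 0))%C with (RtoC 0) by ring. replace (Ci * 0)%C with (RtoC 0) by ring.
  unfold Cdiv. ring.
Qed.

Lemma Zmin_ex (P : Z -> Prop) (l m0 : Z) :
  (forall m, P m -> (l <= m)%Z) -> P m0 -> exists k, P k /\ forall m, P m -> (k <= m)%Z.
Proof.
  intros HL. remember (Z.to_nat (m0 - l)) as n eqn:En. revert m0 En.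
  induction n as [n IH] using lt_wf_ind. intros m0 En H0.
  destruct (classic (exists m, P m /\ (m < m0)%Z)) as [(m & Hm & Lm)|N].
  - apply (IH (Z.to_nat (m - l))) with m; [|reflexivity|exact Hm].
    pose proof (HL m Hm). lia.
  - exists m0. split; [exact H0|]. intros m Hm.
    destruct (Z_lt_le_dec m m0) as [L|L]; [|exact L]. exfalso. apply N. eauto.
Qed.

(** Positivity of [Re (2p + alpha + beta + 1)] bounds the integers [p - theta] below, so a least
    index exists, and [p] exceeds it by a natural number. *)
Lemma min_index_ex (alpha beta theta p : C) (m : Z) :
  index_set alpha beta theta p -> (p - theta)%C = RtoC (IZR m) ->
  exists (r : C) (j : nat), min_index alpha beta theta r /\ p = (r + INR j)%C.
Proof.
  intros Hp Em.
  set (P := fun k : Z => index_set alpha beta theta (theta + IZR k)%C).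
  assert (Ep : p = (theta + IZR m)%C) by (rewrite <- Em; ring).
  (* Every admissible integer exceeds [y], and [up (y - 1) <= y] is an integer lower bound. *)
  set (y := - Re (2 * theta + alpha + beta + 1)%C / 2).
  destruct (archimed (y - 1)) as [_ Ar].
  destruct (Zmin_ex P (up (y - 1)) m) as (k & Hk & Mk).
  - intros q (_ & Hq & _).
    replace (2 * (theta + IZR q) + alpha + beta + 1)%C
      with ((2 * theta + alpha + beta + 1) + (2 * IZR q)%R)%C in Hq by (rewrite RtoC_mult; ring).
    rewrite re_plus, re_RtoC in Hq.
    apply le_IZR. unfold y in *. lra.
  - unfold P. rewrite <- Ep. exact Hp.
  - exists (theta + IZR k)%C, (Z.to_nat (m - k)). split.
    + split; [exact Hk|]. intros q Hq m' k' Em' Ek'.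
      assert (k' = k) as ->.
      { apply eq_IZR, RtoC_inj. rewrite <- Ek'. ring. }
      apply Mk. unfold P. replace (theta + IZR m')%C with q by (rewrite <- Em'; ring). exact Hq.
    + assert (L : (k <= m)%Z) by (apply Mk; unfold P; rewrite <- Ep; exact Hp).
      rewrite Ep, INR_IZR_INZ, Z2Nat.id, minus_IZR, RtoC_minus by lia. ring.
Qed.

Lemma Rcpow_INR (x : R) (n : nat) : 0 < x -> Rcpow x (INR n) = (RtoC x ^ n)%C.
Proof.
  intros Hx. induction n as [|n IH].
  - simpl INR. rewrite Rcpow_0. reflexivity.
  - rewrite RtoC_INR_S, Rcpow_plus, IH, Rcpow_1 by assumption. simpl. ring.
Qed.

Lemma Cdiffn_pow (k n : nat) (x : R) : Cdiffn k (fun t => RtoC t ^ n)%C x.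
Proof.
  induction n as [|n IH]; simpl; [apply Cdiffn_const | apply Cdiffn_mult; [apply Cdiffn_RtoC | exact IH]].
Qed.

Lemma Cdiffn_Rinv (k : nat) (x : R) : 0 < x -> Cdiffn k (fun t => RtoC (/ t)) x.
Proof.
  intros Hx. apply (Cdiffn_ext_loc k (fun t : R => / RtoC t)%C).
  - eapply filter_imp; [|apply (locally_gt 0 x Hx)]. intros t Ht. rewrite RtoC_inv by lra. reflexivity.
  - apply Cdiffn_inv; [apply Cdiffn_RtoC | apply RtoC_neq_0; lra].
Qed.

Lemma Cdiffn_1_minus (k : nat) (x : R) : Cdiffn k (fun t => RtoC (1 - t)) x.
Proof.
  apply (Cdiffn_ext_loc k (fun t : R => 1 + -1 * t)%C); [|apply Cdiffn_affine].
  apply filter_forall. intros t. rewrite RtoC_minus. ring.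
Qed.

Lemma locally_Rabs_1_minus_lt_1 : locally 1 (fun x => Rabs (1 - x) < 1).
Proof.
  pose proof (locally_gt 0 1 ltac:(lra)) as L1. pose proof (locally_lt 2 1 ltac:(lra)) as L2.
  eapply filter_imp; [|exact (filter_and _ _ L1 L2)]. intros x [? ?]. apply Rabs_def1; lra.
Qed.

Lemma Csmooth_near_hyp2F1_1_minus (k a b c : C) : nonpole c ->
  Csmooth_near (fun x => k * hyp2F1 a b c (1 - x)%R)%C 1.
Proof.
  intros Hc. unfold Csmooth_near. eapply filter_imp; [|apply locally_Rabs_1_minus_lt_1].
  intros x Hx. apply smooth_at_Csmooth. intros n.
  apply Cdiffn_mult; [apply Cdiffn_const|].
  apply (Cdiffn_comp n (hyp2F1 a b c) (fun t => 1 - t)); [apply Cdiffn_hyp2F1; assumption | apply Cdiffn_1_minus].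
Qed.

Section Phi_in_E.
Variables alpha beta theta p : C.
Hypothesis halpha : -1 < Re alpha < 1.
Hypothesis halpha0 : alpha <> RtoC 0.
Hypothesis hbeta : -1 < Re beta.
Hypothesis hE : Csin ((alpha + theta) * PI)%C <> RtoC 0.
Hypothesis hp : index_set alpha beta theta p.

Let rho := (Csin (theta * PI) / Csin ((alpha + theta) * PI))%C.

Let c' := (2 * p + alpha + beta + 2)%C.

Lemma alpha_nonint : nonint alpha.
Proof.
  intros n E. destruct (Z.eq_dec n 0) as [->|N]; [contradiction|].
  rewrite E, re_RtoC in halpha. destruct halpha as [A B].
  apply (lt_IZR (-1)) in A. apply (lt_IZR n 1) in B. lia.
Qed.

Lemma c'_Re_pos : 1 < Re c'.
Proof.
  destruct hp as (_ & H & _). unfold c'.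
  replace (2 * p + alpha + beta + 2)%C with ((2 * p + alpha + beta + 1) + 1)%C by ring.
  rewrite re_plus, re_RtoC. lra.
Qed.

Lemma beta1_Re_pos : 0 < Re (beta + 1)%C.
Proof. rewrite re_plus, re_RtoC. lra. Qed.

(** As [p - theta] is an integer, a pole [1 + p + alpha = - n] would make [alpha + theta] an integer
    and the sine in [hE] zero. *)
Lemma p_alpha_nonpole : nonpole (1 + p + alpha)%C.
Proof.
  intros n E. destruct hp as ((m & Em) & _ & _). apply hE.
  assert (Ea : (alpha + theta)%C = (0 + IZR (- (Z.of_nat n + 1 + m)))%C).
  { rewrite opp_IZR, !plus_IZR, <- INR_IZR_INZ, RtoC_opp, !RtoC_plus, <- Em.
    transitivity ((1 + p + alpha + INR n) - INR n - 1 - p + theta)%C; [ring | rewrite E; ring]. }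
  rewrite Ea, Csin_plus_int_PI. replace (0 * PI)%C with (RtoC 0) by ring. rewrite Csin_0. ring.
Qed.

(** The quotient of the reflection formula at [- p] and at [- p - alpha]. Replacing [p] by [theta]
    in both sines costs the same sign, which cancels together with [Gamma(1/2)^2]. *)
Lemma CGamma_ratio_reflection :
  (CGamma (1 + p + alpha) * (/ CGamma (- p) * / CGamma (p + 1)) = rho * / CGamma (- p - alpha))%C.
Proof.
  destruct (CGamma_correct _ p_alpha_nonpole) as [_ N].
  pose proof (inv_CGamma_reflection (- p)%C) as E1.
  pose proof (inv_CGamma_reflection (- p - alpha)%C) as E2.
  replace (1 - - p)%C with (p + 1)%C in E1 by ring.
  replace (1 - (- p - alpha))%C with (1 + p + alpha)%C in E2 by ring.
  set (kappa := (/ CGamma (RtoC (/ 2)) * / CGamma (RtoC (/ 2)))%C) in *.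
  destruct hp as ((m & Em) & _ & _).
  assert (S1 : Csin (- p * PI)%C = (- (Cexp (Ci * (IZR m * PI)) * Csin (theta * PI)))%C).
  { rewrite <- Csin_plus_int_PI, <- Em, <- Csin_opp. f_equal. ring. }
  assert (S2 : Csin ((- p - alpha) * PI)%C = (- (Cexp (Ci * (IZR m * PI)) * Csin ((alpha + theta) * PI)))%C).
  { rewrite <- Csin_plus_int_PI, <- Em, <- Csin_opp. f_equal. ring. }
  rewrite S1 in E1. rewrite S2 in E2.
  assert (E3 : (/ CGamma (- p) * / CGamma (p + 1) = rho * (/ CGamma (- p - alpha) * / CGamma (1 + p + alpha)))%C).
  { rewrite E1, E2. unfold rho. field. exact hE. }
  (* With this inverse as an atom, [field] asks for no condition on [CGamma (- p - alpha)]. *)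
  rewrite E3. generalize (/ CGamma (- p - alpha))%C. intros i. field. exact N.
Qed.

Lemma Phi_at_1 : exists u v : R -> C, Csmooth_near u 1 /\ Csmooth_near v 1 /\
  locally 1 (fun x =>
    (x < 1 -> Phi alpha beta p x = (u x + v x * Rcpow (1 - x) (- alpha))%C) /\
    (1 < x -> Phi alpha beta p x = (rho * u x + v x * Rcpow (x - 1) (- alpha))%C)).
Proof.
  pose proof alpha_nonint as Hni. pose proof (nonint_opp _ Hni) as Hno.
  pose proof (nonint_nonpole_1_plus _ Hni) as Np1. pose proof (nonint_nonpole_1_minus _ Hni) as Np2.
  set (b := (p + alpha + beta + 1)%C). set (b2 := (p + beta + 1)%C).
  (* [U] and [V] are the coefficients of the left branch for [s = - alpha], after the prefactor
     [1 / CGamma (beta + 1)] of [Phi] has cancelled the Gamma value of the lower parameter. *)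
  set (U := (CGamma c' * CGamma (- alpha) * (/ CGamma (- p - alpha) * / CGamma b2))%C).
  set (V := (CGamma c' * CGamma alpha * (/ CGamma (- p) * / CGamma b))%C).
  exists (fun x => U * hyp2F1 (- p) b (1 + alpha) (1 - x)%R)%C,
    (fun x => V * hyp2F1 (- p - alpha) b2 (1 - alpha) (1 - x)%R)%C.
  split; [apply Csmooth_near_hyp2F1_1_minus, Np1|].
  split; [apply Csmooth_near_hyp2F1_1_minus, Np2|].
  assert (Rs : -1 < Re (- alpha) < 1) by (simpl; unfold Re in *; lra).
  destruct (CGamma_correct _ p_alpha_nonpole) as [_ Npa].
  destruct (CGamma_correct _ (nonpole_Re_pos _ beta1_Re_pos)) as [_ Nb1].
  pose proof (connection_formula (- p) b (- alpha)) as HL. unfold connection in HL.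
  replace (- p + b + - alpha)%C with (beta + 1)%C in HL by (unfold b; ring).
  replace (- - alpha)%C with alpha in HL by ring.
  replace (1 - - alpha)%C with (1 + alpha)%C in HL by ring.
  replace (b + - alpha)%C with b2 in HL by (unfold b, b2; ring).
  change (- p + - alpha)%C with (- p - alpha)%C in HL.
  change (1 + - alpha)%C with (1 - alpha)%C in HL.
  specialize (HL beta1_Re_pos Hno Rs).
  pose proof (connection_formula (1 + p + alpha) b (- alpha)) as HR. unfold connection in HR.
  replace (1 + p + alpha + b + - alpha)%C with c' in HR by (unfold b, c'; ring).
  replace (- - alpha)%C with alpha in HR by ring.
  replace (1 - - alpha)%C with (1 + alpha)%C in HR by ring.
  replace (b + - alpha)%C with b2 in HR by (unfold b, b2; ring).
  replace (1 + p + alpha + - alpha)%C with (p + 1)%C in HR by ring.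
  change (1 + - alpha)%C with (1 - alpha)%C in HR.
  specialize (HR ltac:(pose proof c'_Re_pos; lra) Hno Rs).
  assert (Rp1 : 0 < Re (1 + alpha)) by (rewrite re_plus, re_RtoC; lra).
  assert (Rp2 : 0 < Re (1 - alpha)) by (unfold Cminus; rewrite re_plus, re_RtoC; lra).
  destruct (hyp2F1_pfaff_at_0 (- p) b (1 + alpha) Rp1) as (e1 & He1 & P1).
  destruct (hyp2F1_pfaff_at_0 (- p - alpha) b2 (1 - alpha) Rp2) as (e2 & He2 & P2).
  pose proof (locally_gt 0 1 ltac:(lra)) as L0.
  pose proof (locally_lt (1 + e1) 1 ltac:(lra)) as L1.
  pose proof (locally_lt (1 + e2) 1 ltac:(lra)) as L2.
  eapply filter_imp; [|exact (filter_and _ _ L0 (filter_and _ _ L1 L2))].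
  intros y (X0 & X1 & X2). revert X0 X1 X2. generalize (y : R). intros x X0 X1 X2.
  unfold Phi. fold b. fold c'. split; intros Hx; destruct (Rlt_dec x 1) as [h|h]; try lra.
  - pose proof (HL (1 - x) ltac:(lra)) as E.
    replace (1 - (1 - x)) with x in E by ring.
    rewrite E. unfold U, V.
    (* Reciprocals of Gamma may be taken at poles, for instance when [p] is a natural number, so
       they are made atoms before [field]. *)
    set (GA := CGamma (- alpha)). set (GB := CGamma alpha). unfold Cdiv.
    set (i1 := (/ CGamma (- p - alpha))%C). set (i2 := (/ CGamma b2)%C).
    set (i3 := (/ CGamma (- p))%C). set (i4 := (/ CGamma b)%C).
    field. exact Nb1.
  - assert (Xx : 0 < / x) by (apply Rinv_0_lt_compat; lra).
    assert (Xi : / x < 1) by (rewrite <- Rinv_1; apply Rinv_lt_contravar; lra).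
    set (z := 1 - / x).
    assert (Ez : z = (x - 1) * / x) by (unfold z; field; lra).
    assert (Hz : 0 < z < 1) by (unfold z; lra).
    (* Hence [x < 1 + e1] and [x < 1 + e2] put [z] in the range of both Pfaff transformations. *)
    assert (Hzx : z <= x - 1).
    { rewrite Ez. rewrite <- (Rmult_1_r (x - 1)) at 2. apply Rmult_le_compat_l; lra. }
    pose proof (HR z Hz) as E.
    replace (1 - z) with (/ x) in E by (unfold z; ring).
    pose proof (P1 z ltac:(lra)) as F1. pose proof (P2 z ltac:(lra)) as F2.
    replace (- z / (1 - z)) with (1 - x) in F1, F2 by (unfold z; field; lra).
    replace (1 - z) with (/ x) in F1, F2 by (unfold z; ring).
    rewrite Rcpow_inv in F1, F2 by lra.
    replace (- - b)%C with b in F1 by ring. replace (- - b2)%C with b2 in F2 by ring.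
    replace (1 + alpha - - p)%C with (1 + p + alpha)%C in F1 by ring.
    replace (1 - alpha - (- p - alpha))%C with (p + 1)%C in F2 by ring.
    replace (p + alpha + 1)%C with (1 + p + alpha)%C by ring.
    rewrite E, F1, F2, Ez, Rcpow_mult, Rcpow_inv by lra.
    replace (- - alpha)%C with alpha by ring.
    replace (- alpha - beta - p - 1)%C with (- b)%C by (unfold b; ring).
    (* In the singular term [z^(-alpha)] contributes [x^alpha] and Pfaff contributes [x^b2];
       together they cancel the factor [x^(-b)] of [Phi]. *)
    assert (Eb : Rcpow x b = (Rcpow x alpha * Rcpow x b2)%C).
    { rewrite <- Rcpow_plus. f_equal. unfold b, b2. ring. }
    pose proof (Rcpow_opp_l x b) as Q.
    pose proof CGamma_ratio_reflection as G.
    set (h1 := hyp2F1 (- p) b (1 + alpha) (1 - x)). set (h2 := hyp2F1 (- p - alpha) b2 (1 - alpha) (1 - x)).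
    set (xm := Rcpow (x - 1) (- alpha)).
    transitivity ((CGamma (1 + p + alpha) * (/ CGamma (- p) * / CGamma (p + 1))) * (CGamma c' * CGamma (- alpha) * / CGamma b2)
        * (Rcpow x (- b) * Rcpow x b) * h1
      + (CGamma (1 + p + alpha) * / CGamma (1 + p + alpha)) * V * (Rcpow x (- b) * (Rcpow x alpha * Rcpow x b2)) * (h2 * xm))%C.
    + unfold V, Cdiv. ring.
    + rewrite <- Eb, Q, G. unfold U.
      replace (CGamma (1 + p + alpha) * / CGamma (1 + p + alpha))%C with (RtoC 1) by (field; exact Npa).
      ring.
Qed.

Lemma Phi_smooth (x : R) : 0 < x -> x <> 1 -> Csmooth (Phi alpha beta p) x.
Proof.
  intros Hx0 Hx1.
  pose proof (nonpole_Re_pos _ beta1_Re_pos) as Nb.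
  assert (Nc : nonpole c') by (apply nonpole_Re_pos; pose proof c'_Re_pos; lra).
  apply smooth_at_Csmooth. intros k.
  destruct (Rlt_le_dec x 1) as [Hx|Hx].
  - apply (Cdiffn_ext_loc k (fun t => CGamma c' / CGamma (beta + 1) * hyp2F1 (- p) (p + alpha + beta + 1) (beta + 1) t)%C).
    + eapply filter_imp; [|apply (locally_lt 1 x Hx)]. intros t Ht. unfold Phi.
      destruct (Rlt_dec t 1); [reflexivity | contradiction].
    + apply Cdiffn_mult; [apply Cdiffn_const|]. apply Cdiffn_hyp2F1; [exact Nb | apply Rabs_lt_1_of_01; lra].
  - apply (Cdiffn_ext_loc k (fun t => CGamma (1 + p + alpha) / CGamma (- p)
      * hyp2F1 (p + alpha + 1) (p + alpha + beta + 1) c' (/ t)%R * Rcpow t (- alpha - beta - p - 1))%C).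
    + assert (Hx2 : 1 < x) by lra.
      eapply filter_imp; [|apply (locally_gt 1 x Hx2)]. intros t Ht. unfold Phi.
      destruct (Rlt_dec t 1); [lra | reflexivity].
    + apply Cdiffn_mult; [apply Cdiffn_mult; [apply Cdiffn_const|] | apply Cdiffn_Rcpow; lra].
      apply (Cdiffn_comp k (hyp2F1 (p + alpha + 1) (p + alpha + beta + 1) c') (fun t => / t)).
      * apply Cdiffn_hyp2F1; [exact Nc|]. apply Rabs_lt_1_of_01. split.
        -- apply Rinv_0_lt_compat; lra.
        -- rewrite <- Rinv_1. apply Rinv_lt_contravar; lra.
      * apply Cdiffn_Rinv; lra.
Qed.

Lemma Phi_at_0 : exists g : R -> C, Csmooth_near g 0 /\
  locally 0 (fun x => 0 <= x -> Phi alpha beta p x = g x).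
Proof.
  pose proof (nonpole_Re_pos _ beta1_Re_pos) as Nb.
  assert (L : locally 0 (fun x => Rabs x < 1)) by (apply locally_Rabs_lt_1; rewrite Rabs_R0; lra).
  exists (fun t => CGamma c' / CGamma (beta + 1) * hyp2F1 (- p) (p + alpha + beta + 1) (beta + 1) t)%C.
  unfold Csmooth_near. split; (eapply filter_imp; [|exact L]); intros x Hx.
  - apply smooth_at_Csmooth. intros k. apply Cdiffn_mult; [apply Cdiffn_const|].
    apply Cdiffn_hyp2F1; assumption.
  - intros _. unfold Phi. apply Rabs_def2 in Hx. destruct (Rlt_dec x 1); [reflexivity | lra].
Qed.

(** [Phi] decays faster than the minimal index requires by [x^(-j)], where [p = r + j]. Since [j] is
    a natural number, this factor enters [w] as the smooth function [t^j]. *)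
Lemma Phi_at_infty : exists (r : C) (w : R -> C), min_index alpha beta theta r /\
  Csmooth_near w 0 /\
  Rbar_locally p_infty (fun x =>
    Phi alpha beta p x = (w (/ x)%R * Rcpow x (- alpha - beta - r - 1))%C).
Proof.
  assert (Nc : nonpole c') by (apply nonpole_Re_pos; pose proof c'_Re_pos; lra).
  destruct (proj1 hp) as (m & Em).
  destruct (min_index_ex alpha beta theta p m hp Em) as (r & j & Hr & Ep).
  exists r, (fun t => CGamma (1 + p + alpha) / CGamma (- p)
      * hyp2F1 (p + alpha + 1) (p + alpha + beta + 1) c' t * RtoC t ^ j)%C.
  split; [exact Hr|]. unfold Csmooth_near. split.
  - assert (L : locally 0 (fun x => Rabs x < 1)) by (apply locally_Rabs_lt_1; rewrite Rabs_R0; lra).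
    eapply filter_imp; [|exact L]. intros x Hx. apply smooth_at_Csmooth. intros k.
    apply Cdiffn_mult; [apply Cdiffn_mult; [apply Cdiffn_const | apply Cdiffn_hyp2F1; assumption] | apply Cdiffn_pow].
  - exists 1. intros x Hx. unfold Phi. destruct (Rlt_dec x 1); [lra|].
    assert (Xx : 0 < / x) by (apply Rinv_0_lt_compat; lra).
    rewrite <- (Rcpow_INR (/ x) j Xx), (Rcpow_inv x) by lra.
    replace (- alpha - beta - p - 1)%C with (- INR j + (- alpha - beta - r - 1))%C by (rewrite Ep; ring).
    rewrite Rcpow_plus. fold c'. ring.
Qed.

Lemma Phi_space_E : space_E alpha beta theta (Phi alpha beta p).
Proof.
  split; [exact Phi_smooth|]. split; [exact Phi_at_0|]. split; [exact Phi_at_1 | exact Phi_at_infty].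
Qed.

End Phi_in_E.

(** * Improper integrals through antiderivatives *)

Lemma convex_Rmin_Rmax (D : R -> Prop) (x y z : R) :
  convex D -> D x -> D y -> Rmin x y <= z <= Rmax x y -> D z.
Proof.
  intros HD Hx Hy Hz. unfold Rmin, Rmax in Hz. destruct (Rle_dec x y).
  - apply (HD x y); assumption.
  - apply (HD y x); assumption.
Qed.

Lemma antiderivative_ex (f : R -> R) (D : R -> Prop) (x0 : R) :
  convex D -> (forall x, D x -> locally x D) -> (forall x, D x -> continuous f x) -> D x0 ->
  exists F : R -> R, forall x, D x -> is_derive F x (f x).
Proof.
  intros HD HO Hf H0. exists (RInt f x0). intros x Hx.
  apply (is_derive_RInt f (RInt f x0) x0); [|apply Hf, Hx].
  eapply filter_imp; [|apply (HO x Hx)]. intros y Hy.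
  apply (RInt_correct (V := R_CompleteNormedModule)).
  apply (ex_RInt_continuous (V := R_CompleteNormedModule)).
  intros z Hz. apply Hf, (convex_Rmin_Rmax D x0 y); assumption.
Qed.

Lemma Cantiderivative_ex (f : R -> C) (D : R -> Prop) (x0 : R) :
  convex D -> (forall x, D x -> locally x D) -> (forall x, D x -> Clim (locally x) f (f x)) -> D x0 ->
  exists F : R -> C, forall x, D x -> is_Cderive F x (f x).
Proof.
  intros HD HO Hf H0.
  destruct (antiderivative_ex (fun x => Re (f x)) D x0 HD HO) as [F1 H1]; [intros x Hx; apply (Hf x Hx) | exact H0|].
  destruct (antiderivative_ex (fun x => Im (f x)) D x0 HD HO) as [F2 H2]; [intros x Hx; apply (Hf x Hx) | exact H0|].
  exists (fun x => (F1 x, F2 x)). intros x Hx. split; [apply H1 | apply H2]; exact Hx.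
Qed.

Lemma derive_nonneg_le (F f : R -> R) (D : R -> Prop) (x y : R) :
  convex D -> (forall z, D z -> is_derive F z (f z)) -> (forall z, D z -> 0 <= f z) ->
  D x -> D y -> x <= y -> F x <= F y.
Proof.
  intros HD HF Hf Hx Hy Hxy.
  assert (HDz : forall z, Rmin x y <= z <= Rmax x y -> D z).
  { intros z Hz. apply (convex_Rmin_Rmax D x y); assumption. }
  destruct (MVT_gen F x y f) as (z & Hz & E).
  - intros z Hz. apply HF, HDz. lra.
  - intros z Hz. apply continuity_pt_filterlim, (ex_derive_continuous F). eexists; apply HF, HDz, Hz.
  - pose proof (Hf z (HDz z Hz)). assert (0 <= f z * (y - x)) by (apply Rmult_le_pos; lra). lra.
Qed.

(** Both [H - F] and [H + F] are nondecreasing. *)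
Lemma derive_abs_le (F f H h : R -> R) (D : R -> Prop) (x y : R) :
  convex D -> (forall z, D z -> is_derive F z (f z)) -> (forall z, D z -> is_derive H z (h z)) ->
  (forall z, D z -> Rabs (f z) <= h z) ->
  D x -> D y -> Rabs (F x - F y) <= Rabs (H x - H y).
Proof.
  intros HD HF HH Hb.
  assert (W : forall x y, D x -> D y -> x <= y -> Rabs (F x - F y) <= Rabs (H x - H y)).
  { intros a b Ha Hb' Hab.
    assert (Q1 : H a - F a <= H b - F b).
    { apply (derive_nonneg_le (fun z => H z - F z) (fun z => h z - f z) D); try assumption.
      - intros z Hz. apply (is_derive_minus (V := R_NormedModule)); auto.
      - intros z Hz. pose proof (Hb z Hz). pose proof (Rle_abs (f z)). lra. }
    assert (Q2 : H a + F a <= H b + F b).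
    { apply (derive_nonneg_le (fun z => H z + F z) (fun z => h z + f z) D); try assumption.
      - intros z Hz. apply (is_derive_plus (V := R_NormedModule)); auto.
      - intros z Hz. pose proof (Hb z Hz). pose proof (Rle_abs (- f z)). rewrite Rabs_Ropp in *. lra. }
    rewrite (Rabs_left1 (H a - H b)) by lra. apply Rabs_le. lra. }
  intros Hx Hy. destruct (Rle_dec x y) as [L|L]; [auto|].
  rewrite Rabs_minus_sym, (Rabs_minus_sym (H x)). apply W; auto; lra.
Qed.

(** The Cauchy criterion passes from the antiderivative [H] of the majorant to [F]. *)
Lemma filterlim_antiderivative_ex (F f H h : R -> R) (D : R -> Prop) (G : (R -> Prop) -> Prop)
    {PG : ProperFilter G} (l : R) :
  convex D -> G D -> (forall z, D z -> is_derive F z (f z)) -> (forall z, D z -> is_derive H z (h z)) ->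
  (forall z, D z -> Rabs (f z) <= h z) -> filterlim H G (locally l) ->
  exists m : R, filterlim F G (locally m).
Proof.
  intros HD GD HF HH Hb HL.
  apply (filterlim_locally_cauchy (U := R_CompleteSpace)). intros eps.
  destruct (proj2 (filterlim_locally_cauchy (U := R_CompleteSpace) (F := G) H) (ex_intro _ l HL) eps)
    as (P & GP & HP).
  exists (fun x => P x /\ D x). split; [apply filter_and; assumption|].
  intros u v [Pu Du] [Pv Dv]. specialize (HP u v Pu Pv).
  change (Rabs (H v - H u) < eps) in HP. change (Rabs (F v - F u) < eps).
  eapply Rle_lt_trans; [apply (derive_abs_le F f H h D); eassumption | exact HP].
Qed.

(* [|f| <= K t^(k-1) |t'|] with [k > 0], for a monotone local parameter [t] tending to 0;
   [e] is the sign of [t']. *)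
Definition power_bounded (G : (R -> Prop) -> Prop) (f : R -> C) : Prop :=
  exists (D : R -> Prop) (t t' : R -> R) (e k K : R),
    G D /\ convex D /\ 0 < k /\ filterlim t G (at_right 0) /\
    forall x, D x -> 0 < t x /\ is_derive t x (t' x) /\ 0 <= e * t' x /\
      Cmod (f x) <= K * Rpower (t x) (k - 1) * (e * t' x).

Lemma power_bounded_Clim (G : (R -> Prop) -> Prop) {PG : ProperFilter G} (f F : R -> C) (D : R -> Prop) :
  convex D -> G D -> (forall x, D x -> is_Cderive F x (f x)) -> power_bounded G f ->
  exists l : C, Clim G F l.
Proof.
  intros HD GD HF (D' & t & t' & e & k & K & GD' & HD' & Hk & Ht & B).
  set (D2 := fun x => D x /\ D' x).
  assert (C2 : convex D2).
  { intros x y z [? ?] [? ?] Hz. split; [apply (HD x y) | apply (HD' x y)]; assumption. }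
  assert (G2 : G D2) by (apply filter_and; assumption).
  (* An antiderivative of the majorant, tending to 0 with [t] because [k > 0]. *)
  set (H := fun x => e * K / k * Rpower (t x) k).
  set (h := fun x => K * Rpower (t x) (k - 1) * (e * t' x)).
  assert (DH : forall x, D2 x -> is_derive H x (h x)).
  { intros x [_ Hx]. destruct (B x Hx) as (Pt & Dt & _ & _). unfold H, h, Rpower.
    auto_derive.
    - repeat split; try assumption. eexists; exact Dt.
    - replace (Derive (fun x0 : R => t x0) x) with (t' x) by (symmetry; exact (is_derive_unique _ _ _ Dt)).
      replace ((k - 1) * ln (t x)) with (k * ln (t x) + - ln (t x)) by ring.
      rewrite exp_plus, exp_Ropp, exp_ln by assumption. field. lra. }
  assert (LH : filterlim H G (locally (e * K / k * 0))).
  { apply filterlim_Rmult; [apply filterlim_const|].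
    exact (filterlim_comp _ _ _ t (fun y => Rpower y k) _ _ _ Ht (filterlim_Rpower_0 k Hk)). }
  destruct (filterlim_antiderivative_ex (fun x => Re (F x)) (fun x => Re (f x)) H h D2 G (e * K / k * 0) C2 G2) as [l1 L1]; try assumption.
  - intros x [Hx _]. apply (HF x Hx).
  - intros x [_ Hx]. destruct (B x Hx) as (_ & _ & _ & Bx). eapply Rle_trans; [apply re_le_Cmod | exact Bx].
  - destruct (filterlim_antiderivative_ex (fun x => Im (F x)) (fun x => Im (f x)) H h D2 G (e * K / k * 0) C2 G2) as [l2 L2]; try assumption.
    + intros x [Hx _]. apply (HF x Hx).
    + intros x [_ Hx]. destruct (B x Hx) as (_ & _ & _ & Bx). eapply Rle_trans; [apply im_le_Cmod | exact Bx].
    + exists (l1, l2). split; assumption.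
Qed.

Lemma is_RInt_gen_antiderivative (f F : R -> R) (D : R -> Prop) (Fa Fb : (R -> Prop) -> Prop)
    {PA : Filter Fa} {PB : Filter Fb} (la lb : R) :
  convex D -> Fa D -> Fb D -> (forall x, D x -> is_derive F x (f x)) ->
  (forall x, D x -> continuous f x) ->
  filterlim F Fa (locally la) -> filterlim F Fb (locally lb) ->
  is_RInt_gen f Fa Fb (lb - la).
Proof.
  intros HD DA DB HF Hf LA LB P HP.
  assert (L : filterlim (fun ab : R * R => F (snd ab) + - F (fst ab)) (filter_prod Fa Fb) (locally (lb + - la))).
  { apply filterlim_Rplus.
    - eapply filterlim_comp; [apply filterlim_snd | exact LB].
    - apply filterlim_Ropp. eapply filterlim_comp; [apply filterlim_fst | exact LA]. }
  specialize (L P HP). unfold filtermap in L. unfold filtermapi.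
  assert (Q : filter_prod Fa Fb (fun ab => D (fst ab) /\ D (snd ab))).
  { exists D D; auto. }
  eapply filter_imp; [|exact (filter_and _ _ L Q)]. intros [a b]; simpl. intros (H1 & Da & Db).
  exists (F b + - F a). split; [|exact H1].
  apply (is_RInt_derive (V := R_CompleteNormedModule) F f a b); intros x Hx;
    [apply HF | apply Hf]; apply (convex_Rmin_Rmax D a b); assumption.
Qed.

Lemma CRInt_gen_antiderivative (f F : R -> C) (D : R -> Prop) (Fa Fb : (R -> Prop) -> Prop)
    {PA : ProperFilter Fa} {PB : ProperFilter Fb} (la lb : C) :
  convex D -> Fa D -> Fb D -> (forall x, D x -> is_Cderive F x (f x)) ->
  (forall x, D x -> Clim (locally x) f (f x)) -> Clim Fa F la -> Clim Fb F lb ->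
  ex_CRInt_gen f Fa Fb /\ CRInt_gen f Fa Fb = (lb - la)%C.
Proof.
  intros HD DA DB HF Hf LA LB.
  assert (R1 : is_RInt_gen (fun x => Re (f x)) Fa Fb (Re lb - Re la)).
  { apply (is_RInt_gen_antiderivative _ (fun x => Re (F x)) D); try assumption; try apply filter_filter;
      try apply LA; try apply LB; intros x Hx; [apply (HF x Hx) | apply (Hf x Hx)]. }
  assert (R2 : is_RInt_gen (fun x => Im (f x)) Fa Fb (Im lb - Im la)).
  { apply (is_RInt_gen_antiderivative _ (fun x => Im (F x)) D); try assumption; try apply filter_filter;
      try apply LA; try apply LB; intros x Hx; [apply (HF x Hx) | apply (Hf x Hx)]. }
  split; [split; eexists; eassumption|]. unfold CRInt_gen.
  rewrite (is_RInt_gen_unique (V := R_CompleteNormedModule) _ _ R1),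
    (is_RInt_gen_unique (V := R_CompleteNormedModule) _ _ R2).
  reflexivity.
Qed.

(** The power bounds make both integrals converge separately. With antiderivatives [F1] and [F2],
    the function [F1 - F2 - P] is constant, and comparing its limits at the two ends gives the
    boundary terms. *)
Lemma CRInt_gen_green (f1 f2 P : R -> C) (D : R -> Prop) (x0 : R) (Fa Fb : (R -> Prop) -> Prop)
    {PA : ProperFilter Fa} {PB : ProperFilter Fb} (pa pb : C) :
  convex D -> (forall x, D x -> locally x D) -> D x0 -> Fa D -> Fb D ->
  (forall x, D x -> Clim (locally x) f1 (f1 x)) -> (forall x, D x -> Clim (locally x) f2 (f2 x)) ->
  power_bounded Fa f1 -> power_bounded Fb f1 -> power_bounded Fa f2 -> power_bounded Fb f2 ->
  (forall x, D x -> is_Cderive P x (f1 x - f2 x)%C) -> Clim Fa P pa -> Clim Fb P pb ->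
  ex_CRInt_gen f1 Fa Fb /\ ex_CRInt_gen f2 Fa Fb /\
  CRInt_gen f1 Fa Fb = (CRInt_gen f2 Fa Fb + (pb - pa))%C.
Proof.
  intros HD HO H0 DA DB C1 C2 A1 B1 A2 B2 HP LPa LPb.
  destruct (Cantiderivative_ex f1 D x0 HD HO C1 H0) as [F1 HF1].
  destruct (Cantiderivative_ex f2 D x0 HD HO C2 H0) as [F2 HF2].
  destruct (power_bounded_Clim Fa f1 F1 D HD DA HF1 A1) as [a1 La1].
  destruct (power_bounded_Clim Fb f1 F1 D HD DB HF1 B1) as [b1 Lb1].
  destruct (power_bounded_Clim Fa f2 F2 D HD DA HF2 A2) as [a2 La2].
  destruct (power_bounded_Clim Fb f2 F2 D HD DB HF2 B2) as [b2 Lb2].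
  destruct (CRInt_gen_antiderivative f1 F1 D Fa Fb a1 b1 HD DA DB HF1 C1 La1 Lb1) as [E1 I1].
  destruct (CRInt_gen_antiderivative f2 F2 D Fa Fb a2 b2 HD DA DB HF2 C2 La2 Lb2) as [E2 I2].
  split; [exact E1|]. split; [exact E2|]. rewrite I1, I2.
  set (Q := fun x => (F1 x - F2 x - P x)%C).
  assert (K : forall x, D x -> Q x = Q x0).
  { intros x Hx. apply (is_Cderive_0_const Q D HD); try assumption.
    intros z Hz. eapply is_Cderive_eq.
    - apply is_Cderive_minus; [apply is_Cderive_minus; [apply HF1 | apply HF2] | apply HP]; exact Hz.
    - ring. }
  assert (LQa : (a1 - a2 - pa)%C = Q x0).
  { apply (Clim_unique Fa Q).
    - unfold Q. apply Clim_minus; [apply Clim_minus|]; assumption.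
    - apply (Clim_ext_loc (fun _ => Q x0)); [|apply Clim_const].
      eapply filter_imp; [|exact DA]. intros x Hx. symmetry. apply K, Hx. }
  assert (LQb : (b1 - b2 - pb)%C = Q x0).
  { apply (Clim_unique Fb Q).
    - unfold Q. apply Clim_minus; [apply Clim_minus|]; assumption.
    - apply (Clim_ext_loc (fun _ => Q x0)); [|apply Clim_const].
      eapply filter_imp; [|exact DB]. intros x Hx. symmetry. apply K, Hx. }
  transitivity ((b1 - b2 - pb) - (a1 - a2 - pa) + (b2 - a2 + (pb - pa)))%C; [ring|].
  rewrite LQa, LQb. ring.
Qed.

(** * Local behaviour of the elements of [E] *)

Lemma Csmooth_is_Cderive (u : R -> C) (x : R) : Csmooth u x ->
  is_Cderive u x (CDerive u x) /\
  is_Cderive (CDerive u) x (CDerive (CDerive u) x) /\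
  Clim (locally x) (CDerive (CDerive u)) (CDerive (CDerive u) x).
Proof.
  intros H. split; [|split].
  - destruct (H 1%nat) as [A B]. split; apply Derive_correct; assumption.
  - destruct (H 2%nat) as [A B]. split; apply Derive_correct; assumption.
  - destruct (H 3%nat) as [A B]. split.
    + apply (ex_derive_continuous (fun t => Re (CDerive (CDerive u) t))). exact A.
    + apply (ex_derive_continuous (fun t => Im (CDerive (CDerive u) t))). exact B.
Qed.

Lemma CDerive_ext_loc (f g : R -> C) (x : R) :
  locally x (fun t => f t = g t) -> CDerive f x = CDerive g x.
Proof.
  intros H. unfold CDerive. f_equal; apply Derive_ext_loc;
    (eapply filter_imp; [|exact H]); intros t Ht; cbv beta; rewrite Ht; reflexivity.
Qed.

(** [P] holds near every point close to [x], so [f1] agrees with [CDerive f] on a whole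
    neighbourhood, as the second differentiation requires. *)
Lemma CDerive_eq_loc (f f1 : R -> C) (P : R -> Prop) (x : R) (l : C) :
  locally x P -> (forall y, locally y P -> is_Cderive f y (f1 y)) -> is_Cderive f1 x l ->
  CDerive f x = f1 x /\ CDerive (CDerive f) x = l.
Proof.
  intros HP H H1. split; [apply is_Cderive_unique, H, HP|].
  rewrite <- (is_Cderive_unique _ _ _ H1). apply CDerive_ext_loc.
  eapply filter_imp; [|apply (locally_locally _ _ HP)]. intros y Hy.
  apply is_Cderive_unique, H, Hy.
Qed.

(** Whatever holds eventually along [G] holds on an interval belonging to [G], where the comparison
    of antiderivatives can be carried out. *)
Definition convex_basis (G : (R -> Prop) -> Prop) : Prop :=
  forall P, G P -> exists D : R -> Prop, convex D /\ G D /\ forall x, D x -> P x.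

Lemma convex_basis_at_right (a : R) : convex_basis (at_right a).
Proof.
  intros P [d Hd]. exists (fun x => a < x < a + d). split; [|split].
  - intros x y z; lra.
  - exists d. intros y By Hy. change (Rabs (y - a) < d) in By. apply Rabs_def2 in By. lra.
  - intros x Hx. apply Hd; [|lra]. change (Rabs (x - a) < d). apply Rabs_def1; lra.
Qed.

Lemma convex_basis_at_left (a : R) : convex_basis (at_left a).
Proof.
  intros P [d Hd]. exists (fun x => a - d < x < a). split; [|split].
  - intros x y z; lra.
  - exists d. intros y By Hy. change (Rabs (y - a) < d) in By. apply Rabs_def2 in By. lra.
  - intros x Hx. apply Hd; [|lra]. change (Rabs (x - a) < d). apply Rabs_def1; lra.
Qed.

Lemma convex_basis_p_infty : convex_basis (Rbar_locally p_infty).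
Proof.
  intros P [M HM]. exists (fun x => M < x). split; [|split].
  - intros x y z; lra.
  - exists M. auto.
  - exact HM.
Qed.

Lemma power_bounded_intro (G : (R -> Prop) -> Prop) (t t' : R -> R) (e k K : R) (f : R -> C) :
  convex_basis G -> 0 < k -> filterlim t G (at_right 0) ->
  G (fun x => 0 < t x /\ is_derive t x (t' x) /\ 0 <= e * t' x /\
      Cmod (f x) <= K * Rpower (t x) (k - 1) * (e * t' x)) ->
  power_bounded G f.
Proof.
  intros HG Hk Ht H. destruct (HG _ H) as (D & CD & GD & HD).
  exists D, t, t', e, k, K. auto.
Qed.

Lemma Rpower_le_of_lt_1 (t a b : R) : 0 < t < 1 -> b <= a -> Rpower t a <= Rpower t b.
Proof.
  intros Ht Hab. unfold Rpower. assert (ln t < 0) by (rewrite <- ln_1; apply ln_increasing; lra).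
  destruct (Req_dec (a * ln t) (b * ln t)) as [->|N]; [lra|].
  apply Rlt_le, exp_increasing. nra.
Qed.

(** * The weighted integrand and the boundary term on either side of 1 *)

Section Local.
Variables alpha beta : C.

(** The bilinear concomitant of the operator. With [t x = |1 - x|] and [eps] the sign of [1 - x],
    one definition serves both (0,1) and (1,oo). *)
Definition lagrange (eps : R) (t : R -> R) (f g : R -> C) (x : R) : C :=
  (eps * (Rcpow x (beta + 1) * Rcpow (t x) (alpha + 1)) * (CDerive f x * g x - f x * CDerive g x))%C.

(** Convertible to [form_integrand_lt1] for [t x = 1 - x] and to [form_integrand_gt1] for
    [t x = x - 1]. *)
Definition weighted (t : R -> R) (f g : R -> C) (x : R) : C :=
  (f x * g x * Rcpow (t x) alpha * Rcpow x beta)%C.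

Section Half.
Variables (eps : R) (t : R -> R).
Hypothesis heps : eps = 1 \/ eps = -1.
Hypothesis ht : forall x, t x = eps * (1 - x).

Lemma is_derive_t (x : R) : is_derive t x (- eps).
Proof.
  apply (is_derive_ext (fun x => eps * (1 - x))); [intros y; symmetry; apply ht|].
  auto_derive; [trivial | ring].
Qed.

Lemma locally_t_pos (x : R) : 0 < t x -> locally x (fun y => 0 < t y).
Proof.
  intros H. apply (locally_comp_is_derive (fun u => 0 < u) t x _ (is_derive_t x)), locally_gt, H.
Qed.

Lemma is_Cderive_Rcpow_t (s : C) (x : R) : 0 < t x ->
  is_Cderive (fun y => Rcpow (t y) s) x (- eps * s * Rcpow (t x) (s - 1))%C.
Proof.
  intros H. rewrite <- RtoC_opp. apply is_Cderive_Rcpow_comp; [exact H | apply is_derive_t].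
Qed.

Lemma RtoC_t (x : R) : RtoC (t x) = (eps * (1 - x))%C.
Proof. rewrite ht, RtoC_mult, RtoC_minus. reflexivity. Qed.

Lemma eps_sqr : (RtoC eps * RtoC eps)%C = RtoC 1.
Proof. rewrite <- RtoC_mult. f_equal. destruct heps; subst eps; ring. Qed.

Lemma eps_neq_0 : RtoC eps <> RtoC 0.
Proof. apply RtoC_neq_0. destruct heps; subst eps; lra. Qed.

(** Lagrange's identity: [x^beta t^alpha] times the operator applied to [f] is [eps] times the
    derivative of [x^(beta+1) t^(alpha+1) f'], since [x (1 - x) = eps x t]. *)
Lemma is_Cderive_lagrange (f g : R -> C) (x : R) :
  0 < x -> 0 < t x -> Csmooth f x -> Csmooth g x ->
  is_Cderive (lagrange eps t f g) x
    (weighted t (hyp_op alpha beta f) g x - weighted t f (hyp_op alpha beta g) x)%C.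
Proof.
  intros Hx Ht Hf Hg.
  destruct (Csmooth_is_Cderive f x Hf) as (F1 & F2 & _).
  destruct (Csmooth_is_Cderive g x Hg) as (G1 & G2 & _).
  eapply is_Cderive_eq.
  - unfold lagrange. apply is_Cderive_mult.
    + apply is_Cderive_scal, is_Cderive_mult; [apply is_Cderive_Rcpow, Hx | apply is_Cderive_Rcpow_t, Ht].
    + apply is_Cderive_minus; apply is_Cderive_mult; eassumption.
  - unfold weighted, hyp_op.
    replace (beta + 1 - 1)%C with beta by ring. replace (alpha + 1 - 1)%C with alpha by ring.
    rewrite !Rcpow_plus, !Rcpow_1, RtoC_t by assumption.
    set (A := Rcpow (t x) alpha). set (B := Rcpow x beta). set (f2 := CDerive (CDerive f) x).
    set (g2 := CDerive (CDerive g) x). set (f1 := CDerive f x). set (g1 := CDerive g x).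
    transitivity ((RtoC eps * RtoC eps) * A * B * ((beta + 1) * (1 - x) * (f1 * g x - f x * g1)
       + x * - (alpha + 1) * (f1 * g x - f x * g1) + x * (1 - x) * (f2 * g x - f x * g2)))%C; [ring|].
    rewrite eps_sqr. ring.
Qed.

Lemma Clim_hyp_op_locally (f : R -> C) (x : R) : Csmooth f x ->
  Clim (locally x) (hyp_op alpha beta f) (hyp_op alpha beta f x).
Proof.
  intros Hf. destruct (Csmooth_is_Cderive f x Hf) as (F1 & F2 & F3).
  pose proof (is_Cderive_Clim _ _ _ (is_Cderive_id x)) as X.
  unfold hyp_op. apply Clim_plus; apply Clim_mult.
  - apply Clim_mult; [exact X | apply Clim_minus; [apply Clim_const | exact X]].
  - exact F3.
  - apply Clim_minus; [apply Clim_const | apply Clim_mult; [apply Clim_const | exact X]].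
  - apply (is_Cderive_Clim _ _ _ F2).
Qed.

Lemma Clim_weighted (f g : R -> C) (x : R) :
  0 < x -> 0 < t x -> Clim (locally x) f (f x) -> Clim (locally x) g (g x) ->
  Clim (locally x) (weighted t f g) (weighted t f g x).
Proof.
  intros Hx Ht Hf Hg. unfold weighted. repeat apply Clim_mult; try assumption.
  - apply (is_Cderive_Clim _ _ _ (is_Cderive_Rcpow_t alpha x Ht)).
  - apply (is_Cderive_Clim _ _ _ (is_Cderive_Rcpow beta x Hx)).
Qed.

(** * One-sided expansions at 1 *)

Section AtOne.
Variable G : (R -> Prop) -> Prop.
Context {PG : ProperFilter G}.
Hypothesis hGt : filterlim t G (at_right 0).
Hypothesis hG1 : filter_le G (locally 1).
Hypothesis hGc : convex_basis G.

(** The operator conjugated by [t^(-alpha)]. Since [- alpha] is an exponent of the equation at 1,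
    the factor [1 / (1 - x)] in front of [v] cancels and the coefficients are polynomial. *)
Definition hyp_op_sing (v : R -> C) (x : R) : C :=
  (x * (1 - x) * CDerive (CDerive v) x
   + (beta + 1 - (alpha + beta + 2) * x + 2 * alpha * x) * CDerive v x
   + alpha * (beta + 1) * v x)%C.

Lemma near_one_lt : G (fun x => 0 < t x < 1).
Proof.
  assert (H : at_right 0 (fun y => 0 < y < 1)) by (apply at_right_01; auto).
  exact (hGt _ H).
Qed.

(** The operator preserves the two-term shape, so integrands containing the image of [f] can be
    estimated exactly like those containing [f]. [rho] is 1 on the left of 1 and the quotient of
    sines on the right. *)
Lemma expansion_at_one (f u v : R -> C) (rho : C) :
  Csmooth_near u 1 -> Csmooth_near v 1 ->
  locally 1 (fun x => 0 < t x -> f x = (rho * u x + v x * Rcpow (t x) (- alpha))%C) ->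
  G (fun x => 0 < t x < 1 /\ f x = (rho * u x + v x * Rcpow (t x) (- alpha))%C /\
    CDerive f x = (rho * CDerive u x + CDerive v x * Rcpow (t x) (- alpha)
       + v x * (alpha * eps * Rcpow (t x) (- alpha) / t x))%C /\
    hyp_op alpha beta f x = (rho * hyp_op alpha beta u x + hyp_op_sing v x * Rcpow (t x) (- alpha))%C).
Proof.
  intros Hu Hv Hf.
  set (P := fun x => Csmooth u x /\ Csmooth v x /\
    (0 < t x -> f x = (rho * u x + v x * Rcpow (t x) (- alpha))%C) /\ 0 < t x).
  pose proof (hG1 _ (locally_locally _ _ (filter_and _ _ Hu (filter_and _ _ Hv Hf)))) as L.
  eapply filter_imp; [|exact (filter_and _ _ L near_one_lt)]. intros x [Lx Tx].
  assert (LP : locally x P).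
  { eapply filter_imp; [|exact (filter_and _ _ Lx (locally_t_pos x (proj1 Tx)))].
    unfold P. tauto. }
  set (f1 := fun y => (rho * CDerive u y + (CDerive v y * Rcpow (t y) (- alpha)
     + v y * (- eps * - alpha * Rcpow (t y) (- alpha - 1))))%C).
  assert (D1 : forall y, locally y P -> is_Cderive f y (f1 y)).
  { intros y Ly. pose proof (locally_singleton _ _ Ly) as (Su & Sv & _ & Ty).
    destruct (Csmooth_is_Cderive u y Su) as (U1 & _ & _).
    destruct (Csmooth_is_Cderive v y Sv) as (V1 & _ & _).
    apply (is_Cderive_ext_loc (fun x => rho * u x + v x * Rcpow (t x) (- alpha))%C).
    - eapply filter_imp; [|exact Ly]. intros z (_ & _ & E & Tz). symmetry. apply E, Tz.
    - apply is_Cderive_plus; [apply is_Cderive_scal, U1|].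
      apply is_Cderive_mult; [exact V1 | apply is_Cderive_Rcpow_t, Ty]. }
  pose proof (locally_singleton _ _ LP) as (Su & Sv & E & Tx0).
  destruct (Csmooth_is_Cderive u x Su) as (U1 & U2 & _).
  destruct (Csmooth_is_Cderive v x Sv) as (V1 & V2 & _).
  assert (D2 : is_Cderive f1 x (rho * CDerive (CDerive u) x
    + ((CDerive (CDerive v) x * Rcpow (t x) (- alpha) + CDerive v x * (- eps * - alpha * Rcpow (t x) (- alpha - 1)))
     + (CDerive v x * (- eps * - alpha * Rcpow (t x) (- alpha - 1))
       + v x * (- eps * - alpha * (- eps * (- alpha - 1) * Rcpow (t x) (- alpha - 1 - 1))))))%C).
  { unfold f1. apply is_Cderive_plus; [apply is_Cderive_scal, U2|]. apply is_Cderive_plus; apply is_Cderive_mult;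
      try eassumption; try (apply is_Cderive_Rcpow_t, Tx).
    apply is_Cderive_scal, is_Cderive_Rcpow_t, Tx. }
  destruct (CDerive_eq_loc f f1 P x _ LP D1 D2) as [E1 E2].
  assert (Nt : RtoC (t x) <> RtoC 0) by (apply RtoC_neq_0; lra).
  split; [exact Tx|]. split; [apply E, Tx0|]. split.
  - rewrite E1. unfold f1. rewrite Rcpow_minus_1 by exact Tx0. unfold Cdiv. ring.
  - unfold hyp_op at 1. rewrite E2, E1. unfold f1. rewrite !Rcpow_minus_1 by exact Tx0.
    set (T := Rcpow (t x) (- alpha)). unfold hyp_op, hyp_op_sing.
    rewrite RtoC_t in *.
    assert (N1 : (1 - x)%C <> RtoC 0) by (intros Z; apply Nt; rewrite Z; ring).
    pose proof eps_neq_0. field. auto.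
Qed.

Lemma Clim_at_one (u : R -> C) : Csmooth_near u 1 ->
  Clim G u (u 1) /\ Clim G (CDerive u) (CDerive u 1) /\
  Clim G (hyp_op alpha beta u) (hyp_op alpha beta u 1) /\ Clim G (hyp_op_sing u) (hyp_op_sing u 1).
Proof.
  intros Hu. pose proof (locally_singleton _ _ Hu) as S.
  destruct (Csmooth_is_Cderive u 1 S) as (U1 & U2 & U3).
  pose proof (is_Cderive_Clim _ _ _ (is_Cderive_id 1)) as X.
  split; [|split; [|split]]; apply (Clim_filter_le _ _ _ _ hG1).
  - apply (is_Cderive_Clim _ _ _ U1).
  - apply (is_Cderive_Clim _ _ _ U2).
  - apply Clim_hyp_op_locally, S.
  - unfold hyp_op_sing. repeat apply Clim_plus; apply Clim_mult; try apply Clim_const.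
    + apply Clim_mult; [exact X | apply Clim_minus; [apply Clim_const | exact X]].
    + exact U3.
    + apply Clim_plus; [apply Clim_minus; [apply Clim_const|] |]; (apply Clim_mult; [apply Clim_const | exact X]).
    + apply (is_Cderive_Clim _ _ _ U2).
    + apply (is_Cderive_Clim _ _ _ U1).
Qed.

Hypothesis halpha : -1 < Re alpha < 1.

Lemma Clim_Rcpow_t (s : C) : 0 < Re s -> Clim G (fun x => Rcpow (t x) s) (RtoC 0).
Proof. intros Hs. apply (Clim_comp _ _ t (fun y => Rcpow y s) _ hGt), Clim_Rcpow_0, Hs. Qed.

Lemma Clim_Rcpow_id_at_one (s : C) : Clim G (fun x => Rcpow x s) (RtoC 1).
Proof.
  apply (Clim_filter_le _ _ _ _ hG1). rewrite <- (Rcpow_1_l s).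
  eapply (is_Cderive_Clim (fun x => Rcpow x s)), is_Cderive_Rcpow, Rlt_0_1.
Qed.

(** Multiplying two expansions by the weight leaves the powers [t^alpha], 1 and [t^(-alpha)], all
    bounded by [t^(-|Re alpha|)]. This is integrable with [k = 1 - |Re alpha|]. *)
Lemma power_bounded_at_one (f g p1 q1 p2 q2 : R -> C) (a1 b1 a2 b2 : C) :
  Clim G p1 a1 -> Clim G q1 b1 -> Clim G p2 a2 -> Clim G q2 b2 ->
  G (fun x => f x = (p1 x + q1 x * Rcpow (t x) (- alpha))%C) ->
  G (fun x => g x = (p2 x + q2 x * Rcpow (t x) (- alpha))%C) ->
  power_bounded G (weighted t f g).
Proof.
  intros P1 Q1 P2 Q2 Ef Eg.
  pose proof (Clim_Rcpow_id_at_one beta) as X.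
  destruct (Clim_Cmod_le _ _ (Clim_mult _ _ _ _ (Clim_mult _ _ _ _ P1 P2) X)) as [N1 B1].
  destruct (Clim_Cmod_le _ _ (Clim_mult _ _ _ _ (Clim_plus _ _ _ _ (Clim_mult _ _ _ _ P1 Q2)
     (Clim_mult _ _ _ _ Q1 P2)) X)) as [N2 B2].
  destruct (Clim_Cmod_le _ _ (Clim_mult _ _ _ _ (Clim_mult _ _ _ _ Q1 Q2) X)) as [N3 B3].
  set (k0 := Rabs (Re alpha)).
  assert (Hk0 : k0 < 1) by (apply Rabs_def1; lra).
  apply (power_bounded_intro G t (fun _ => - eps) (- eps) (1 - k0) (N1 + N2 + N3)); try assumption; [lra|].
  eapply filter_imp; [|exact (filter_and _ _ (filter_and _ _ Ef Eg) (filter_and _ _ near_one_lt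
     (filter_and _ _ B1 (filter_and _ _ B2 B3))))].
  intros x ((Fx & Gx) & Tx & X1 & X2 & X3).
  assert (Ee : - eps * - eps = 1) by (destruct heps; subst eps; ring).
  split; [lra|]. split; [apply is_derive_t|]. split; [lra|].
  rewrite Ee, Rmult_1_r. replace (1 - k0 - 1) with (- k0) by ring.
  set (tau := Rpower (t x) (- k0)).
  assert (T1 : Cmod (Rcpow (t x) alpha) <= tau).
  { rewrite Cmod_Rcpow. apply Rpower_le_of_lt_1; [exact Tx|]. unfold k0.
    pose proof (Rle_abs (- Re alpha)). rewrite Rabs_Ropp in *. lra. }
  assert (T2 : Cmod (Rcpow (t x) (- alpha)) <= tau).
  { rewrite Cmod_Rcpow. apply Rpower_le_of_lt_1; [exact Tx|]. unfold k0.
    pose proof (Rle_abs (Re alpha)). simpl. unfold Re in *. lra. }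
  assert (T3 : 1 <= tau).
  { rewrite <- (Rpower_O (t x)) by lra. apply Rpower_le_of_lt_1; [exact Tx|].
    pose proof (Rabs_pos (Re alpha)). unfold k0; lra. }
  unfold weighted. rewrite Fx, Gx.
  set (S1 := (p1 x * p2 x * Rcpow x beta)%C) in *.
  set (S2 := ((p1 x * q2 x + q1 x * p2 x) * Rcpow x beta)%C) in *.
  set (S3 := (q1 x * q2 x * Rcpow x beta)%C) in *.
  pose proof (Rcpow_opp_l (t x) alpha) as O.
  set (A := Rcpow (t x) alpha) in *. set (A' := Rcpow (t x) (- alpha)) in *.
  replace ((p1 x + q1 x * A') * (p2 x + q2 x * A') * A * Rcpow x beta)%C
    with (S1 * A + S2 * (A' * A) + S3 * A' * (A' * A))%C by (unfold S1, S2, S3; ring).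
  rewrite O, !Cmult_1_r.
  eapply Rle_trans; [apply Cmod_triangle|].
  rewrite !Rmult_plus_distr_r. apply Rplus_le_compat.
  - eapply Rle_trans; [apply Cmod_triangle|]. rewrite Cmod_mult. apply Rplus_le_compat.
    + apply Rmult_le_compat; try apply Cmod_ge_0; assumption.
    + pose proof (Cmod_ge_0 S2). nra.
  - rewrite Cmod_mult. apply Rmult_le_compat; try apply Cmod_ge_0; assumption.
Qed.

(** Apart from the cross terms in which [t^(-alpha)] itself is differentiated, every term carries
    [t^(alpha+1)], [t] or [t^(1-alpha)] and vanishes. The surviving terms pair one regular with one
    singular part, whence a single factor [rho]. *)
Lemma Clim_lagrange_at_one (f u v g u2 v2 : R -> C) (rho : C) :
  Csmooth_near u 1 -> Csmooth_near v 1 -> Csmooth_near u2 1 -> Csmooth_near v2 1 ->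
  locally 1 (fun x => 0 < t x -> f x = (rho * u x + v x * Rcpow (t x) (- alpha))%C) ->
  locally 1 (fun x => 0 < t x -> g x = (rho * u2 x + v2 x * Rcpow (t x) (- alpha))%C) ->
  Clim G (lagrange eps t f g) (alpha * rho * (v 1%R * u2 1%R - u 1%R * v2 1%R))%C.
Proof.
  intros Hu Hv Hu2 Hv2 Hf Hg.
  pose proof (expansion_at_one f u v rho Hu Hv Hf) as Ef.
  pose proof (expansion_at_one g u2 v2 rho Hu2 Hv2 Hg) as Eg.
  destruct (Clim_at_one u Hu) as (U0 & U1 & _). destruct (Clim_at_one v Hv) as (V0 & V1 & _).
  destruct (Clim_at_one u2 Hu2) as (W0 & W1 & _). destruct (Clim_at_one v2 Hv2) as (Y0 & Y1 & _).
  apply (Clim_ext_loc (fun x => eps * Rcpow x (beta + 1) *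
     (rho * rho * Rcpow (t x) (alpha + 1) * (CDerive u x * u2 x - u x * CDerive u2 x)
     + rho * Rcpow (t x) 1 * (CDerive u x * v2 x + CDerive v x * u2 x - u x * CDerive v2 x - v x * CDerive u2 x)
     + Rcpow (t x) (1 - alpha) * (CDerive v x * v2 x - v x * CDerive v2 x)
     + alpha * eps * rho * (v x * u2 x - u x * v2 x)))%C).
  - eapply filter_imp; [|exact (filter_and _ _ Ef Eg)].
    intros x ((Tx & F0 & F1 & _) & (_ & G0 & G1 & _)). unfold lagrange. rewrite F0, F1, G0, G1.
    replace (1 - alpha)%C with (1 + - alpha)%C by ring. set (B := Rcpow x (beta + 1)).
    rewrite !Rcpow_plus, !Rcpow_1 by lra.
    rewrite !(Rcpow_opp (t x) alpha).
    assert (Nt : RtoC (t x) <> RtoC 0) by (apply RtoC_neq_0; lra).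
    pose proof (Rcpow_neq_0 (t x) alpha). field. auto.
  - eapply Clim_eq.
    + apply Clim_mult; [apply Clim_mult; [apply Clim_const | apply Clim_Rcpow_id_at_one]|].
      repeat apply Clim_plus; apply Clim_mult.
      * apply Clim_mult; [apply Clim_const | apply Clim_Rcpow_t]. rewrite re_plus, re_RtoC; lra.
      * apply Clim_minus; apply Clim_mult; eassumption.
      * apply Clim_mult; [apply Clim_const | apply Clim_Rcpow_t]. rewrite re_RtoC; lra.
      * repeat apply Clim_minus; [apply Clim_plus | |]; apply Clim_mult; eassumption.
      * apply Clim_Rcpow_t. unfold Cminus. rewrite re_plus, re_RtoC. simpl. unfold Re in *. lra.
      * apply Clim_minus; apply Clim_mult; eassumption.
      * apply Clim_const.
      * apply Clim_minus; apply Clim_mult; eassumption.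
    + transitivity ((RtoC eps * RtoC eps) * (alpha * rho * (v 1%R * u2 1%R - u 1%R * v2 1%R)))%C; [ring|].
      rewrite eps_sqr. ring.
Qed.

End AtOne.
End Half.
End Local.

(** * Behaviour at 0 *)

Section AtZero.
Variables alpha beta : C.
Hypothesis hbeta : -1 < Re beta.

(** [f] agrees with the smooth [g] only for [x >= 0], but each [x > 0] has a neighbourhood of
    agreement, so the derivatives agree there and share their one-sided limits. *)
Lemma Clim_at_zero (f : R -> C) :
  (exists g : R -> C, Csmooth_near g 0 /\ locally 0 (fun x => 0 <= x -> f x = g x)) ->
  exists l0 l1 l2 : C, Clim (at_right 0) f l0 /\ Clim (at_right 0) (CDerive f) l1 /\
    Clim (at_right 0) (hyp_op alpha beta f) l2.
Proof.
  intros (g & Hg & E). pose proof (locally_singleton _ _ Hg) as S.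
  destruct (Csmooth_is_Cderive g 0 S) as (G1 & G2 & _).
  assert (L : at_right 0 (fun x => locally x (fun y => f y = g y))).
  { apply locally_locally in E. unfold at_right, within. eapply filter_imp; [|exact E].
    intros x Lx Hx. pose proof (locally_gt 0 x Hx) as L0.
    eapply filter_imp; [|exact (filter_and _ _ Lx L0)]. intros y [A B]. apply A. lra. }
  assert (R : filter_le (at_right 0) (locally 0)) by apply filter_le_at_right.
  exists (g 0), (CDerive g 0), (hyp_op alpha beta g 0). split; [|split].
  - apply (Clim_ext_loc g).
    + eapply filter_imp; [|exact L]. intros x Lx. symmetry. exact (locally_singleton _ _ Lx).
    + apply (Clim_filter_le _ _ _ _ R), (is_Cderive_Clim _ _ _ G1).
  - apply (Clim_ext_loc (CDerive g)).
    + eapply filter_imp; [|exact L]. intros x Lx. symmetry. apply CDerive_ext_loc, Lx.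
    + apply (Clim_filter_le _ _ _ _ R), (is_Cderive_Clim _ _ _ G2).
  - apply (Clim_ext_loc (hyp_op alpha beta g)).
    + eapply filter_imp; [|exact L]. intros x Lx. unfold hyp_op. symmetry. f_equal; f_equal.
      * apply CDerive_ext_loc. eapply filter_imp; [|apply (locally_locally _ _ Lx)].
        intros y Ly. apply CDerive_ext_loc, Ly.
      * apply CDerive_ext_loc, Lx.
    + apply (Clim_filter_le _ _ _ _ R), Clim_hyp_op_locally, S.
Qed.

Lemma power_bounded_at_zero (f g : R -> C) (a b : C) :
  Clim (at_right 0) f a -> Clim (at_right 0) g b ->
  power_bounded (at_right 0) (weighted alpha beta (fun x => 1 - x) f g).
Proof.
  intros Hf Hg.
  destruct (Clim_Cmod_le _ _ (Clim_mult _ _ _ _ (Clim_mult _ _ _ _ Hf Hg) (Clim_Rcpow_1_minus alpha))) as [N B].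
  (* The only singular factor is [x^beta], hence the exponent [k = Re beta + 1]. *)
  apply (power_bounded_intro (at_right 0) (fun x => x) (fun _ => 1) 1 (Re beta + 1) N).
  - apply convex_basis_at_right.
  - lra.
  - apply filterlim_id.
  - assert (P : at_right 0 (fun x => 0 < x)) by (apply at_right_01; intros; lra).
    eapply filter_imp; [|exact (filter_and _ _ P B)]. intros x [Hx Bx].
    split; [exact Hx|]. split; [apply is_derive_Rid|]. split; [lra|].
    replace (Re beta + 1 - 1) with (Re beta) by ring. rewrite !Rmult_1_r.
    unfold weighted. rewrite Cmod_mult, Cmod_Rcpow. apply Rmult_le_compat_r; [apply Rlt_le, exp_pos | exact Bx].
Qed.

Lemma Clim_lagrange_at_zero (f g : R -> C) (a b a1 b1 : C) :
  Clim (at_right 0) f a -> Clim (at_right 0) g b ->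
  Clim (at_right 0) (CDerive f) a1 -> Clim (at_right 0) (CDerive g) b1 ->
  Clim (at_right 0) (lagrange alpha beta 1 (fun x => 1 - x) f g) (RtoC 0).
Proof.
  intros Hf Hg Hf1 Hg1. eapply Clim_eq.
  - unfold lagrange. apply Clim_mult; [apply Clim_mult; [apply Clim_const | apply Clim_mult]|].
    + apply Clim_Rcpow_0. rewrite re_plus, re_RtoC; lra.
    + apply Clim_Rcpow_1_minus.
    + apply Clim_minus; apply Clim_mult; eassumption.
  - ring.
Qed.

End AtZero.

(** * Behaviour at infinity *)

Section AtInfinity.
Variables alpha beta : C.
Let G := Rbar_locally p_infty.

Lemma filterlim_Rinv_p_infty : filterlim (fun x => / x) G (at_right 0).
Proof.
  intros P HP. destruct (at_right_0_ex _ HP) as (d & Hd & H).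
  exists (/ d). intros x Hx. apply H.
  assert (0 < / d) by (apply Rinv_0_lt_compat; assumption).
  split; [apply Rinv_0_lt_compat; lra|].
  rewrite <- (Rinv_inv d). apply Rinv_lt_contravar; [apply Rmult_lt_0_compat|]; lra.
Qed.

Lemma Clim_Rinv (f : R -> C) (l : C) : Clim (at_right 0) f l -> Clim G (fun x => f (/ x)) l.
Proof. apply Clim_comp, filterlim_Rinv_p_infty. Qed.

Lemma is_Cderive_inv_pow (W : R -> C) (W1 s : C) (x : R) : 0 < x -> is_Cderive W (/ x) W1 ->
  is_Cderive (fun t => W (/ t)%R * Rcpow t (- s))%C x
    (- (RtoC (/ x) * RtoC (/ x) * W1 + s * RtoC (/ x) * W (/ x)%R) * Rcpow x (- s))%C.
Proof.
  intros Hx HW. eapply is_Cderive_eq.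
  - apply is_Cderive_mult; [|apply is_Cderive_Rcpow, Hx].
    apply (is_Cderive_comp W (fun t => / t) x W1 (- / x * / x)); [exact HW|].
    auto_derive; [lra | field; lra].
  - rewrite Rcpow_minus_1, RtoC_mult, RtoC_opp, RtoC_inv by lra. field. apply RtoC_neq_0; lra.
Qed.

(** With [y = 1/x] and [f = w(y) x^(-s)], the functions [f'], [f''] and the image of [f] under the
    operator are [x^(-s)] times [y dinv], [y^2 d2inv] and [hyp_op_inv]. Thus the operator preserves
    the form of the decay. *)
Definition dinv (s : C) (w : R -> C) (y : R) : C := (- (y * CDerive w y + s * w y))%C.

Definition d2inv (s : C) (w : R -> C) (y : R) : C :=
  (2 * y * CDerive w y + y * y * CDerive (CDerive w) y + s * w y + s * y * CDerive w y
   + s * (y * CDerive w y + s * w y))%C.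

Definition hyp_op_inv (s : C) (w : R -> C) (y : R) : C :=
  ((y - 1) * d2inv s w y + ((beta + 1) * y - (alpha + beta + 2)) * dinv s w y)%C.

Lemma expansion_at_infty (f w : R -> C) (s : C) :
  Csmooth_near w 0 -> G (fun x => f x = (w (/ x)%R * Rcpow x (- s))%C) ->
  G (fun x => 1 < x /\ f x = (w (/ x)%R * Rcpow x (- s))%C /\
    CDerive f x = (RtoC (/ x) * dinv s w (/ x)%R * Rcpow x (- s))%C /\
    hyp_op alpha beta f x = (hyp_op_inv s w (/ x)%R * Rcpow x (- s))%C).
Proof.
  intros [d Hw] [M HM].
  exists (Rmax (Rmax M 1) (/ d)). intros x Hx.
  (* Beyond [m] the expansion of [f] holds, [x > 1], and [1/x] lies where [w] is smooth. *)
  set (m := Rmax (Rmax M 1) (/ d)) in *.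
  pose proof (Rmax_l (Rmax M 1) (/ d)). pose proof (Rmax_r (Rmax M 1) (/ d)).
  pose proof (Rmax_l M 1). pose proof (Rmax_r M 1). fold m in H, H0.
  pose proof (cond_pos d) as Pd.
  assert (Sm : forall y, m < y -> Csmooth w (/ y)).
  { intros y Hy. apply Hw. change (Rabs (/ y - 0) < d). rewrite Rminus_0_r, Rabs_pos_eq.
    - rewrite <- (Rinv_inv d). assert (0 < / d) by (apply Rinv_0_lt_compat; assumption).
      apply Rinv_lt_contravar; [apply Rmult_lt_0_compat|]; lra.
    - apply Rlt_le, Rinv_0_lt_compat; lra. }
  set (f1 := fun y : R => (- (RtoC (/ y) * RtoC (/ y) * CDerive w (/ y)%R + s * RtoC (/ y) * w (/ y)%R) * Rcpow y (- s))%C).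
  assert (D1 : forall y, locally y (fun z => m < z) -> is_Cderive f y (f1 y)).
  { intros y Ly. pose proof (locally_singleton _ _ Ly) as Hy.
    apply (is_Cderive_ext_loc (fun t => w (/ t)%R * Rcpow t (- s))%C).
    - eapply filter_imp; [|exact Ly]. intros z Hz. symmetry. apply HM. lra.
    - apply is_Cderive_inv_pow; [lra|]. apply (Csmooth_is_Cderive w _ (Sm y Hy)). }
  destruct (Csmooth_is_Cderive w (/ x) (Sm x Hx)) as (W1 & W2 & _).
  set (y := / x) in *.
  assert (D2 : is_Cderive f1 x (- (y * y * (- (1 * y * CDerive w y + y * (1 * CDerive w y + y * CDerive (CDerive w) y)
       + (s * 1 * w y + s * y * CDerive w y)))
     + s * y * (- (y * y * CDerive w y + s * y * w y))) * Rcpow x (- s))%C).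
  { apply (is_Cderive_ext_loc (fun t => (fun z : R => (- (z * z * CDerive w z + s * z * w z))%C) (/ t)%R * Rcpow t (- s))%C).
    - apply filter_forall. intros t. reflexivity.
    - apply (is_Cderive_inv_pow (fun z : R => (- (z * z * CDerive w z + s * z * w z))%C)); [lra|].
      fold y. apply is_Cderive_opp.
      eapply is_Cderive_eq.
      + apply is_Cderive_plus; (apply is_Cderive_mult; [|eassumption]).
        * apply is_Cderive_mult; apply is_Cderive_id.
        * apply is_Cderive_scal, is_Cderive_id.
      + cbv beta. ring. }
  destruct (CDerive_eq_loc f f1 (fun z => m < z) x _ (locally_gt m x Hx) D1 D2) as [E1 E2].
  split; [lra|]. split; [apply HM; lra|]. split.
  - rewrite E1. unfold f1, dinv. fold y. ring.
  - unfold hyp_op. rewrite E2, E1. unfold f1, hyp_op_inv, d2inv, dinv. fold y.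
    assert (Ny : RtoC y <> RtoC 0).
    { apply RtoC_neq_0. unfold y. apply Rinv_neq_0_compat. lra. }
    assert (Ex : RtoC x = (/ RtoC y)%C).
    { rewrite <- RtoC_inv; [unfold y; rewrite Rinv_inv; reflexivity|].
      intros Z. apply Ny. rewrite Z. reflexivity. }
    rewrite Ex. set (T := Rcpow x (- s)). field. exact Ny.
Qed.

Lemma Clim_at_infty (w : R -> C) (s : C) : Csmooth_near w 0 ->
  exists l0 l1 l2, Clim (at_right 0) w l0 /\ Clim (at_right 0) (dinv s w) l1 /\
    Clim (at_right 0) (hyp_op_inv s w) l2.
Proof.
  intros Hw. pose proof (locally_singleton _ _ Hw) as S.
  destruct (Csmooth_is_Cderive w 0 S) as (W1 & W2 & W3).
  assert (R : filter_le (at_right 0) (locally 0)) by apply filter_le_at_right.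
  apply is_Cderive_Clim in W1. apply is_Cderive_Clim in W2.
  apply (Clim_filter_le _ _ _ _ R) in W1. apply (Clim_filter_le _ _ _ _ R) in W2.
  apply (Clim_filter_le _ _ _ _ R) in W3.
  pose proof Clim_id_0 as X.
  assert (D : exists l, Clim (at_right 0) (dinv s w) l).
  { eexists. unfold dinv. apply Clim_opp, Clim_plus; apply Clim_mult; try eassumption. apply Clim_const. }
  assert (D2 : exists l, Clim (at_right 0) (d2inv s w) l).
  { eexists. unfold d2inv. repeat apply Clim_plus.
    - apply Clim_mult; [apply Clim_mult; [apply Clim_const | exact X] | exact W2].
    - apply Clim_mult; [apply Clim_mult; exact X | exact W3].
    - apply Clim_mult; [apply Clim_const | exact W1].
    - apply Clim_mult; [apply Clim_mult; [apply Clim_const | exact X] | exact W2].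
    - apply Clim_mult; [apply Clim_const|]. apply Clim_plus; apply Clim_mult; try eassumption. apply Clim_const. }
  destruct D as [l1 L1]. destruct D2 as [l2 L2].
  eexists; exists l1; eexists. split; [exact W1|]. split; [exact L1|].
  unfold hyp_op_inv. apply Clim_plus; apply Clim_mult; try eassumption.
  - apply Clim_minus; [exact X | apply Clim_const].
  - apply Clim_minus; [apply Clim_mult; [apply Clim_const | exact X] | apply Clim_const].
Qed.

Lemma Rcpow_sub_1 (x : R) (s : C) : 1 < x -> Rcpow (x - 1) s = (Rcpow x s * Rcpow (1 - / x) s)%C.
Proof.
  intros Hx. rewrite <- Rcpow_mult; [f_equal; field; lra | lra |].
  assert (/ x < 1) by (rewrite <- Rinv_1; apply Rinv_lt_contravar; lra). lra.
Qed.

(** The integrand is of order [x^(-(k+1))], that is [t^(k-1) |t'|] for [t = 1/x]; the sign is -1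
    because [t] decreases. *)
Lemma power_bounded_at_infty (f g A B : R -> C) (s s' a b : C) (k : R) :
  0 < k -> Re (s + s' - alpha - beta)%C = k + 1 ->
  Clim (at_right 0) A a -> Clim (at_right 0) B b ->
  G (fun x => 1 < x /\ f x = (A (/ x)%R * Rcpow x (- s))%C) -> G (fun x => g x = (B (/ x)%R * Rcpow x (- s'))%C) ->
  power_bounded G (weighted alpha beta (fun x => x - 1) f g).
Proof.
  intros Hk Ek LA LB Ef Eg.
  pose proof (Clim_Rinv _ _ (Clim_mult _ _ _ _ (Clim_mult _ _ _ _ LA LB) (Clim_Rcpow_1_minus alpha))) as L.
  destruct (Clim_Cmod_le _ _ L) as [N BN].
  apply (power_bounded_intro G (fun x => / x) (fun x => - / x * / x) (-1) k N).
  - apply convex_basis_p_infty.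
  - exact Hk.
  - exact filterlim_Rinv_p_infty.
  - eapply filter_imp; [|exact (filter_and _ _ Ef (filter_and _ _ Eg BN))].
    intros x ((Hx & Fx) & Gx & Bx).
    assert (Px : 0 < / x) by (apply Rinv_0_lt_compat; lra).
    split; [exact Px|]. split; [auto_derive; [lra | field; lra]|]. split; [nra|].
    unfold weighted. rewrite Fx, Gx, Rcpow_sub_1 by exact Hx.
    replace (A (/ x)%R * Rcpow x (- s) * (B (/ x)%R * Rcpow x (- s')) * (Rcpow x alpha * Rcpow (1 - / x) alpha) * Rcpow x beta)%C
      with (A (/ x)%R * B (/ x)%R * Rcpow (1 - / x) alpha * Rcpow x (- s + - s' + alpha + beta))%C
      by (rewrite !Rcpow_plus; ring).
    rewrite Cmod_mult, Cmod_Rcpow.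
    replace (- s + - s' + alpha + beta)%C with (- (s + s' - alpha - beta))%C by ring.
    replace (Re (- (s + s' - alpha - beta))%C) with (- (k + 1)) by (rewrite <- Ek; reflexivity).
    rewrite Rmult_assoc.
    replace (Rpower (/ x) (k - 1) * (-1 * (- / x * / x))) with (Rpower x (- (k + 1))).
    + apply Rmult_le_compat_r; [apply Rlt_le, exp_pos | exact Bx].
    + replace (-1 * (- / x * / x)) with (/ x * / x) by ring.
      rewrite <- (Rpower_1 (/ x) Px) at 2 3. rewrite <- !Rpower_plus.
      unfold Rpower. rewrite ln_Rinv by lra. f_equal. ring.
Qed.

(** In [y = 1/x] the concomitant is [y^(s + s' - alpha - beta - 1)] times a function with a finite
    limit at 0. *)
Lemma Clim_lagrange_at_infty (f w g w2 : R -> C) (s s' : C) :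
  0 < Re (s + s' - alpha - beta - 1)%C ->
  Csmooth_near w 0 -> Csmooth_near w2 0 ->
  G (fun x => f x = (w (/ x)%R * Rcpow x (- s))%C) -> G (fun x => g x = (w2 (/ x)%R * Rcpow x (- s'))%C) ->
  Clim G (lagrange alpha beta (-1) (fun x => x - 1) f g) (RtoC 0).
Proof.
  intros Hk Hw Hw2 Hf Hg.
  pose proof (expansion_at_infty f w s Hw Hf) as Ef. pose proof (expansion_at_infty g w2 s' Hw2 Hg) as Eg.
  destruct (Clim_at_infty w s Hw) as (l0 & l1 & _ & L0 & L1 & _).
  destruct (Clim_at_infty w2 s' Hw2) as (m0 & m1 & _ & M0 & M1 & _).
  set (h := fun y : R => ((-1)%R * (Rcpow y (s + s' - alpha - beta - 1) * Rcpow (1 - y) (alpha + 1))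
     * (dinv s w y * w2 y - w y * dinv s' w2 y))%C).
  apply (Clim_ext_loc (fun x => h (/ x))).
  - eapply filter_imp; [|exact (filter_and _ _ Ef Eg)].
    intros x ((Hx & F0 & F1 & _) & (_ & G0 & G1 & _)). unfold h, lagrange.
    rewrite F0, F1, G0, G1, Rcpow_sub_1, Rcpow_inv by lra.
    replace (- (s + s' - alpha - beta - 1))%C with (- s + - s' + alpha + (beta + 1))%C by ring.
    rewrite !Rcpow_plus, (Rcpow_1 x), RtoC_inv by lra.
    field. apply RtoC_neq_0; lra.
  - eapply Clim_eq.
    + apply (Clim_Rinv h). unfold h.
      apply Clim_mult; [apply Clim_mult; [apply Clim_const | apply Clim_mult]|].
      * apply Clim_Rcpow_0, Hk.
      * apply Clim_Rcpow_1_minus.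
      * apply Clim_minus; apply Clim_mult; eassumption.
    + ring.
Qed.

End AtInfinity.

(** * Symmetry of the form *)

Lemma open_half (t : R -> R) (eps x : R) : (forall x, t x = eps * (1 - x)) ->
  0 < x /\ 0 < t x -> locally x (fun y => 0 < y /\ 0 < t y).
Proof.
  intros ht [Hx Tx]. apply filter_and; [apply locally_gt, Hx | apply (locally_t_pos eps t ht), Tx].
Qed.

Lemma convex_half (t : R -> R) (eps : R) : (forall x, t x = eps * (1 - x)) ->
  convex (fun y => 0 < y /\ 0 < t y).
Proof.
  intros ht x y z [Hx Tx] [Hy Ty] Hz. rewrite ht in *. split; [lra|]. destruct (Rle_dec 0 eps); nra.
Qed.

(** The domain [0 < x], [0 < t x] is (0,1) for [eps = 1] and (1,oo) for [eps = -1]. *)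
Lemma CRInt_gen_weighted_green (alpha beta : C) (eps x0 : R) (t : R -> R) (Fa Fb : (R -> Prop) -> Prop)
    {PA : ProperFilter Fa} {PB : ProperFilter Fb} (f g : R -> C) (pa pb : C) :
  (eps = 1 \/ eps = -1) -> (forall x, t x = eps * (1 - x)) ->
  0 < x0 -> 0 < t x0 ->
  Fa (fun x => 0 < x /\ 0 < t x) -> Fb (fun x => 0 < x /\ 0 < t x) ->
  (forall x, 0 < x -> x <> 1 -> Csmooth f x) -> (forall x, 0 < x -> x <> 1 -> Csmooth g x) ->
  power_bounded Fa (weighted alpha beta t (hyp_op alpha beta f) g) ->
  power_bounded Fb (weighted alpha beta t (hyp_op alpha beta f) g) ->
  power_bounded Fa (weighted alpha beta t f (hyp_op alpha beta g)) ->
  power_bounded Fb (weighted alpha beta t f (hyp_op alpha beta g)) ->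
  Clim Fa (lagrange alpha beta eps t f g) pa -> Clim Fb (lagrange alpha beta eps t f g) pb ->
  ex_CRInt_gen (weighted alpha beta t (hyp_op alpha beta f) g) Fa Fb /\
  ex_CRInt_gen (weighted alpha beta t f (hyp_op alpha beta g)) Fa Fb /\
  CRInt_gen (weighted alpha beta t (hyp_op alpha beta f) g) Fa Fb
  = (CRInt_gen (weighted alpha beta t f (hyp_op alpha beta g)) Fa Fb + (pb - pa))%C.
Proof.
  intros heps ht X0 T0 DA DB Sf Sg A1 B1 A2 B2 LA LB.
  assert (S1 : forall x, 0 < x /\ 0 < t x -> Csmooth f x /\ Csmooth g x).
  { intros x [Hx Tx]. rewrite ht in Tx. split; [apply Sf | apply Sg]; try exact Hx; intros E; rewrite E in Tx; lra. }
  apply (CRInt_gen_green _ _ (lagrange alpha beta eps t f g) (fun x => 0 < x /\ 0 < t x) x0); try assumption.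
  - exact (convex_half t eps ht).
  - intros x Hx. exact (open_half t eps x ht Hx).
  - split; assumption.
  - intros x Hx. destruct (S1 x Hx) as [F0 G0]. destruct Hx.
    apply (Clim_weighted alpha beta eps t ht); try assumption.
    + apply Clim_hyp_op_locally, F0.
    + apply (is_Cderive_Clim _ _ _ (proj1 (Csmooth_is_Cderive g x G0))).
  - intros x Hx. destruct (S1 x Hx) as [F0 G0]. destruct Hx.
    apply (Clim_weighted alpha beta eps t ht); try assumption.
    + apply (is_Cderive_Clim _ _ _ (proj1 (Csmooth_is_Cderive f x F0))).
    + apply Clim_hyp_op_locally, G0.
  - intros x Hx. destruct (S1 x Hx) as [F0 G0]. destruct Hx.
    apply is_Cderive_lagrange; assumption.
Qed.

Lemma filterlim_1_minus_at_left : filterlim (fun x => 1 - x) (at_left 1) (at_right 0).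
Proof.
  intros P [d Hd]. exists d. intros x Bx Hx. apply Hd; [|lra].
  change (Rabs (x - 1) < d) in Bx. change (Rabs (1 - x - 0) < d).
  rewrite Rabs_minus_sym in Bx. rewrite Rminus_0_r. exact Bx.
Qed.

Lemma filterlim_minus_1_at_right : filterlim (fun x => x - 1) (at_right 1) (at_right 0).
Proof.
  intros P [d Hd]. exists d. intros x Bx Hx. apply Hd; [|lra].
  change (Rabs (x - 1) < d) in Bx. change (Rabs (x - 1 - 0) < d). rewrite Rminus_0_r. exact Bx.
Qed.

Lemma filter_le_at_left (a : R) : filter_le (at_left a) (locally a).
Proof. intros P HP. unfold at_left, within. eapply filter_imp; [|exact HP]. auto. Qed.

Section Symmetry.
Variables alpha beta theta : C.
Hypothesis halpha : -1 < Re alpha < 1.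
Hypothesis hbeta : -1 < Re beta.
Hypothesis hE : Csin ((alpha + theta) * PI)%C <> RtoC 0.
Hypothesis htheta : Csin (theta * PI)%C <> RtoC 0.
Variables f g : R -> C.
Hypothesis hf : space_E alpha beta theta f.
Hypothesis hg : space_E alpha beta theta g.

Let Df := hyp_op alpha beta f.
Let Dg := hyp_op alpha beta g.

Lemma form_symmetric : ex_form alpha beta Df g /\ ex_form alpha beta f Dg /\
  form alpha beta theta Df g = form alpha beta theta f Dg.
Proof.
  set (rho := (Csin (theta * PI) / Csin ((alpha + theta) * PI))%C).
  destruct hf as (Sf & Zf & (u & v & Hu & Hv & Of) & (r & w & Hr & Hw & If)).
  destruct hg as (Sg & Zg & (u2 & v2 & Hu2 & Hv2 & Og) & (r2 & w2 & Hr2 & Hw2 & Ig)).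
  set (tl := fun x => 1 - x). set (tr := fun x => x - 1).
  assert (htl : forall x, tl x = 1 * (1 - x)) by (intros; unfold tl; ring).
  assert (htr : forall x, tr x = -1 * (1 - x)) by (intros; unfold tr; ring).
  assert (Ofl : locally 1 (fun x => 0 < tl x -> f x = (1 * u x + v x * Rcpow (tl x) (- alpha))%C)).
  { eapply filter_imp; [|exact Of]. intros x [E _] Tx. unfold tl in *. rewrite E by lra. ring. }
  assert (Ogl : locally 1 (fun x => 0 < tl x -> g x = (1 * u2 x + v2 x * Rcpow (tl x) (- alpha))%C)).
  { eapply filter_imp; [|exact Og]. intros x [E _] Tx. unfold tl in *. rewrite E by lra. ring. }
  assert (Ofr : locally 1 (fun x => 0 < tr x -> f x = (rho * u x + v x * Rcpow (tr x) (- alpha))%C)).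
  { eapply filter_imp; [|exact Of]. intros x [_ E] Tx. unfold tr in *. apply E. lra. }
  assert (Ogr : locally 1 (fun x => 0 < tr x -> g x = (rho * u2 x + v2 x * Rcpow (tr x) (- alpha))%C)).
  { eapply filter_imp; [|exact Og]. intros x [_ E] Tx. unfold tr in *. apply E. lra. }
  (* Stated for both sides of 1 at once; the coefficient [c] of the regular part will be 1 on the
     left and [rho] on the right. *)
  assert (PBone : forall eps t G, ProperFilter G -> (eps = 1 \/ eps = -1) -> (forall x, t x = eps * (1 - x)) ->
     filterlim t G (at_right 0) -> filter_le G (locally 1) -> convex_basis G ->
     forall c,
     locally 1 (fun x => 0 < t x -> f x = (c * u x + v x * Rcpow (t x) (- alpha))%C) ->
     locally 1 (fun x => 0 < t x -> g x = (c * u2 x + v2 x * Rcpow (t x) (- alpha))%C) ->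
     power_bounded G (weighted alpha beta t Df g) /\ power_bounded G (weighted alpha beta t f Dg)).
  { intros eps t G PG heps ht hGt hG1 hGc c Hf Hg.
    pose proof (expansion_at_one alpha beta eps t heps ht G hGt hG1 f u v c Hu Hv Hf) as Ef.
    pose proof (expansion_at_one alpha beta eps t heps ht G hGt hG1 g u2 v2 c Hu2 Hv2 Hg) as Eg.
    destruct (Clim_at_one alpha beta G hG1 u Hu) as (U0 & _ & U2 & _).
    destruct (Clim_at_one alpha beta G hG1 v Hv) as (V0 & _ & _ & V2).
    destruct (Clim_at_one alpha beta G hG1 u2 Hu2) as (W0 & _ & W2 & _).
    destruct (Clim_at_one alpha beta G hG1 v2 Hv2) as (Y0 & _ & _ & Y2).
    split.
    - apply (power_bounded_at_one alpha beta eps t heps ht G hGt hG1 hGc halpha _ _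
        (fun x => c * hyp_op alpha beta u x)%C (hyp_op_sing alpha beta v) (fun x => c * u2 x)%C v2 _ _ _ _
        (Clim_mult _ _ _ _ (Clim_const c) U2) V2 (Clim_mult _ _ _ _ (Clim_const c) W0) Y0).
      + eapply filter_imp; [|exact Ef]. intros x (_ & _ & _ & E). exact E.
      + eapply filter_imp; [|exact Eg]. intros x (_ & E & _). exact E.
    - apply (power_bounded_at_one alpha beta eps t heps ht G hGt hG1 hGc halpha _ _
        (fun x => c * u x)%C v (fun x => c * hyp_op alpha beta u2 x)%C (hyp_op_sing alpha beta v2) _ _ _ _
        (Clim_mult _ _ _ _ (Clim_const c) U0) V0 (Clim_mult _ _ _ _ (Clim_const c) W2) Y2).
      + eapply filter_imp; [|exact Ef]. intros x (_ & E & _). exact E.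
      + eapply filter_imp; [|exact Eg]. intros x (_ & _ & _ & E). exact E. }
  set (delta := (v 1%R * u2 1%R - u 1%R * v2 1%R)%C).
  destruct (PBone 1 tl (at_left 1) _ (or_introl eq_refl) htl filterlim_1_minus_at_left (filter_le_at_left 1)
    (convex_basis_at_left 1) (RtoC 1) Ofl Ogl) as [B1 B2].
  pose proof (Clim_lagrange_at_one alpha beta 1 tl (or_introl eq_refl) htl (at_left 1) filterlim_1_minus_at_left
    (filter_le_at_left 1) halpha f u v g u2 v2 (RtoC 1) Hu Hv Hu2 Hv2 Ofl Ogl) as LB.
  destruct (Clim_at_zero alpha beta f Zf) as (a0 & a1 & a2 & A0 & A1 & A2).
  destruct (Clim_at_zero alpha beta g Zg) as (b0 & b1 & b2 & C0 & C1 & C2).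
  destruct (CRInt_gen_weighted_green alpha beta 1 (/ 2) tl (at_right 0) (at_left 1) f g
    (RtoC 0) (alpha * 1 * delta)%C) as (X1 & X2 & XE); try assumption.
  { left; reflexivity. }
  { lra. }
  { unfold tl; lra. }
  { apply at_right_01. intros z Hz. unfold tl. lra. }
  { exists (mkposreal 1 Rlt_0_1). intros y By Hy. change (Rabs (y - 1) < 1) in By. apply Rabs_def2 in By.
    unfold tl. lra. }
  { exact (power_bounded_at_zero alpha beta hbeta _ _ _ _ A2 C0). }
  { exact (power_bounded_at_zero alpha beta hbeta _ _ _ _ A0 C2). }
  { exact (Clim_lagrange_at_zero alpha beta hbeta f g _ _ _ _ A0 C0 A1 C1). }
  destruct (PBone (-1) tr (at_right 1) _ (or_intror eq_refl) htr filterlim_minus_1_at_right (filter_le_at_right 1)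
    (convex_basis_at_right 1) rho Ofr Ogr) as [B3 B4].
  pose proof (Clim_lagrange_at_one alpha beta (-1) tr (or_intror eq_refl) htr (at_right 1) filterlim_minus_1_at_right
    (filter_le_at_right 1) halpha f u v g u2 v2 rho Hu Hv Hu2 Hv2 Ofr Ogr) as LA.
  set (s := (alpha + beta + r + 1)%C). set (s2 := (alpha + beta + r2 + 1)%C).
  assert (If' : Rbar_locally p_infty (fun x => f x = (w (/ x)%R * Rcpow x (- s))%C)).
  { replace (- s)%C with (- alpha - beta - r - 1)%C by (unfold s; ring). exact If. }
  assert (Ig' : Rbar_locally p_infty (fun x => g x = (w2 (/ x)%R * Rcpow x (- s2))%C)).
  { replace (- s2)%C with (- alpha - beta - r2 - 1)%C by (unfold s2; ring). exact Ig. }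
  destruct Hr as ((_ & Rr & _) & _). destruct Hr2 as ((_ & Rr2 & _) & _).
  (* Positive as the mean of [Re (2r + alpha + beta + 1)] and the same quantity for [r2]. *)
  set (k := Re (r + r2 + alpha + beta + 1)%C).
  assert (Hk : 0 < k).
  { unfold k. rewrite !re_plus, re_RtoC in *. rewrite !re_scal_l in *. lra. }
  assert (Ek : Re (s + s2 - alpha - beta)%C = k + 1).
  { unfold k, s, s2. replace (alpha + beta + r + 1 + (alpha + beta + r2 + 1) - alpha - beta)%C
      with ((r + r2 + alpha + beta + 1) + 1)%C by ring. rewrite re_plus, re_RtoC. reflexivity. }
  assert (Ek' : 0 < Re (s + s2 - alpha - beta - 1)%C).
  { unfold Cminus at 1. rewrite re_plus. change (Re (- RtoC 1)) with (- 1). rewrite Ek. lra. }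
  destruct (Clim_at_infty alpha beta w s Hw) as (c0 & _ & c2 & P0 & _ & P2).
  destruct (Clim_at_infty alpha beta w2 s2 Hw2) as (d0 & _ & d2 & Q0 & _ & Q2).
  pose proof (expansion_at_infty alpha beta f w s Hw If') as Ef.
  pose proof (expansion_at_infty alpha beta g w2 s2 Hw2 Ig') as Eg.
  destruct (CRInt_gen_weighted_green alpha beta (-1) 2 tr (at_right 1) (Rbar_locally p_infty) f g
    (alpha * rho * delta)%C (RtoC 0)) as (Y1 & Y2 & YE); try assumption.
  { right; reflexivity. }
  { lra. }
  { unfold tr; lra. }
  { exists (mkposreal 1 Rlt_0_1). intros y By Hy. unfold tr. lra. }
  { exists 1. intros y Hy. unfold tr. lra. }
  { apply (power_bounded_at_infty alpha beta _ _ (hyp_op_inv alpha beta s w) w2 s s2 c2 d0 k Hk Ek P2 Q0).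
    - eapply filter_imp; [|exact Ef]. intros x (Hx & _ & _ & E). split; assumption.
    - exact Ig'. }
  { apply (power_bounded_at_infty alpha beta _ _ w (hyp_op_inv alpha beta s2 w2) s s2 c0 d2 k Hk Ek P0 Q2).
    - eapply filter_imp; [|exact Ef]. intros x (Hx & E & _). split; assumption.
    - eapply filter_imp; [|exact Eg]. intros x (_ & _ & _ & E). exact E. }
  { exact (Clim_lagrange_at_infty alpha beta f w g w2 s s2 Ek' Hw Hw2 If' Ig'). }
  split; [exact (conj X1 Y1)|]. split; [exact (conj X2 Y2)|].
  unfold form.
  change (form_integrand_lt1 alpha beta Df g) with (weighted alpha beta tl (hyp_op alpha beta f) g).
  change (form_integrand_gt1 alpha beta Df g) with (weighted alpha beta tr (hyp_op alpha beta f) g).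
  change (form_integrand_lt1 alpha beta f Dg) with (weighted alpha beta tl f (hyp_op alpha beta g)).
  change (form_integrand_gt1 alpha beta f Dg) with (weighted alpha beta tr f (hyp_op alpha beta g)).
  (* The boundary terms are [alpha delta] from (0,1) and [- alpha rho delta] from (1,oo), and the
     second integral has weight [1 / rho]. *)
  rewrite XE, YE. unfold rho. field. split; assumption.
Qed.

End Symmetry.

Theorem theorem2 (alpha beta theta : C)
    (htheta : 0 <= Re theta < 1)
    (halpha : -1 < Re alpha < 1)
    (halpha0 : alpha <> RtoC 0)
    (hbeta : -1 < Re beta)
    (* the denominator occurring in the definition of the space E *)
    (hE : Csin ((alpha + theta) * PI) <> RtoC 0) :
  (forall p : C, index_set alpha beta theta p ->
     space_E alpha beta theta (Phi alpha beta p)) /\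
  ((* the denominator occurring in the bilinear form *)
   Csin (theta * PI) <> RtoC 0 ->
   forall f g : R -> C,
     space_E alpha beta theta f -> space_E alpha beta theta g ->
     ex_form alpha beta (hyp_op alpha beta f) g /\
     ex_form alpha beta f (hyp_op alpha beta g) /\
     form alpha beta theta (hyp_op alpha beta f) g =
     form alpha beta theta f (hyp_op alpha beta g)).
Proof.
  split.
  - intros p hp. apply Phi_space_E; assumption.
  - intros hs f g hf hg. apply form_symmetric; assumption.
Qed.
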